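(* Let $\mathcal T$ be a triangulation of the sphere with more than four vertices, with vertex set $V$ and edge set $E$. Let $W\subset[0,\pi)^{|E|}$ be the set of functions $\Theta:E\to[0,\pi)$ satisfying the following four conditions. (1) If $e_1,e_2,e_3$ form the boundary of a triangle of $\mathcal T$, then $\Theta(e_1)+\Theta(e_2)<\Theta(e_3)+\pi$, $\Theta(e_2)+\Theta(e_3)<\Theta(e_1)+\pi$ and $\Theta(e_3)+\Theta(e_1)<\Theta(e_2)+\pi$. (2) If $e_1,e_2$ form a homologically non-adjacent arc, then $\Theta(e_1)+\Theta(e_2)\le\pi$; and, when $\mathcal T$ is the boundary of a triangular bipyramid, at least one of these inequalities is strict. (3) If $e_1,e_2,e_3$ form a simple closed curve separating the vertices of $\mathcal T$, then $\sum_{\mu=1}^3\Theta(e_\mu)<\pi$. (4) If $e_1,e_2,e_3,e_4$ form a simple closed curve separating the vertices of $\mathcal T$, then $\sum_{\mu=1}^4\Theta(e_\mu)<2\pi$. Then for almost every $\Theta\in W$, up to linear and anti-linear fractional maps, there are at most finitely many irreducible circle patterns on $\hat{\mathbb C}$ realizing the data $(\mathcal T,\Theta)$.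
   Context: Triangulations are finite simplicial complexes. ''Almost every'' is with respect to Lebesgue measure on $\mathbb R^{|E|}$. A circle pattern $\mathcal P=\{D_v\}_{v\in V}$ on the Riemann sphere $\hat{\mathbb C}$ is a collection of closed round disks. Its contact graph has a vertex for each disk and an edge $[u,w]$ whenever $D_u\cap D_w\neq\emptyset$. For each edge $[u,w]$ of the contact graph one has the exterior intersection angle $\Theta([u,w])\in[0,\pi)$: it is $0$ when $D_u,D_w$ are tangent and meet in exactly one point, and when $\partial D_u,\partial D_w$ cross at two points the interior angle of the lens $D_u\cap D_w$ is $\pi-\Theta([u,w])$. The pattern is irreducible if $\bigcup_{v\in A}D_v\subsetneq\hat{\mathbb C}$ for every proper subset $A\subsetneq V$. It realizes the data $(\mathcal T,\Theta)$ if its contact graph is isomorphic to the $1$-skeleton of $\mathcal T$ and its exterior intersection angles are given by $\Theta$. A simple arc formed by edges of $\mathcal T$ is homologically adjacent if there is an edge of $\mathcal T$ between its starting and ending points, and homologically non-adjacent otherwise. A simple closed curve formed by edges separates the vertices of $\mathcal T$ if both components of its complement in the sphere contain at least one vertex of $\mathcal T$. Linear (resp. anti-linear) fractional maps are the orientation-preserving (resp. orientation-reversing) Möbius transformations of $\hat{\mathbb C}$. *)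

(* Defs.v *)
From HB Require Import structures.
From mathcomp Require Import all_boot all_order all_algebra.
From mathcomp Require Import all_classical all_reals all_analysis.
From mathcomp Require Import complex.

Set Implicit Arguments.
Unset Strict Implicit.
Unset Printing Implicit Defensive.

Import Order.TTheory GRing.Theory Num.Theory ComplexField.Normc numFieldNormedType.Exports.

Local Open Scope classical_set_scope.
Local Open Scope ring_scope.

(** * Triangulations of the sphere *)

(* A finite abstract simplicial complex with vertex set exactly 'I_n, given by
   its nonempty simplices. *)
Record simplicial_complex n (K : {set {set 'I_n}}) : Prop := {
  simplex_nonempty : finset.set0 \notin K;
  simplex_face : forall s t : {set 'I_n},
    s \in K -> t \subset s -> t != finset.set0 -> t \in K;
  simplex_vertex : forall v : 'I_n, [set v]%SET \in K }.

Definition edge n (K : {set {set 'I_n}}) :=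
  {e : {set 'I_n} | (e \in K) && (#|e| == 2)%N}.

Definition carrier (R : realType) n (x : 'rV[R]_n) : {set 'I_n} :=
  [set v | x ord0 v != 0]%SET.

(* Geometric realization |K|, in barycentric coordinates. *)
Definition realization (R : realType) n (K : {set {set 'I_n}}) :
    set 'rV[R]_n :=
  [set x : 'rV[R]_n | [/\ forall v, 0 <= x ord0 v, \sum_v x ord0 v = 1
             & carrier x \in K]].

Definition vertex_point (R : realType) n (v : 'I_n) : 'rV[R]_n :=
  delta_mx ord0 v.

Definition unit_sphere (R : realType) : set 'rV[R]_3 :=
  [set x : 'rV[R]_3 | \sum_i x ord0 i ^+ 2 = 1].

Definition homeomorphic (X Y : topologicalType) (A : set X) (B : set Y) : Prop :=
  exists (f : X -> Y) (g : Y -> X),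
    [/\ {within A, continuous f} /\ {within B, continuous g},
        f @` A `<=` B, g @` B `<=` A,
        (forall x, A x -> g (f x) = x)
      & forall y, B y -> f (g y) = y].

Definition sphere_triangulation (R : realType) n (K : {set {set 'I_n}}) : Prop :=
  simplicial_complex K /\
  homeomorphic (@realization R n K) (@unit_sphere R).

(* Two triangles {p, q1, q2} for each pair of the equator {x, y, z}, one with
   p = a and one with p = b. *)
Definition bipyramid_boundary n (K : {set {set 'I_n}}) : Prop :=
  exists a b x y z : 'I_n,
    uniq [:: a; b; x; y; z] /\
    forall s : {set 'I_n}, s \in K <->
      s != finset.set0 /\
      exists p q : 'I_n, [/\ p \in [set a; b]%SET, q \in [set x; y; z]%SET
        & s \subset (p |: ([set x; y; z] :\ q))%SET].

(* [c] is the set of edges of a simple closed curve. *)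
Definition curve_complement (R : realType) n (K c : {set {set 'I_n}}) :
    set 'rV[R]_n :=
  realization K `\` [set x : 'rV[R]_n | exists2 e, e \in c & carrier x \subset e].

Definition separates_vertices (R : realType) n (K c : {set {set 'I_n}}) : Prop :=
  forall x, @curve_complement R n K c x -> exists v : 'I_n,
    connected_component (@curve_complement R n K c) x (vertex_point R v).

(** * The set W of angle functions *)

Section AngleConditions.
Variables (R : realType) (n : nat) (K : {set {set 'I_n}}).
Implicit Types (Theta : {ffun edge K -> R}) (e : edge K) (u v w : 'I_n).

Definition cond_triangle Theta : Prop :=
  forall e1 e2 e3 u v w, uniq [:: u; v; w] ->
    val e1 = [set u; v]%SET -> val e2 = [set v; w]%SET ->
    val e3 = [set w; u]%SET -> [set u; v; w]%SET \in K ->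
    [/\ Theta e1 + Theta e2 < Theta e3 + pi,
        Theta e2 + Theta e3 < Theta e1 + pi
      & Theta e3 + Theta e1 < Theta e2 + pi].

Definition nonadjacent_arc e1 e2 : Prop :=
  exists u v w, [/\ uniq [:: u; v; w], val e1 = [set u; v]%SET,
    val e2 = [set v; w]%SET & [set u; w]%SET \notin K].

Definition cond_arc Theta : Prop :=
  (forall e1 e2, nonadjacent_arc e1 e2 -> Theta e1 + Theta e2 <= pi) /\
  (bipyramid_boundary K ->
   exists e1 e2, nonadjacent_arc e1 e2 /\ Theta e1 + Theta e2 < pi).

Definition cond_curve3 Theta : Prop :=
  forall e1 e2 e3 u v w, uniq [:: u; v; w] ->
    val e1 = [set u; v]%SET -> val e2 = [set v; w]%SET ->
    val e3 = [set w; u]%SET ->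
    separates_vertices R K [set val e1; val e2; val e3]%SET ->
    Theta e1 + Theta e2 + Theta e3 < pi.

Definition cond_curve4 Theta : Prop :=
  forall e1 e2 e3 e4 u v w t, uniq [:: u; v; w; t] ->
    val e1 = [set u; v]%SET -> val e2 = [set v; w]%SET ->
    val e3 = [set w; t]%SET -> val e4 = [set t; u]%SET ->
    separates_vertices R K [set val e1; val e2; val e3; val e4]%SET ->
    Theta e1 + Theta e2 + Theta e3 + Theta e4 < 2 * pi.

Definition W : set {ffun edge K -> R} :=
  [set Theta : {ffun edge K -> R} | (forall e, 0 <= Theta e < pi) /\
    [/\ cond_triangle Theta, cond_arc Theta, cond_curve3 Theta
      & cond_curve4 Theta]].

End AngleConditions.

(** * The Riemann sphere and its Moebius transformations *)

(* [None] is the point at infinity. *)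
Definition riemann_sphere (R : realType) := option R[i].

Definition linear_fractional (R : realType) (a b c d : R[i])
    (p : riemann_sphere R) : riemann_sphere R :=
  match p with
  | Some z => if c * z + d == 0 then None else Some ((a * z + b) / (c * z + d))
  | None => if c == 0 then None else Some (a / c)
  end.

Definition moebius (R : realType) (m : riemann_sphere R -> riemann_sphere R) : Prop :=
  exists a b c d : R[i], a * d - b * c != 0 /\
    (m = linear_fractional a b c d \/
     m = linear_fractional a b c d \o omap (@conjc R)).

(** * Circle patterns *)

(* [HalfPlane u t] is Re (conj u * z) >= t, together with infinity. *)
Variant disk (R : realType) :=
  | Inside of R[i] & R
  | Outside of R[i] & R
  | HalfPlane of R[i] & R.

Section Disks.
Variable R : realType.
Implicit Types (d : disk R) (z : R[i]).

Definition round d : Prop :=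
  match d with
  | Inside _ r | Outside _ r => 0 < r
  | HalfPlane u _ => u != 0
  end.

(* Defining function on the finite plane: nonnegative on the disk, zero on the
   boundary circle. *)
Definition slack d z : R :=
  match d with
  | Inside c r => r - normc (z - c)
  | Outside c r => normc (z - c) - r
  | HalfPlane u t => complex.Re (conjc u * z) - t
  end.

Definition disk_set d : set (riemann_sphere R) :=
  [set p | if p is Some z then 0 <= slack d z
           else if d is Inside _ _ then False else True].

Definition boundary d : set (riemann_sphere R) :=
  [set p | if p is Some z then slack d z = 0
           else if d is HalfPlane _ _ then True else False].

(* Inward normal vector of the disk at a finite boundary point. *)
Definition inward d z : R[i] :=
  match d with
  | Inside c _ => c - z
  | Outside c _ => z - c
  | HalfPlane u _ => u
  end.

Definition vector_angle (x y : R[i]) : R :=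
  acos (complex.Re (conjc x * y) / (normc x * normc y)).

(* The lens is bounded near z by two half-planes whose inward normals make an
   angle phi, so its corner at z has interior angle pi - phi. *)
Definition lens_angle d1 d2 z : R :=
  pi - vector_angle (inward d1 z) (inward d2 z).

End Disks.

(* Two normalizations of the exterior intersection angle Theta of crossing
   disks are in use.  With [lens_is_Theta], Theta is continuous at external
   tangency, where it vanishes, and two bounded disks satisfy
   |c1 - c2|^2 = r1^2 + r2^2 + 2 r1 r2 cos Theta (Thurston).  With
   [lens_is_supplement], the interior angle of the lens is pi - Theta. *)
Variant angle_convention := lens_is_Theta | lens_is_supplement.

Definition exterior_of_lens (R : realType) (conv : angle_convention) (l : R) : R :=
  match conv with lens_is_Theta => l | lens_is_supplement => pi - l end.

(* Disks that meet neither in one point nor along crossing boundaries (e.g.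
   nested ones) have no exterior intersection angle.  Two distinct crossing
   points cannot both be infinite, and the angle is the same at both. *)
Definition exterior_angle (R : realType) (conv : angle_convention)
    (d1 d2 : disk R) (theta : R) : Prop :=
  (exists p, disk_set d1 `&` disk_set d2 = [set p] /\ theta = 0) \/
  (exists p q, [/\ p <> q, boundary d1 `&` boundary d2 = [set p; q]
     & forall z, (boundary d1 `&` boundary d2) (Some z) ->
         theta = exterior_of_lens conv (lens_angle d1 d2 z)]).

Section Patterns.
Variables (R : realType) (n : nat).
Implicit Types P Q : 'I_n -> disk R.

Definition circle_pattern P : Prop := forall v, round (P v).

Definition irreducible P : Prop :=
  forall A : {set 'I_n}, A \proper [set: 'I_n]%SET ->
    \bigcup_(v in [set` A]) disk_set (P v) `<` [set: riemann_sphere R].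

(* [phi] is the isomorphism from the contact graph to the 1-skeleton. *)
Definition realizes (conv : angle_convention) (K : {set {set 'I_n}})
    (Theta : {ffun edge K -> R}) P : Prop :=
  exists2 phi : 'I_n -> 'I_n, bijective phi &
    (forall u v : 'I_n, u != v ->
       (disk_set (P u) `&` disk_set (P v) !=set0 <->
        [set phi u; phi v]%SET \in K)) /\
    (forall (u v : 'I_n) (e : edge K), val e = [set phi u; phi v]%SET ->
       exterior_angle conv (P u) (P v) (Theta e)).

Definition moebius_equiv P Q : Prop :=
  exists2 m, moebius m & forall v, disk_set (Q v) = m @` disk_set (P v).

End Patterns.

Definition finite_up_to T (E : T -> T -> Prop) (A : set T) : Prop :=
  exists F : set T, finite_set F /\ forall x, A x -> exists2 y, F y & E y x.

(** * Lebesgue-null sets of R^I *)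

(* Countable covers by boxes of arbitrarily small total volume. *)
Definition lebesgue_null (R : realType) (I : finType) (A : set {ffun I -> R}) : Prop :=
  forall eps : R, 0 < eps -> exists a b : nat -> {ffun I -> R},
    [/\ forall k i, a k i <= b k i,
        A `<=` \bigcup_k [set x : {ffun I -> R} | forall i, a k i <= x i <= b k i]
      & (\sum_(k <oo) (\prod_i (b k i - a k i))%:E <= eps%:E)%E].

Definition almost_every_in (R : realType) (I : finType)
    (A Q : set {ffun I -> R}) : Prop :=
  lebesgue_null (A `\` Q).

(* Main.v *)
Require Import Defs.
From mathcomp Require Import all_boot all_order all_algebra.
From mathcomp Require Import all_classical all_reals all_analysis.
From mathcomp Require Import complex.
From mathcomp Require Import zify ring lra.

(** A disk is a Hermitian form of signature (1, 1) and determinant -1, i.e. a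
    unit vector of Minkowski space, and prescribing the angle of two crossing
    disks prescribes the product of their vectors. Once two crossing disks and a
    scale are normalized by a Moebius transformation, a pattern of n disks
    depends algebraically on d = 3n - 6 parameters, while there are |E| >= d
    angle equations. Hence each coordinate z of the normalized pattern is
    algebraically dependent with the |E| products g: counting dimensions gives a
    nonzero polynomial with P(z, g) = 0. When some coefficient of P, as a
    polynomial in z, does not vanish at the prescribed cosines, z takes finitely
    many values; the exceptional angles form the zero set of a nonzero
    polynomial in cosines, which is null.

    The inequality |E| >= 3n - 6 is where the sphere enters. If X is the sphere
    with the vertices removed, one of them placed at infinity, the n - 1 maps
    (z - v_i) / |z - v_i| from X to the circle are independent modulo maps that
    lift to the line. On the other hand X is covered by the triangles and edges
    with their vertices cut off, over each of which all maps lift, so that the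
    obstruction to lifting is an integer cochain on the incidences between edges
    and triangles. This gives
    n + |E| + |F| <= |I| + 2 with I the set of incidences, and |I| <= 3 |F|,
    |I| <= 2 |E| because, again by winding numbers, no four vertices span a
    simplex and no edge lies in three triangles. *)

Set Implicit Arguments.
Unset Strict Implicit.
Unset Printing Implicit Defensive.

Import Order.TTheory GRing.Theory Num.Theory ComplexField.Normc numFieldNormedType.Exports.

(** * Zero sets of polynomials in cosines *)

(** Three obstacles shape the argument. A zero angle may come from a tangency, which offers no pair
    of crossing points to normalize by; the angle functions with a zero entry lie in finitely many
    hyperplanes and are discarded together with the zero sets of polynomials. The isomorphism of the
    contact graph, the disks used for the normalization and the way the last dilation is spent all
    depend on the pattern, so one polynomial is taken for each of the finitely many choices and each
    coordinate. One coordinate of each unit vector is only a square root of a polynomial in the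
    others; products of such roots reduce to square-free ones, which multiplies the dimension by the
    constant 2^n and leaves its growth in the degree unchanged, so the count still decides. On the
    topological side the linear relations must have integer coefficients, since only integer
    combinations of angles survive modulo 2 pi. *)

Section SmallSets.
Variable R : realType.
Local Open Scope ring_scope.

(** Nested coefficient lists with the variable of index 0 outermost: an induction on m sees a
    one-variable polynomial whose coefficients depend on the remaining variables. Lists may end in
    zeros. *)
Fixpoint mpol (m : nat) : Type := if m is m'.+1 then seq (mpol m') else R.

Fixpoint mpeval m : mpol m -> (nat -> R) -> R :=
  match m with
  | 0 => fun c _ => c
  | m'.+1 => fun p y => (Poly [seq mpeval c (y \o succn) | c <- p]).[y 0%N]
  end.

Fixpoint mpnz m : mpol m -> bool :=
  match m with
  | 0 => fun c => c != 0
  | m'.+1 => fun p => has (@mpnz m') p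
  end.

Fixpoint words (m N : nat) : seq (seq nat) :=
  if m is m'.+1 then [seq i :: s | s <- words m' N, i <- iota 0 N] else [:: [::]].

Lemma size_words m N : size (words m N) = (N ^ m)%N.
Proof.
by elim: m => //= m IH; rewrite size_allpairs IH size_iota expnS mulnC.
Qed.

Lemma uniq_words m N : uniq (words m N).
Proof.
elim: m => //= m IH; apply: allpairs_uniq => //; first exact: iota_uniq.
by move=> [s i] [s' i'] _ _ [-> ->].
Qed.

Lemma mem_words m N s : (s \in words m N) = (size s == m) && all (gtn N) s.
Proof.
elim: m s => [|m IH] [|i s] //=.
  by apply/allpairsP => -[[? ?]] [].
rewrite eqSS; apply/allpairsP/idP => [[[s' i']] /= [+ + [-> ->]]|].
  by rewrite IH mem_iota => /andP[-> ->] /= ->.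
move=> /and3P[h1 h2 h3]; exists (s, i); split => //=.
  by rewrite IH h1.
by rewrite mem_iota.
Qed.

Lemma count_words m N (P : pred (seq nat)) :
  count P (words m.+1 N) =
  (\sum_(s <- words m N) count (fun i => P (i :: s)) (iota 0 N))%N.
Proof.
rewrite /= count_flatten -map_comp sumnE big_map.
by apply: eq_bigr => s _ /=; rewrite count_map.
Qed.

(* Sampling rules x_N : {0..N-1} -> [-1,1] that do not cluster. *)
Definition spread (x : nat -> nat -> R) :=
  forall eps : R, 0 < eps -> exists rho : R, 0 < rho /\ exists N0, forall N, (N0 <= N)%N ->
   forall c, (count (fun i => `|x N i - c| <= rho) (iota 0 N))%:R <= eps * N%:R.

Variable x : nat -> nat -> R.
Hypothesis xbnd : forall N i, `|x N i| <= 1.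
Hypothesis xspread : spread x.

Lemma count_sub (T : eqType) (a b c : pred T) (s : seq T) :
  (forall i, i \in s -> a i -> b i || c i) ->
  (count a s <= count b s + count c s)%N.
Proof.
elim: s => //= i s IH h.
have := h i (mem_head _ _); have {}/IH : forall j, j \in s -> a j -> b j || c j.
  by move=> j js; apply: h; rewrite inE js orbT.
by case: (a i) (b i) (c i) => [] [] []; lia.
Qed.

(** The bound is uniform in the polynomial because the induction on the number of variables applies
    it to coefficients that move. If p is small at a sample x0, division by X - x0 leaves a quotient
    of smaller size that still has a coefficient of absolute value at least delta / 4; wherever p is
    small, either the sample is within rho of x0 or the quotient is small. *)
Lemma few_small_values1 D : forall delta eps : R, 0 < delta -> 0 < eps ->
  exists eta : R, 0 < eta /\ exists N0, forall N, (N0 <= N)%N ->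
  forall p : {poly R}, (size p <= D)%N -> (exists j, delta <= `|p`_j|) ->
  (count (fun i => `|p.[x N i]| <= eta) (iota 0 N))%:R <= eps * N%:R.
Proof.
elim: D => [|D IH] delta eps d0 e0.
  exists 1; split => //; exists 0%N => N _ p; rewrite leqn0 size_poly_eq0.
  by move=> /eqP -> [j]; rewrite coef0 normr0 leNgt d0.
have d4 : 0 < delta / 4 by lra.
have e2 : 0 < eps / 2 by lra.
have [eta [eta0 [N1 H1]]] := IH _ _ d4 e2.
have [rho [rho0 [N2 H2]]] := xspread e2.
have er : 0 < eta * rho / 2 by rewrite divr_gt0 ?mulr_gt0.
(* With |p(x)| and |p(x0)| at most eta rho / 2, the quotient times x - x0 is at most eta rho. The
   bound delta / 2 keeps the constant p(x0) from accounting for the large coefficient, as delta / 4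
   + delta / 4 + delta / 2 = delta. *)
exists (Num.min (eta * rho / 2) (delta / 2)); split.
  by rewrite lt_min er /=; lra.
exists (maxn N1 N2) => N; rewrite geq_max => /andP[NN1 NN2] p sp [j pj].
set P := (X in count X _).
have [|] := boolP (has P (iota 0 N)); last first.
  rewrite has_count -eqn0Ngt => /eqP ->; rewrite mulr_ge0 //; lra.
move=> /hasP[i0 _]; rewrite /P le_min => /andP[pi0 pi0'].
set x0 := x N i0 in pi0 pi0'.
have : root (p - (p.[x0])%:P) x0 by rewrite rootE !hornerE subrr.
move=> /factor_theorem[q qE].
have pE : p = q * ('X - x0%:P) + (p.[x0])%:P by rewrite -qE subrK.
have sq : (size q <= D)%N.
  have [->|q0] := eqVneq q 0; first by rewrite size_poly0.
  have : (size (q * ('X - x0%:P))%R <= D.+1)%N.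
    rewrite -qE (leq_trans (size_polyD _ _)) // geq_max sp size_polyN.
    by rewrite (leq_trans (size_polyC_leq1 _)).
  by rewrite size_Mmonic ?monicXsubC // size_XsubC addn2.
have x01 : `|x0| <= 1 by apply: xbnd.
have qc : exists j, delta / 4 <= `|q`_j|.
  apply: contrapT => /forallNP qs.
  have {}qs k : `|q`_k| < delta / 4 by rewrite ltNge; apply/negP/qs.
  move: pj; rewrite {1}pE mulrBr !coefD coefN coefMX coefMC coefC.
  have h1 : `|if j == 0%N then 0 else q`_j.-1| < delta / 4.
    by case: ifP => _; rewrite ?normr0.
  have h2 : `|q`_j * x0| < delta / 4.
    by rewrite normrM (le_lt_trans _ (qs j)) // ler_piMr.
  have h3 : `|if j == 0%N then p.[x0] else 0| <= delta / 2.
    by case: ifP => _ //; rewrite normr0; lra.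
  move: h1 h2 h3; set a := (if _ then 0 else _); set c := (if _ then _ else 0).
  set b := q`_j * x0 => h1 h2 h3 h4.
  have := ler_normD (a - b) c; have := ler_normB a b; lra.
have cnt : (count P (iota 0 N) <= count (fun i => `|x N i - x0| <= rho)%R (iota 0 N)
      + count (fun i => `|q.[x N i]| <= eta)%R (iota 0 N))%N.
  apply: count_sub => i _; rewrite /P le_min => /andP[h _].
  rewrite -implyNb -ltNge; apply/implyP => hr.
  have : `|q.[x N i]| * `|x N i - x0| <= eta * rho.
    have -> : `|q.[x N i]| * `|x N i - x0| = `|p.[x N i] - p.[x0]|.
      by rewrite {1}pE -normrM !hornerE addrK.
    by have := ler_normB p.[x N i] p.[x0]; move: h pi0; lra.
  move=> h'; rewrite -(ler_pM2r rho0) (le_trans _ h') // ler_wpM2l //.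
  exact: ltW.
have := H1 N NN1 q sq qc; have := H2 N NN2 x0.
move: cnt; rewrite -(ler_nat R) natrD; lra.
Qed.

Definition sample N (s : seq nat) (k : nat) : R := x N (nth 0%N s k).

(** A Fubini argument by counting: for all but a fraction eps / 2 of the tails, one fixed
    coefficient exceeds delta and the one-variable bound applies with a common eta; each exceptional
    tail costs at most N words. *)
Lemma few_small_values m (p : mpol m) : mpnz p -> forall eps : R, 0 < eps ->
  exists eta : R, 0 < eta /\ exists N0, forall N, (N0 <= N)%N ->
  (count (fun s => `|mpeval p (sample N s)| <= eta) (words m N))%:R <= eps * N%:R ^+ m.
Proof.
elim: m p => [|m IH] /= p pnz eps e0.
  exists (`|p| / 2); split; first by rewrite divr_gt0 // normr_gt0.
  exists 0%N => N _; rewrite addn0 expr0 mulr1.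
  have -> : `|p| <= `|p| / 2 = false.
    by apply/negbTE; rewrite -ltNge; (have : 0 < `|p| by rewrite normr_gt0); lra.
  by rewrite ltW.
have [d [j [jp cnz]]] : exists d j, (j < size p)%N /\ mpnz (nth d p j).
  case: p pnz => // d p /(has_nthP d)[j jp pj]; by exists d, j.
set c := nth d p j in cnz.
have e2 : 0 < eps / 2 by lra.
have [delta [d0 [N1 H1]]] := IH c cnz _ e2.
have [eta [eta0 [N2 H2]]] := few_small_values1 (size p) d0 e2.
exists eta; split => //; exists (maxn N1 N2) => N.
rewrite geq_max => /andP[NN1 NN2].
rewrite count_words /=.
pose cnt s := count (fun i => `|mpeval (p : mpol m.+1) (sample N (i :: s))| <= eta) (iota 0 N).
have cntb s : (cnt s)%:R <= (N * (`|mpeval c (sample N s)| <= delta)%R)%:R + eps / 2 * N%:R :> R.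
  have [h|h] := leP `|mpeval c (sample N s)| delta.
    have : (cnt s)%:R <= N%:R :> R.
      by rewrite ler_nat (leq_trans (count_size _ _)) // size_iota.
    have : 0 <= eps / 2 * N%:R by rewrite mulr_ge0 // ltW.
    rewrite muln1; lra.
  rewrite muln0 add0r; apply: (H2 N NN2 (Poly [seq mpeval c (sample N s) | c <- p])).
    by rewrite (leq_trans (size_Poly _)) // size_map.
  exists j; rewrite coef_Poly (nth_map d) //; exact: ltW.
rewrite natr_sum (le_trans (ler_sum _ (fun s _ => cntb s))) //.
rewrite big_split /= -natr_sum -big_distrr /= natrM.
have -> : (\sum_(s <- words m N) (`|mpeval c (sample N s)| <= delta)%R =
    count (fun s => `|mpeval c (sample N s)| <= delta)%R (words m N))%N.
  by rewrite -sum1_count [RHS]big_mkcond /=; apply: eq_bigr => s _; case: ifP.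
rewrite big_const_seq count_predT size_words iter_addr_0 -[X in _ + X]mulr_natr natrX.
have -> : eps * N%:R ^+ m.+1 = N%:R * (eps / 2 * N%:R ^+ m) + eps / 2 * N%:R * N%:R ^+ m.
  by rewrite exprS; field.
by rewrite lerD2r ler_wpM2l // H1.
Qed.

Lemma mpeval_lip m (p : mpol m) : exists L M : R, 0 <= L /\ 0 <= M /\
  (forall y, (forall k, `|y k| <= 1) -> `|mpeval p y| <= M) /\
  forall y y' d, (forall k, `|y k| <= 1) -> (forall k, `|y' k| <= 1) ->
    (forall k, `|y k - y' k| <= d) -> `|mpeval p y - mpeval p y'| <= L * d.
Proof.
elim: m p => [|m IH] /= p.
  exists 0, `|p|; split => //; split => //; split => // y y' d _ _ _.
  by rewrite subrr normr0 mul0r.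
elim: p => [|c p [L [M [L0 [M0 [H1 H2]]]]]] /=.
  exists 0, 0; split => //; split => //; split => [y _|y y' d _ _ _];
  by rewrite !horner0 ?subrr ?normr0 ?mul0r.
have [L' [M' [L0' [M0' [H1' H2']]]]] := IH c.
exists (L + M + L'), (M + M'); split; first by rewrite !addr_ge0.
split; first by rewrite addr_ge0.
have HE y : (Poly [seq mpeval c0 (y \o succn) | c0 <- c :: p]).[y 0%N] =
   (Poly [seq mpeval c0 (y \o succn) | c0 <- p]).[y 0%N] * y 0%N + mpeval c (y \o succn).
  by rewrite !horner_Poly.
split => [y y1|y y' d y1 y1' yy']; rewrite !HE.
  rewrite (le_trans (ler_normD _ _)) // lerD //; last first.
    by apply: H1' => k; exact: y1.
  by rewrite normrM (le_trans _ (H1 y y1)) // ler_piMr.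
move: (H1 y y1) (H2 y y' d y1 y1' yy').
have /= := H2' (y \o succn) (y' \o succn) d (fun k => y1 _) (fun k => y1' _) (fun k => yy' _).
set a := mpeval c _; set a' := mpeval c _.
set b := horner _ _; set b' := horner _ _ => h1 h2 h3.
have -> : b * y 0%N + a - (b' * y' 0%N + a') =
  (b - b') * y' 0%N + b * (y 0%N - y' 0%N) + (a - a') by ring.
have d0 : 0 <= d := le_trans (normr_ge0 _) (yy' 0%N).
rewrite [leRHS]mulrDl (mulrDl L) (le_trans (ler_normD _ _)) // lerD //.
rewrite (le_trans (ler_normD _ _)) // lerD //.
  by rewrite normrM (le_trans _ h3) // ler_piMr.
by rewrite normrM ler_pM.
Qed.

End SmallSets.

(** * Null sets by grids in angle space *)

Section NullSets.
Variable R : realType.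
Local Open Scope ring_scope.
Local Open Scope classical_set_scope.

Lemma ler_cosB (a b : R) : `|cos a - cos b| <= `|a - b|.
Proof.
wlog ab : a b / b <= a.
  move=> h; have [/h //|/ltW/h] := leP b a.
  by rewrite distrC (distrC b).
have [|c _ ->] := @MVT_segment R cos (fun x => - sin x) b a ab (fun x _ => is_derive_cos x).
  by apply: continuous_subspaceT; exact: continuous_cos.
rewrite normrM normrN ler_piMl //.
by rewrite ler_norml sin_geN1 sin_le1.
Qed.

(** The midpoint and the half-length of [a, b] both lie in [t, pi - t], where the sine is at least
    sin t. The bound is quadratic because cos is flat at 0 and pi. *)
Lemma cosB_ge (t a b : R) : 0 <= t -> t <= pi / 2 -> 0 <= a -> b <= pi ->
  2 * t <= b - a -> 2 * sin t ^+ 2 <= cos a - cos b.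
Proof.
move=> t0 tpi a0 bpi tab.
set m := (a + b) / 2; set d := (b - a) / 2.
have -> : cos a - cos b = 2 * (sin m * sin d).
  have -> : cos a = cos (m - d) by congr cos; rewrite /m /d; field.
  have -> : cos b = cos (m + d) by congr cos; rewrite /m /d; field.
  by rewrite cosB cosD; ring.
have p0 := @pi_gt0 R.
have st0 : 0 <= sin t by rewrite sin_ge0_pi //; apply/andP; split; lra.
have sinle y : t <= y -> y <= pi - t -> sin t <= sin y.
  move=> ty yt; have [yp|/ltW yp] := leP y (pi / 2).
    rewrite leNgt ltr_sin ?in_itv /= -?leNgt //; apply/andP; split; lra.
  have -> : sin y = sin (pi - y).
    by rewrite sinB sinpi cospi; ring.
  rewrite leNgt ltr_sin ?in_itv /= -?leNgt; [lra| |]; apply/andP; split; lra.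
rewrite ler_wpM2l // expr2 ler_pM // sinle /m /d; lra.
Qed.

Lemma spread_cos (sg : R) : `|sg| = 1 -> spread (fun N i => sg * cos (pi * i%:R / N%:R)).
Proof.
move=> sg1 eps e0.
have p0 := @pi_gt0 R.
pose del := Num.min (eps / 2) 1.
have del0 : 0 < del by rewrite lt_min; apply/andP; split; lra.
have del1 : del <= 1 by rewrite /del ge_min lexx orbT.
have del2 : del <= eps / 2 by rewrite /del ge_min lexx.
pose t := pi * del / 2.
have t0 : 0 < t by rewrite /t divr_gt0 ?mulr_gt0.
have tp : t <= pi / 2 by rewrite /t ler_wpM2r // ler_piMr // ltW.
have st0 : 0 < sin t by rewrite sin_gt0_pi // t0 /=; lra.
(* Two samples within this radius of c differ by at most sin(t)^2, so by [cosB_ge] their angles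
   differ by less than 2 t = pi del and their indices by less than del N. The condition N > 2 / eps
   absorbs the one extra index of such a window. *)
exists (sin t ^+ 2 / 2); split; first by rewrite divr_gt0 // exprn_gt0.
exists (Num.truncn (2 / eps)).+1 => N NN c.
have NN' : 2 / eps < N%:R by rewrite (lt_le_trans (truncnS_gt _)) // ler_nat.
have N0 : 0 < N%:R :> R by rewrite (lt_trans _ NN') // divr_gt0.
set P := (X in count X _).
have close i j : (i <= j)%N -> (j < N)%N -> P i -> P j -> j%:R - i%:R < del * N%:R :> R.
  move=> ij jN Pi Pj; rewrite ltNge; apply/negP => h.
  have : 2 * sin t ^+ 2 <= cos (pi * i%:R / N%:R) - cos (pi * j%:R / N%:R).
    apply: cosB_ge => //; first exact: ltW.
    - by rewrite divr_ge0 ?mulr_ge0 ?(ltW p0) //.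
    - by rewrite ler_pdivrMr // ler_wpM2l ?ler_nat ?(ltW p0) ?(ltnW jN) //.
    - have -> : pi * j%:R / N%:R - pi * i%:R / N%:R = pi / N%:R * (j%:R - i%:R) :> R by field; rewrite ?gt_eqF.
      have -> : 2 * t = pi / N%:R * (del * N%:R) by rewrite /t; field; rewrite ?gt_eqF.
      by rewrite ler_wpM2l // divr_ge0 // ltW.
  move: Pi Pj; rewrite /P; set ci := cos _; set cj := cos _ => Pi Pj.
  have : `|ci - cj| <= sin t ^+ 2.
    have -> : `|ci - cj| = `|(sg * ci - c) - (sg * cj - c)|.
      by rewrite (_ : _ - _ - _ = sg * (ci - cj)) ?normrM ?sg1 ?mul1r //; ring.
    rewrite (le_trans (ler_normB _ _)) //; lra.
  have := exprn_gt0 2 st0; have := ler_norm (ci - cj); lra.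
have [hasP|] := boolP (has P (iota 0 N)); last first.
  by rewrite has_count -eqn0Ngt => /eqP ->; rewrite mulr_ge0 // ltW.
pose i0 := nth 0%N (iota 0 N) (find P (iota 0 N)).
have Pi0 : P i0 by apply: nth_find.
have i0E : i0 = find P (iota 0 N).
  by rewrite /i0 nth_iota //; move: hasP; rewrite has_find size_iota.
have i0min j : (j < N)%N -> P j -> (i0 <= j)%N.
  move=> jN Pj; rewrite leqNgt; apply/negP; rewrite i0E => /(before_find 0%N).
  by rewrite nth_iota // Pj.
pose w := Num.truncn (del * N%:R).
have : (count P (iota 0 N) <= w.+1)%N.
  rewrite -size_filter -(size_iota i0 w.+1); apply: uniq_leq_size.
    by rewrite filter_uniq // iota_uniq.
  move=> j; rewrite mem_filter !mem_iota /= => /andP[Pj jN].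
  have ij := i0min j jN Pj; rewrite ij /=.
  have := close _ _ ij jN Pi0 Pj; rewrite -natrB // => h.
  have : (j - i0 <= w)%N.
    by rewrite /w truncn_ge_nat; [exact: ltW|rewrite mulr_ge0 // ltW].
  by rewrite addnS ltnS -leq_subLR.
rewrite -(ler_nat R) => h.
have hw : w%:R <= del * N%:R by rewrite truncn_le mulr_ge0 // ltW.
have : 1 < eps / 2 * N%:R.
  by move: NN'; rewrite ltr_pdivrMr // => h'; lra.
have : del * N%:R <= eps / 2 * N%:R by rewrite ler_wpM2r // ltW.
move: h; rewrite -[w.+1]addn1 natrD; lra.
Qed.

Section Covers.
Variable I : finType.
Implicit Types A B : set {ffun I -> R}.

Definition box_volume (b : {ffun I -> R} * {ffun I -> R}) : R :=
  \prod_i (b.2 i - b.1 i).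

(** Jordan content zero. Finite covers suffice for grids, and finite unions need no splitting of eps
    into a series. *)
Definition finitely_null A := forall eps : R, 0 < eps ->
  exists bs : seq ({ffun I -> R} * {ffun I -> R}),
  [/\ forall b, b \in bs -> forall i, b.1 i <= b.2 i,
      forall x, A x -> exists2 b, b \in bs & forall i, b.1 i <= x i <= b.2 i
    & \sum_(b <- bs) box_volume b <= eps].

Lemma finitely_null_sub A B : A `<=` B -> finitely_null B -> finitely_null A.
Proof.
move=> AB nB eps e0; have [bs [h1 h2 h3]] := nB eps e0.
by exists bs; split=> // x /AB /h2.
Qed.

Lemma finitely_null_set0 : finitely_null set0.
Proof. by move=> eps e0; exists [::]; split => //; rewrite big_nil ltW. Qed.

Lemma finitely_nullU A B : finitely_null A -> finitely_null B -> finitely_null (A `|` B).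
Proof.
move=> nA nB eps e0.
have e2 : 0 < eps / 2 by lra.
have [s [h1 h2 h3]] := nA _ e2; have [s' [h1' h2' h3']] := nB _ e2.
exists (s ++ s'); split.
- by move=> b; rewrite mem_cat => /orP[/h1|/h1'].
- move=> x [/h2|/h2'] [b bs xb]; exists b => //; rewrite mem_cat bs ?orbT //.
- by rewrite big_cat /=; lra.
Qed.

Lemma finitely_null_bigcup (J : finType) (A : J -> set {ffun I -> R}) :
  (forall j, finitely_null (A j)) -> finitely_null [set x | exists j, A j x].
Proof.
move=> nA.
suff : forall s : seq J, finitely_null [set x | exists2 j, j \in s & A j x].
  move=> /(_ (enum J)); apply: finitely_null_sub => x /= [j Aj].
  by exists j => //; rewrite mem_enum.
elim=> [|j s IH]; first by apply: finitely_null_sub finitely_null_set0 => x [].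
apply: finitely_null_sub (finitely_nullU (nA j) IH) => x /= [k].
by rewrite inE => /predU1P[->|ks] Ak; [left|right; exists k].
Qed.

Lemma finitely_null_lebesgue_null A : (0 < #|I|)%N -> finitely_null A -> lebesgue_null A.
Proof.
move=> I0 nA eps e0; have [bs [h1 h2 h3]] := nA eps e0.
(* The finite cover is continued by the degenerate box at the origin. Its volume is 0 because I is
   nonempty; an empty product would be 1. *)
pose z : {ffun I -> R} := [ffun _ => 0].
pose nb k := nth (z, z) bs k.
have nb_le k i : (nb k).1 i <= (nb k).2 i.
  have [kb|kb] := ltnP k (size bs); first by apply: h1; rewrite mem_nth.
  by rewrite /nb nth_default // ffunE.
exists (fun k => (nb k).1), (fun k => (nb k).2); split=> //.
  move=> x /h2[b /(nthP (z, z))[k kb <-] xb].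
  by exists k => // i; apply: xb.
have f0 k : (0 <= (\prod_i ((nb k).2 i - (nb k).1 i))%:E)%E.
  by rewrite lee_fin prodr_ge0 // => i _; rewrite subr_ge0.
rewrite (@nneseries_split _ _ 0%N (size bs)) // add0n.
rewrite [X in (_ + X)%E]eseries0 ?adde0; last first.
  move=> k kb _; congr (_%:E); rewrite /nb nth_default //.
  have /card_gt0P[i _] := I0.
  by rewrite (bigD1 i) //= subrr mul0r.
rewrite sumEFin lee_fin (le_trans _ h3) // [leRHS](big_nth (z, z)) /box_volume /nb lexx //.
Qed.

Lemma finitely_null_hyperplane (e : I) :
  finitely_null [set x : {ffun I -> R} | (forall i, 0 <= x i <= pi) /\ x e = 0].
Proof.
move=> eps e0; exists [:: ([ffun _ => 0], [ffun i => if i == e then 0 else pi])]; split.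
- by move=> b; rewrite inE => /eqP -> i /=; rewrite !ffunE; case: ifP => // _; exact: pi_ge0.
- move=> x [xb xe]; exists ([ffun _ => 0], [ffun i => if i == e then 0 else pi]).
    by rewrite inE.
  move=> i /=; rewrite !ffunE; case: ifP => [/eqP ->|_]; last exact: xb.
  by rewrite xe lexx.
- rewrite big_seq1 /box_volume (bigD1 e) //= !ffunE eqxx subrr mul0r ltW //.
Qed.

(** Indices beyond [#|I|] read the angle 0 and give [sg], like the default of [gram] and like
    samples of a word read past its end, so that the sequences compared later agree at every
    index. *)
Definition cosines (sg : R) (x : {ffun I -> R}) (k : nat) : R :=
  sg * cos (if insub k is Some j then x (enum_val (j : 'I_#|I|)) else 0).

(** The angle cube is cut into cells of side pi / N. If a cell meets the zero set, the Lipschitz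
    bounds of p and cos make p at most eta at its lower corner, and [few_small_values] allows this
    for at most a fraction eps / pi^m of the N^m cells, with m = [#|I|]. *)
Lemma finitely_null_zeros (sg : R) (p : mpol R #|I|) : `|sg| = 1 -> mpnz p ->
  finitely_null [set x : {ffun I -> R} |
     (forall i, 0 <= x i < pi) /\ mpeval p (cosines sg x) = 0].
Proof.
move=> sg1 pnz eps e0.
have p0 := @pi_gt0 R.
pose X N i : R := sg * cos (pi * i%:R / N%:R).
have Xb N i : `|X N i| <= 1.
  by rewrite /X normrM sg1 mul1r ler_norml cos_geN1 cos_le1.
have e0' : 0 < eps / pi ^+ #|I| by rewrite divr_gt0 // exprn_gt0.
have [eta [eta0 [N0 HN0]]] := few_small_values Xb (spread_cos sg1) pnz e0'.
have [L [M [L0 [M0 [_ lip]]]]] := mpeval_lip p.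
pose N := maxn N0 (Num.truncn (L * pi / eta)).+1.
have NN0 : (N0 <= N)%N by rewrite leq_maxl.
have NL : L * pi / eta < N%:R.
  by rewrite (lt_le_trans (truncnS_gt _)) // ler_nat leq_maxr.
have Ngt0 : 0 < N%:R :> R by rewrite ltr0n /N leq_max orbT.
have {}HN0 := HN0 N NN0.
pose small s := `|mpeval p (sample X N s)| <= eta.
pose lo (s : seq nat) : {ffun I -> R} := [ffun i => pi * (nth 0%N s (enum_rank i))%:R / N%:R].
pose hi (s : seq nat) : {ffun I -> R} := [ffun i => lo s i + pi / N%:R].
exists [seq (lo s, hi s) | s <- words #|I| N & small s]; split.
- move=> b /mapP[s _ ->] i /=; rewrite !ffunE lerDl divr_ge0 //; exact: ltW.
- move=> x [xb xz].
  (* The word of the cell that contains x; x < pi keeps every index below N. *)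
  pose s := [seq Num.truncn (x (enum_val j) * N%:R / pi) | j <- enum 'I_#|I|].
  have snth j (jI : (j < #|I|)%N) : nth 0%N s j = Num.truncn (x (enum_val (Ordinal jI)) * N%:R / pi).
    rewrite /s (nth_map (Ordinal jI)) ?size_enum_ord //; congr (Num.truncn (x (enum_val _) * _ / _)).
    by apply: val_inj; rewrite /= nth_enum_ord.
  have xin j (jI : (j < #|I|)%N) : pi * (nth 0%N s j)%:R / N%:R <= x (enum_val (Ordinal jI))
      < pi * (nth 0%N s j)%:R / N%:R + pi / N%:R.
    have -> : pi * (nth 0%N s j)%:R / N%:R + pi / N%:R = pi * (nth 0%N s j).+1%:R / N%:R :> R.
      by rewrite -[(nth 0%N s j).+1]addn1 natrD; field; rewrite gt_eqF.
    have /truncn_itv : 0 <= x (enum_val (Ordinal jI)) * N%:R / pi.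
      have /andP[x0 _] := xb (enum_val (Ordinal jI)).
      by rewrite divr_ge0 ?mulr_ge0 // ltW.
    rewrite -snth ler_pdivlMr // ltr_pdivrMr // => /andP[h1 h2].
    by rewrite ler_pdivrMr // ltr_pdivlMr // ![pi * _]mulrC h1.
  exists (lo s, hi s); last first.
    move=> i /=; have := xin _ (ltn_ord (enum_rank i)); rewrite !ffunE.
    rewrite (_ : Ordinal _ = enum_rank i) ?enum_rankK => [/andP[-> /ltW ->] //|].
    exact: val_inj.
  apply/mapP; exists s => //; rewrite mem_filter mem_words; apply/and3P; split.
  + rewrite /small.
    have := lip (sample X N s) (cosines sg x) (pi / N%:R); rewrite xz subr0.
    have h : L * (pi / N%:R) <= eta.
      by rewrite mulrA ler_pdivrMr // [eta * _]mulrC -ler_pdivrMr // ltW.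
    move=> h'; apply: le_trans h; apply: h'.
    * by move=> k; apply: Xb.
    * by move=> k; rewrite /cosines normrM sg1 mul1r ler_norml cos_geN1 cos_le1.
    move=> k; rewrite /sample /X /cosines -mulrBr normrM sg1 mul1r.
    apply: le_trans (ler_cosB _ _) _.
    case: insubP => [j jI jk|].
      have := xin _ (ltn_ord j).
      rewrite (_ : Ordinal _ = j) ?jk; last exact: val_inj.
      by move=> h2; rewrite ler_norml; apply/andP; split; lra.
    rewrite -leqNgt => kI; rewrite nth_default; last by rewrite /s size_map size_enum_ord.
    by rewrite mulr0 mul0r subrr normr0 divr_ge0 // ltW.
  + by rewrite /s size_map size_enum_ord.
  + apply/allP => _ /mapP[j _ ->] /=; rewrite truncn_lt_nat.
      have /andP[_ xpi] := xb (enum_val j).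
      by rewrite ltr_pdivrMr // mulrC ltr_pM2l.
    have /andP[x0 _] := xb (enum_val j).
    by rewrite divr_ge0 ?mulr_ge0 // ltW.
- rewrite big_map big_filter /=.
  rewrite (eq_bigr (fun=> (pi / N%:R) ^+ #|I|)); last first.
    move=> s _; rewrite /box_volume -prodr_const; apply: eq_bigr => i _.
    by rewrite !ffunE addrC addKr.
  rewrite big_const_seq iter_addr_0 -[leLHS]mulr_natl.
  apply: le_trans (ler_wpM2r _ HN0) _; first by rewrite exprn_ge0 // divr_ge0 // ltW.
  rewrite expr_div_n le_eqVlt; apply/orP; left; apply/eqP; field.
  by rewrite !expf_neq0 // gt_eqF.
Qed.

End Covers.
End NullSets.

(** * Algebraic dependence *)

Lemma wide_kernel (F : fieldType) (I J : finType) (M : I -> J -> F) :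
  (#|J| < #|I|)%N ->
  exists c : I -> F, (exists i, c i != 0)%R /\
    forall j, (\sum_i c i * M i j = 0)%R.
Proof.
move=> JI.
pose A := (\matrix_(i < #|I|, j < #|J|) M (enum_val i) (enum_val j))%R.
have : kermx A != 0%R.
  rewrite -mxrank_eq0 mxrank_ker -lt0n subn_gt0.
  exact: leq_ltn_trans (rank_leq_col _) JI.
case/rowV0Pn => v /sub_kermxP vA v0.
exists (fun i => v ord0 (enum_rank i)); split.
  have /rV0Pn[i vi] := v0; exists (enum_val i); by rewrite enum_valK.
move=> j; have /matrixP/(_ ord0 (enum_rank j)) := vA.
rewrite !mxE => h; rewrite -[RHS]h (reindex (@enum_val I predT)) /=; last first.
  by exists enum_rank => x _; [exact: enum_valK|exact: enum_rankK].
by apply: eq_bigr => i _; rewrite !mxE enum_rankK enum_valK.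
Qed.

Section Dependence.
Variable R : realType.
Local Open Scope ring_scope.

Fixpoint word_mon (y : nat -> R) (s : seq nat) : R :=
  if s is i :: s' then y 0%N ^+ i * word_mon (y \o succn) s' else 1.

Fixpoint mpol_of (m N : nat) (c : seq nat -> R) : mpol R m :=
  match m with
  | 0 => c [::]
  | m'.+1 => [seq mpol_of m' N (fun s => c (i :: s)) | i <- iota 0 N]
  end.

Lemma mpeval_mpol_of m N c y :
  mpeval (mpol_of m N c) y = \sum_(s <- words m N) c s * word_mon y s.
Proof.
elim: m c y => [|m IH] c y /=; first by rewrite big_seq1 mulr1.
rewrite big_allpairs_dep exchange_big /= -map_comp.
have -> (s : seq R) : Poly s = \poly_(i < size s) s`_i.
  by apply/polyP => i; rewrite coef_Poly coef_poly; case: ltnP => // /(nth_default 0) ->.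
rewrite horner_poly size_map size_iota.
have -> (F : nat -> R) : \sum_(i <- iota 0 N) F i = \sum_(i < N) F i.
  by rewrite -(big_mkord xpredT) /index_iota subn0.
apply: eq_bigr => i _.
rewrite (nth_map 0%N) ?size_iota // nth_iota // add0n /= IH mulr_suml.
by apply: eq_bigr => s _; ring.
Qed.

Lemma mpnz_mpol_of m N (c : seq nat -> R) s : s \in words m N -> c s != 0 -> mpnz (mpol_of m N c).
Proof.
elim: m c s => [|m IH] c s; first by rewrite inE => /eqP ->.
move=> /allpairsP[[s' i] /= [s'w iN ->]] cs.
rewrite has_map; apply/hasP; exists i => //=.
exact: IH s'w cs.
Qed.

Variables (X : Type) (T S : finType) (t : T -> X -> R) (s : S -> X -> R).

(** The t are free parameters and the s are square roots over them, so that each s is needed at most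
    once and a set records which ones occur. *)
Definition st_mon (q : {ffun T -> nat} * {set S}) (x : X) : R :=
  (\prod_i t i x ^+ q.1 i) * \prod_(j in q.2) s j x.

Definition st_span (D : nat) (f : X -> R) :=
  exists l : seq (R * ({ffun T -> nat} * {set S})),
    all (fun q : R * ({ffun T -> nat} * {set S}) => [forall i, (q.2.1 i <= D)%N]) l /\
    forall x, f x = \sum_(q <- l) q.1 * st_mon q.2 x.

(** Degree is measured through multiplication because the elements are functions on X, whose
    expressions in t and s need not be unique; products are then handled by composing
    multiplications. *)
Definition st_mul (e : nat) (h : X -> R) :=
  forall D f, st_span D f -> st_span (D + e) (fun x => f x * h x).

Lemma st_span_ext D f g : f =1 g -> st_span D f -> st_span D g.
Proof. by move=> fg [l [h1 h2]]; exists l; split => // x; rewrite -fg. Qed.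

Lemma st_span_le D D' f : (D <= D')%N -> st_span D f -> st_span D' f.
Proof.
move=> DD [l [h1 h2]]; exists l; split => //.
apply: sub_all h1 => q /forallP h; apply/forallP => i; exact: leq_trans (h i) DD.
Qed.

Lemma st_spanD D f g : st_span D f -> st_span D g -> st_span D (fun x => f x + g x).
Proof.
move=> [l [h1 h2]] [l' [h1' h2']]; exists (l ++ l'); rewrite all_cat h1; split => // x.
by rewrite big_cat h2 h2'.
Qed.

Lemma st_spanZ D c f : st_span D f -> st_span D (fun x => c * f x).
Proof.
move=> [l [h1 h2]]; exists [seq (c * q.1, q.2) | q <- l]; rewrite all_map; split => // x.
by rewrite big_map h2 mulr_sumr; apply: eq_bigr => q _; rewrite mulrA.
Qed.

Lemma st_span0 D : st_span D (fun=> 0).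
Proof. by exists [::]; split => // x; rewrite big_nil. Qed.

Lemma st_span_mon D (q : {ffun T -> nat} * {set S}) c : [forall i, (q.1 i <= D)%N] ->
  st_span D (fun x => c * st_mon q x).
Proof. by move=> h; exists [:: (c, q)]; split; rewrite ?/= ?andbT // => x; rewrite big_seq1. Qed.

Lemma st_span1 : st_span 0 (fun=> 1).
Proof.
apply: st_span_ext (st_span_mon (q := ([ffun=> 0%N], finset.set0)) 1 _).
  move=> x; rewrite /st_mon /= big_set0 mul1r mulr1 big1 // => i _.
  by rewrite ffunE expr0.
by apply/forallP => i /=; rewrite ffunE.
Qed.

Lemma st_mul_mon e h :
  (forall D (q : {ffun T -> nat} * {set S}), [forall i, (q.1 i <= D)%N] -> st_span (D + e) (fun x => st_mon q x * h x)) ->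
  st_mul e h.
Proof.
move=> H D f [l [h1 h2]].
apply: (@st_span_ext _ (fun x => \sum_(q <- l) q.1 * (st_mon q.2 x * h x))).
  by move=> x; rewrite h2 mulr_suml; apply: eq_bigr => q _; rewrite mulrA.
elim: l h1 {h2} => [_|q l IH /= /andP[hq hl]].
  by apply: st_span_ext (st_span0 _) => x; rewrite big_nil.
apply: (@st_span_ext _ (fun x => q.1 * (st_mon q.2 x * h x) +
   \sum_(q <- l) q.1 * (st_mon q.2 x * h x))); first by move=> x; rewrite big_cons.
by apply: st_spanD; [apply: st_spanZ; exact: H|exact: IH].
Qed.

Lemma st_mul_ext e f g : f =1 g -> st_mul e f -> st_mul e g.
Proof. by move=> fg h D k /h; apply: st_span_ext => x; rewrite fg. Qed.

Lemma st_mul_le e e' h : (e <= e')%N -> st_mul e h -> st_mul e' h.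
Proof. by move=> ee H D f /H; apply: st_span_le; rewrite leq_add2l. Qed.

Lemma st_mulC c : st_mul 0 (fun=> c).
Proof. by move=> D f /(st_spanZ c); rewrite addn0; apply: st_span_ext => x; rewrite mulrC. Qed.

Lemma st_mulD e f g : st_mul e f -> st_mul e g -> st_mul e (fun x => f x + g x).
Proof.
move=> hf hg D k hk; apply: st_span_ext (st_spanD (hf D k hk) (hg D k hk)) => x.
by rewrite mulrDr.
Qed.

Lemma st_mulM e e' f g : st_mul e f -> st_mul e' g -> st_mul (e + e') (fun x => f x * g x).
Proof.
move=> hf hg D k hk; rewrite addnA; apply: st_span_ext (hg _ _ (hf D k hk)) => x.
by rewrite mulrA.
Qed.

Lemma st_mulZ e c f : st_mul e f -> st_mul e (fun x => c * f x).
Proof. by move=> hf; apply: (st_mulM (st_mulC c) hf). Qed.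

Lemma st_mulX e n f : st_mul e f -> st_mul (e * n) (fun x => f x ^+ n).
Proof.
move=> hf; elim: n => [|n IH]; first by rewrite muln0; apply: st_mulC.
by rewrite mulnS; apply: st_mul_ext (st_mulM hf IH) => x; rewrite exprS.
Qed.

Lemma st_mul_t i : st_mul 1 (t i).
Proof.
apply: st_mul_mon => D q /forallP hq.
pose q' := ([ffun k => (q.1 k + (k == i))%N], q.2).
apply: (@st_span_ext _ (fun x => 1 * st_mon q' x)).
  move=> x; rewrite mul1r /st_mon /= mulrAC; congr (_ * _).
  rewrite (bigD1 i) //= [in RHS](bigD1 i) //= ffunE eqxx addn1 exprSr mulrAC.
  by congr (_ * _); apply: eq_bigr => k /negbTE ki; rewrite ffunE ki addn0.
apply: st_span_mon; apply/forallP => k; rewrite /= ffunE.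
by apply: leq_add => //; case: (k == i).
Qed.

(** A monomial that already contains [s j] loses it and is multiplied by the square, which the
    hypothesis controls; otherwise [s j] joins the set. *)
Lemma st_mul_s j : st_mul 2 (fun x => s j x ^+ 2) -> st_mul 2 (s j).
Proof.
move=> hs; apply: st_mul_mon => D [a E] hq.
have [jE|jE] := boolP (j \in E).
  apply: (@st_span_ext _ (fun x => 1 * st_mon (a, E :\ j)%SET x * s j x ^+ 2)).
    by move=> x; rewrite mul1r /st_mon /= [in RHS](big_setD1 j) //=; ring.
  by apply: hs; apply: st_span_mon.
apply: (@st_span_ext _ (fun x => 1 * st_mon (a, j |: E)%SET x)).
  by move=> x; rewrite mul1r /st_mon /= big_setU1 //=; ring.
by apply: st_span_mon; apply/forallP => i; rewrite (leq_trans (forallP hq i)) ?leq_addr.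
Qed.

Lemma st_span_coef D f : st_span D f ->
  exists c : {ffun T -> 'I_D.+1} * {set S} -> R,
  forall x, f x = \sum_q c q * st_mon ([ffun i => q.1 i : nat], q.2) x.
Proof.
move=> [l [h1 h2]].
pose emb (q : {ffun T -> nat} * {set S}) : {ffun T -> 'I_D.+1} * {set S} :=
  ([ffun i => inord (q.1 i)], q.2).
exists (fun q => \sum_(p <- l | emb p.2 == q) p.1) => x.
rewrite h2 big_seq; under [RHS]eq_bigr do rewrite mulr_suml big_mkcond.
rewrite exchange_big /= [RHS]big_seq; apply: eq_bigr => p pl.
rewrite (bigD1 (emb p.2)) //= eqxx big1 ?addr0; last first.
  by move=> q /negbTE; rewrite eq_sym => ->.
case: p pl => c [a E] pl; congr (_ * st_mon (_, _) x).
apply/ffunP => i; rewrite !ffunE inordK // ltnS.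
by have /forallP/(_ i) := allP h1 _ pl.
Qed.

(* Counting: there are [N ^ m.+1] monomials of partial degrees < N in the y's, and they
   all lie in a space whose dimension is O(N ^ #|T|). *)
Lemma dependence m (y : nat -> X -> R) e : (#|T| <= m)%N ->
  (forall k, (k <= m)%N -> st_mul e (y k)) ->
  exists p : mpol R m.+1, mpnz p /\ forall x, mpeval p (fun k => y k x) = 0.
Proof.
move=> Tm ye.
(* The products have partial degrees at most D in the parameters, and D + 1 <= B N. They lie in the
   span of at most (B N)^#|T| 2^#|S| <= B^#|T| N^m 2^#|S| monomials, which N > B^#|T| 2^#|S| makes
   fewer than the N^(m+1) products. *)
pose B := (e * m.+1).+1.
pose N := (B ^ #|T| * 2 ^ #|S|).+1.
pose D := (e * m.+1 * N.-1)%N.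
have word_span (w : seq nat) (z : nat -> X -> R) :
    all (gtn N) w -> (forall k, (k < size w)%N -> st_mul e (z k)) ->
    st_mul (e * size w * N.-1) (fun x => word_mon (fun k => z k x) w).
  elim: w z => [|i w IH] z /=; first by rewrite muln0 mul0n => _ _; apply: st_mulC.
  move=> /andP[iN wN] hz; rewrite mulnS mulnDl.
  apply: st_mulM.
    apply: (@st_mul_le (e * i)); last by apply: st_mulX; apply: hz.
    by rewrite leq_mul2l -ltnS (ltn_predK iN) iN orbT.
  by apply: (IH (fun k => z k.+1)) => // k kw; apply: hz.
have word_span' w : w \in words m.+1 N -> st_span D (fun x => word_mon (fun k => y k x) w).
  rewrite mem_words => /andP[/eqP sw wN].
  have : st_mul (e * size w * N.-1) (fun x => word_mon (fun k => y k x) w).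
    by apply: word_span => // k; rewrite sw ltnS; exact: ye.
  rewrite sw => /(_ 0%N _ st_span1); rewrite add0n.
  by apply: st_span_ext => x; rewrite mul1r.
pose ws := words m.+1 N.
have wsn (i : 'I_(size ws)) : nth [::] ws i \in ws by apply: mem_nth.
have [M HM] := choice (fun i : 'I_(size ws) => st_span_coef (word_span' _ (wsn i))).
have [|c [[i0 ci0] c0]] := @wide_kernel R _ _ M.
  rewrite card_prod card_ffun !card_ord.
  have -> : #|{set S}| = (2 ^ #|S|)%N.
    by rewrite -[LHS]cardsT -powersetT card_powerset cardsT.
  rewrite size_words.
  have DB : (D.+1 <= B * N)%N.
    by rewrite /D /B /N /=; move: (e * m.+1)%N => a; set n := (_ * 2 ^ _)%N; nia.
  have h1 : (D.+1 ^ #|T| <= B ^ #|T| * N ^ m)%N.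
    rewrite (@leq_trans ((B * N) ^ #|T|)) //.
      by elim: #|T| => // k IHk; rewrite !expnS leq_mul.
    by rewrite expnMn leq_mul2l leq_pexp2l // orbT.
  rewrite (@leq_ltn_trans (B ^ #|T| * N ^ m * 2 ^ #|S|)) // ?leq_mul2r ?h1 ?orbT //.
  by rewrite mulnAC expnS ltn_pmul2r ?expn_gt0.
pose cw (w : seq nat) : R := if insub (index w ws) is Some i then c i else 0.
have cwE (i : 'I_(size ws)) : cw (nth [::] ws i) = c i.
  by rewrite /cw index_uniq ?uniq_words // valK.
exists (mpol_of m.+1 N cw); split.
  by apply: (@mpnz_mpol_of _ _ _ (nth [::] ws i0)) => //; rewrite cwE.
move=> x; rewrite mpeval_mpol_of (big_nth [::]) big_mkord.
under eq_bigr do rewrite cwE HM mulr_sumr.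
rewrite exchange_big big1 //= => q _.
under eq_bigr do rewrite mulrA.
by rewrite -mulr_suml c0 mul0r.
Qed.

Lemma finite_fibres m (z : X -> R) (g : nat -> X -> R) e : (#|T| <= m)%N ->
  st_mul e z -> (forall k, (k < m)%N -> st_mul e (g k)) ->
  exists p : mpol R m, mpnz p /\ forall y : nat -> R, mpeval p y <> 0 ->
  finite_set [set z x | x in [set x | forall k, g k x = y k]].
Proof.
move=> Tm ze ge.
have [|p [pnz p0]] := @dependence m (fun k => if k is k'.+1 then g k' else z) e Tm.
  by case.
have [d [j [jp cnz]]] : exists d j, (j < size p)%N /\ mpnz (nth d p j).
  case: p pnz {p0} => // d p /(has_nthP d)[j jp pj]; by exists d, j.
exists (nth d p j); split => // y py.
pose P := Poly [seq mpeval c y | c <- p].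
have P0 : P != 0.
  apply/eqP => /polyP/(_ j); rewrite coef_Poly (nth_map d) // coef0; exact: py.
apply: (@sub_finite_set _ _ [set r | root P r]).
  move=> _ [x gx <-] /=; rewrite rootE -[X in _ == X](p0 x) /=.
  apply/eqP; congr (Poly _).[_]; apply: eq_map => c; congr mpeval.
  by apply/funext => k /=; rewrite gx.
have [rs rsP] : exists rs : seq R, forall r, root P r -> r \in rs.
  apply: contrapT => /forallNP H.
  have /(_ (size P)) [rs [rs1 [rs2 rs3]]] : forall k, exists rs : seq R, size rs = k /\ uniq rs /\ all (root P) rs.
    elim=> [|k [rs [rs1 [rs2 rs3]]]]; first by exists [::].
    have /existsNP[r /not_implyP[r1 /negP r2]] := H rs.
    by exists (r :: rs); rewrite /= rs1 r1 rs3 r2.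
  have := max_poly_roots P0 rs3 rs2.
  by rewrite rs1 ltnn.
by apply: sub_finite_set (finite_seq rs) => r /rsP.
Qed.

End Dependence.

(** * Disks as Hermitian forms *)

Section HermitianForms.
Variable R : realType.
Local Open Scope ring_scope.
Local Open Scope classical_set_scope.
Local Notation C := R[i].
Local Notation Re := (@complex.Re R).
Local Notation Im := (@complex.Im R).

Lemma ReM (x y : C) : Re (x * y) = Re x * Re y - Im x * Im y.
Proof. by case: x; case: y. Qed.
Lemma ImM (x y : C) : Im (x * y) = Re x * Im y + Im x * Re y.
Proof. by case: x; case: y. Qed.
Lemma ReD (x y : C) : Re (x + y) = Re x + Re y.
Proof. by case: x; case: y. Qed.
Lemma ImD (x y : C) : Im (x + y) = Im x + Im y.
Proof. by case: x; case: y. Qed.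
Lemma ReN (x : C) : Re (- x) = - Re x.
Proof. by case: x. Qed.
Lemma ImN (x : C) : Im (- x) = - Im x.
Proof. by case: x. Qed.
Lemma Re_conjc (x : C) : Re (conjc x) = Re x.
Proof. by case: x. Qed.
Lemma Im_conjc (x : C) : Im (conjc x) = - Im x.
Proof. by case: x. Qed.
Definition ReImE := (ReM, ImM, ReD, ImD, ReN, ImN, Re_conjc, Im_conjc).

Definition sqn (z : C) : R := Re z ^+ 2 + Im z ^+ 2.

Lemma normcE_sqn (z : C) : normc z = Num.sqrt (sqn z).
Proof. by case: z. Qed.
Lemma sqn_ge0 z : 0 <= sqn z.
Proof. by rewrite addr_ge0 ?sqr_ge0. Qed.
Lemma sqn_eq0 z : (sqn z == 0) = (z == 0).
Proof.
by case: z => x y; rewrite /sqn paddr_eq0 ?sqr_ge0 // !sqrf_eq0 eq_complex.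
Qed.
Lemma sqn_gt0 z : z != 0 -> 0 < sqn z.
Proof. by move=> z0; rewrite lt_neqAle sqn_ge0 eq_sym sqn_eq0 z0. Qed.
Lemma normc_ge0 (z : C) : 0 <= normc z.
Proof. by rewrite normcE_sqn sqrtr_ge0. Qed.
Lemma sqr_normc (z : C) : normc z ^+ 2 = sqn z.
Proof. by rewrite normcE_sqn sqr_sqrtr // sqn_ge0. Qed.
Lemma normc_gt0 (z : C) : z != 0 -> 0 < normc z.
Proof. by move=> z0; rewrite normcE_sqn sqrtr_gt0 sqn_gt0. Qed.

(* [Herm A C X Y] is the form A|z|^2 + 2 Re(conj B * z * conj w) + C|w|^2, B = X + iY. *)
Record herm := Herm { hA : R; hC : R; hX : R; hY : R }.
Implicit Types H : herm.

Definition hform H (z w : C) : R :=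
  hA H * sqn z + hC H * sqn w +
  2 * (hX H * (Re z * Re w + Im z * Im w) + hY H * (Im z * Re w - Re z * Im w)).

(* Minus the determinant of the Hermitian matrix, and its polarization. *)
Definition hip H1 H2 : R :=
  hX H1 * hX H2 + hY H1 * hY H2 - (hA H1 * hC H2 + hA H2 * hC H1) / 2.
Definition unit_herm H := hX H ^+ 2 + hY H ^+ 2 = 1 + hA H * hC H.

Definition num (p : riemann_sphere R) : C := if p is Some z then z else 1.
Definition den (p : riemann_sphere R) : C := if p is Some _ then 1 else 0.

Definition herm_disk H : set (riemann_sphere R) := [set p | 0 <= hform H (num p) (den p)].

(** At (z, 1) the form is (r^2 - |z - c|^2) / r for a bounded disk, the opposite for an exterior,
    and 2 (Re(conj u z) - t) / |u| for a half-plane: nonnegative exactly on the disk, with the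
    factor fixed by the determinant -1. *)
Definition herm_of (d : disk R) : herm :=
  match d with
  | Inside c r => Herm (- r^-1) ((r ^+ 2 - sqn c) / r) (Re c / r) (Im c / r)
  | Outside c r => Herm r^-1 (- ((r ^+ 2 - sqn c) / r)) (- (Re c / r)) (- (Im c / r))
  | HalfPlane u t => Herm 0 (- (2 * t / normc u)) (Re u / normc u) (Im u / normc u)
  end.

Definition disk_of H : disk R :=
  let c := Complex (- (hX H / hA H)) (- (hY H / hA H)) in
  if hA H < 0 then Inside c (- (hA H)^-1)
  else if 0 < hA H then Outside c (hA H)^-1
  else HalfPlane (Complex (hX H) (hY H)) (- (hC H / 2)).

Lemma unit_herm_of d : round d -> unit_herm (herm_of d).
Proof.
rewrite /unit_herm; case: d => [c r|c r|u t] /= r0.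
- by rewrite /sqn; field; rewrite gt_eqF.
- by rewrite /sqn; field; rewrite gt_eqF.
- have u0 := normc_gt0 r0; have := sqr_normc u; rewrite /sqn => uE.
  by rewrite mul0r addr0 !expr_div_n -mulrDl -uE divff // expf_neq0 // gt_eqF.
Qed.

Lemma disk_ofK H : unit_herm H -> round (disk_of H) /\ herm_of (disk_of H) = H.
Proof.
case: H => A C X Y; rewrite /unit_herm /disk_of /= => h.
case: (ltrgtP A 0) => A0 /=.
- rewrite oppr_gt0 invr_lt0; split => //.
  have A0' : A != 0 by rewrite lt_eqF.
  have -> : C = (X ^+ 2 + Y ^+ 2 - 1) / A by rewrite h; field.
  by congr Herm; rewrite /sqn /=; field; rewrite ?A0' ?oppr_eq0 ?invr_eq0 ?A0'.
- rewrite invr_gt0; split => //.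
  have A0' : A != 0 by rewrite gt_eqF.
  have -> : C = (X ^+ 2 + Y ^+ 2 - 1) / A by rewrite h; field.
  by congr Herm; rewrite /sqn /=; field; rewrite ?A0' ?oppr_eq0 ?invr_eq0 ?A0'.
- rewrite A0 mul0r addr0 in h.
  have -> : Num.sqrt (X ^+ 2 + Y ^+ 2) = 1 by rewrite h sqrtr1.
  split; last by rewrite A0 !divr1; congr Herm; field.
  by apply/eqP => -[X0 Y0]; move: h; rewrite X0 Y0 expr0n addr0 => /esym/eqP; rewrite oner_eq0.
Qed.

Lemma disk_set_herm d : round d -> disk_set d = herm_disk (herm_of d).
Proof.
move=> rd; apply/seteqP; rewrite /disk_set /herm_disk.
have sq0 : sqn 0 = 0 :> R by apply/eqP; rewrite sqn_eq0.
have sq1 : sqn 1 = 1 :> R by rewrite /sqn /= expr1n expr0n addr0.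
suff h p : disk_set d p <-> herm_disk (herm_of d) p by split=> p /h.
rewrite /disk_set /herm_disk /= /hform.
case: d rd p => [c r|c r|u t] /= r0 [z|] /=; rewrite ?sq0 ?sq1.
- have -> : - r^-1 * sqn z + (r ^+ 2 - sqn c) / r * 1 +
     2 * (Re c / r * (Re z * 1 + Im z * 0) + Im c / r * (Im z * 1 - Re z * 0))
     = (r ^+ 2 - sqn (z - c)) / r.
    by rewrite /sqn !ReImE; field; rewrite gt_eqF.
  rewrite -sqr_normc pmulr_lge0 ?invr_gt0 // !subr_ge0.
  by rewrite ler_pXn2r // ?nnegrE ?normc_ge0 // ltW.
- rewrite [X in _ <-> 0 <= X](_ : _ = - r^-1); last by ring.
  by rewrite oppr_ge0 leNgt invr_gt0 r0.
- have -> : r^-1 * sqn z + - ((r ^+ 2 - sqn c) / r) * 1 +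
     2 * (- (Re c / r) * (Re z * 1 + Im z * 0) + - (Im c / r) * (Im z * 1 - Re z * 0))
     = (sqn (z - c) - r ^+ 2) / r.
    by rewrite /sqn !ReImE; field; rewrite gt_eqF.
  rewrite -sqr_normc pmulr_lge0 ?invr_gt0 // !subr_ge0.
  by rewrite ler_pXn2r // ?nnegrE ?normc_ge0 // ltW.
- rewrite [X in _ <-> 0 <= X](_ : _ = r^-1); last by ring.
  by rewrite invr_ge0 ltW.
- have u0 := normc_gt0 r0.
  have -> : 0 * sqn z + - (2 * t / normc u) * 1 +
     2 * (Re u / normc u * (Re z * 1 + Im z * 0) + Im u / normc u * (Im z * 1 - Re z * 0))
     = (Re (conjc u * z) - t) * (2 / normc u).
    by rewrite !ReImE; field; rewrite gt_eqF.
  by rewrite pmulr_lge0 // divr_gt0.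
- by rewrite [X in _ <-> 0 <= X](_ : _ = 0) ?lexx //; ring.
Qed.

Lemma hform_boundary d p : round d -> boundary d p -> hform (herm_of d) (num p) (den p) = 0.
Proof.
have sq0 : sqn 0 = 0 :> R by apply/eqP; rewrite sqn_eq0.
have sq1 : sqn 1 = 1 :> R by rewrite /sqn /= expr1n expr0n addr0.
rewrite /boundary /= /hform.
case: d p => [c r|c r|u t] /= [z|] //= r0 h; rewrite ?sq0 ?sq1.
- transitivity ((r ^+ 2 - sqn (z - c)) / r).
    by rewrite /sqn !ReImE; field; rewrite gt_eqF.
  by rewrite -sqr_normc (_ : normc _ = r) ?subrr ?mul0r //; lra.
- transitivity ((sqn (z - c) - r ^+ 2) / r).
    by rewrite /sqn !ReImE; field; rewrite gt_eqF.
  by rewrite -sqr_normc (_ : normc _ = r) ?subrr ?mul0r //; lra.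
- have u0 := normc_gt0 r0.
  transitivity ((Re (conjc u * z) - t) * (2 / normc u)).
    by rewrite !ReImE; field; rewrite gt_eqF.
  by rewrite h mul0r.
- by ring.
Qed.

(** Half the gradient of the form at (z, 1); at a boundary point it is an inward normal. *)
Definition hgrad H (z : C) : C := Complex (hA H * Re z + hX H) (hA H * Im z + hY H).

Lemma inward_hgrad d z : round d -> boundary d (Some z) ->
  exists2 k : R, 0 < k & Re (inward d z) = k * Re (hgrad (herm_of d) z) /\
    Im (inward d z) = k * Im (hgrad (herm_of d) z).
Proof.
case: d => [c r|c r|u t] /= r0 h.
- by exists r => //; rewrite !ReImE; split; field; rewrite gt_eqF.
- by exists r => //; rewrite !ReImE; split; field; rewrite gt_eqF.
- have u0 := normc_gt0 r0.
  by exists (normc u) => //; split; field; rewrite gt_eqF.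
Qed.

(** The difference of the two sides is a combination of the values of both forms at z, so it
    vanishes at a crossing point. This turns an angle into a polynomial condition that no longer
    mentions z. *)
Lemma hgrad_dot H1 H2 z : hform H1 z 1 = 0 -> hform H2 z 1 = 0 ->
  Re (conjc (hgrad H1 z) * hgrad H2 z) = hip H1 H2.
Proof.
move=> h1 h2; apply/eqP; rewrite -subr_eq0; apply/eqP.
transitivity (hA H1 / 2 * hform H2 z 1 + hA H2 / 2 * hform H1 z 1).
  by rewrite /hform /hip !ReImE /sqn /=; field.
by rewrite h1 h2 !mulr0 addr0.
Qed.

Lemma hip_id H : unit_herm H <-> hip H H = 1.
Proof. by rewrite /unit_herm /hip; split=> h; lra. Qed.

Lemma cos_vector_angle d1 d2 z : round d1 -> round d2 ->
  boundary d1 (Some z) -> boundary d2 (Some z) ->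
  cos (vector_angle (inward d1 z) (inward d2 z)) = hip (herm_of d1) (herm_of d2).
Proof.
move=> r1 r2 b1 b2.
have [k k0 [hk hk']] := inward_hgrad r1 b1.
have [l l0 [hl hl']] := inward_hgrad r2 b2.
have f1 := hform_boundary r1 b1; have f2 := hform_boundary r2 b2.
have dot := hgrad_dot f1 f2.
have n1 := hgrad_dot f1 f1; have n2 := hgrad_dot f2 f2.
have u1 := unit_herm_of r1; have u2 := unit_herm_of r2.
move: dot n1 n2; rewrite (proj1 (hip_id _) u1) (proj1 (hip_id _) u2).
set g1 := hgrad _ z in hk hk' *; set g2 := hgrad _ z in hl hl' *.
set H1 := herm_of d1; set H2 := herm_of d2.
rewrite !ReImE => dot n1 n2.
have norm_in (u : C) (g : C) (c : R) : 0 < c -> Re u = c * Re g -> Im u = c * Im g ->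
    Re g * Re g - (- Im g) * Im g = 1 -> normc u = c.
  move=> c0 h1 h2 h3; rewrite normcE_sqn /sqn h1 h2.
  rewrite (_ : _ + _ = c ^+ 2); first by rewrite sqrtr_sqr ger0_norm // ltW.
  by rewrite -[RHS]mulr1 -h3; ring.
rewrite /vector_angle (norm_in _ _ _ k0 hk hk' n1) (norm_in _ _ _ l0 hl hl' n2).
have -> : Re (conjc (inward d1 z) * inward d2 z) / (k * l) = hip H1 H2.
  rewrite !ReImE hk hk' hl hl' -dot; field.
  by rewrite !gt_eqF.
(* The Cauchy-Schwarz bound that [acosK] asks for comes from the square of the cross product of the
   two unit gradients. *)
rewrite acosK // in_itv /= -ler_norml -(@ler_pXn2r _ 2) ?nnegrE // expr1n.
rewrite real_normK ?num_real // -dot.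
have := sqr_ge0 (Re g1 * Im g2 - Im g1 * Re g2).
have : (Re g1 * Re g1 - (- Im g1) * Im g1) * (Re g2 * Re g2 - (- Im g2) * Im g2) = 1.
  by rewrite n1 n2 mulr1.
nra.
Qed.

Definition scaleh (k : R) H := Herm (k * hA H) (k * hC H) (k * hX H) (k * hY H).

Lemma hform_scaleh k H z w : hform (scaleh k H) z w = k * hform H z w.
Proof. by rewrite /hform /=; ring. Qed.

Lemma hip_scaleh k H1 H2 : hip (scaleh k H1) (scaleh k H2) = k ^+ 2 * hip H1 H2.
Proof. by rewrite /hip /=; field. Qed.

Definition pull (a b c d : C) H : herm :=
  Herm (hform H a c) (hform H b d)
    ((hform H (a + b) (c + d) - hform H a c - hform H b d) / 2)
    ((hform H ('i%C * a + b) ('i%C * c + d) - hform H a c - hform H b d) / 2).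

Lemma hform_pull a b c d H z w :
  hform (pull a b c d H) z w = hform H (a * z + b * w) (c * z + d * w).
Proof.
case: H a b c d z w => A C0 X Y [a a'] [b b'] [c c'] [d d'] [z z'] [w w'].
by rewrite /pull /hform /= /sqn !ReImE /=; field.
Qed.

Lemma hip_pull a b c d H1 H2 :
  hip (pull a b c d H1) (pull a b c d H2) = sqn (a * d - b * c) * hip H1 H2.
Proof.
case: H1 H2 a b c d => A1 C1 X1 Y1 [A2 C2 X2 Y2] [a a'] [b b'] [c c'] [d d'].
by rewrite /hip /pull /= /hform /= /sqn !ReImE /=; field.
Qed.

Definition npull (a b c d : C) H := scaleh (normc (a * d - b * c))^-1 (pull a b c d H).

Lemma hip_npull a b c d H1 H2 : a * d - b * c != 0 ->
  hip (npull a b c d H1) (npull a b c d H2) = hip H1 H2.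
Proof.
move=> det0; rewrite hip_scaleh hip_pull exprVn sqr_normc mulKf //.
by rewrite sqn_eq0.
Qed.

Lemma hformM H l z w : hform H (l * z) (l * w) = sqn l * hform H z w.
Proof. by rewrite /hform /sqn !ReImE; ring. Qed.

(** In homogeneous coordinates the map is linear up to a factor l, and by [hformM] such a factor
    multiplies a form by a positive number only; infinity is then treated like any other point. *)
Lemma linear_fractional_rep (a b c d : C) p : a * d - b * c != 0 ->
  exists2 l : C, l != 0 &
    a * num p + b * den p = l * num (linear_fractional a b c d p) /\
    c * num p + d * den p = l * den (linear_fractional a b c d p).
Proof.
move=> det0; case: p => [z|] /=.
  case: eqP => /= [cz|/eqP cz].
    exists (a * z + b); last by rewrite !mulr1 mulr0 cz.
    apply: contra det0 => /eqP az; apply/eqP.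
    have [c0|c0] := eqVneq c 0.
      by move: cz; rewrite c0 mul0r add0r mulr0 subr0 => ->; rewrite mulr0.
    have zE : z = - d / c by apply: (mulfI c0); rewrite mulrCA divff // mulr1; apply/eqP; rewrite -addr_eq0 cz.
    apply: (mulfI (invr_neq0 c0)); move: az; rewrite zE mulr0 => az.
    by rewrite -[RHS]oppr0 -az; field.
  by exists (c * z + d) => //; split; rewrite !mulr1 // [RHS]mulrC divfK.
rewrite !mulr0 !addr0 !mulr1; case: eqP => [c0|/eqP c0] /=.
  exists a; last by rewrite mulr1 mulr0.
  apply: contra det0 => /eqP ->; by rewrite c0 mul0r mulr0 subr0.
by exists c => //; split; rewrite ?mulr1 // [RHS]mulrC divfK.
Qed.

Lemma rep_inj (p q : riemann_sphere R) (l : C) : l != 0 ->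
  num p = l * num q -> den p = l * den q -> p = q.
Proof.
case: p q => [z|] [w|] l0 //=.
- by move=> -> /esym; rewrite mulr1 => ->; rewrite mul1r.
- by move=> _ /eqP; rewrite mulr0 oner_eq0.
- by move=> _ /esym/eqP; rewrite mulr1 (negPf l0).
Qed.

Lemma linear_fractionalK (a b c d : C) p : a * d - b * c != 0 ->
  linear_fractional a b c d (linear_fractional d (- b) (- c) a p) = p.
Proof.
move=> det0.
have det0' : d * a - - b * - c != 0 by rewrite mulrNN mulrC.
have [l l0 [h1 h2]] := linear_fractional_rep p det0'.
have [k k0 [h3 h4]] := linear_fractional_rep (linear_fractional d (- b) (- c) a p) det0.
apply: (@rep_inj _ _ ((a * d - b * c) / (k * l))).
- by rewrite mulf_neq0 ?invr_neq0 ?mulf_neq0.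
- apply: (mulfI k0); rewrite -h3.
  apply: (mulfI l0); rewrite mulrDr (mulrCA l a) (mulrCA l b) -h1 -h2.
  by field; rewrite ?k0 ?l0.
- apply: (mulfI k0); rewrite -h4.
  apply: (mulfI l0); rewrite mulrDr (mulrCA l c) (mulrCA l d) -h1 -h2.
  by field; rewrite ?k0 ?l0.
Qed.

Lemma herm_disk_npull a b c d H : a * d - b * c != 0 ->
  herm_disk H = linear_fractional a b c d @` herm_disk (npull a b c d H).
Proof.
move=> det0.
have key p : herm_disk (npull a b c d H) p <-> herm_disk H (linear_fractional a b c d p).
  rewrite /herm_disk /= hform_scaleh hform_pull.
  have [l l0 [-> ->]] := linear_fractional_rep p det0.
  by rewrite hformM pmulr_rge0 ?invr_gt0 ?normc_gt0 // pmulr_rge0 // sqn_gt0.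
apply/seteqP; split => [p hp|_ [p /key hp <-]] //.
exists (linear_fractional d (- b) (- c) a p); last exact: linear_fractionalK.
by apply/key; rewrite linear_fractionalK.
Qed.

End HermitianForms.

(** * Normal forms of circle patterns *)

Lemma finite_ffun (I : finType) (T : choiceType) (S : I -> set T) :
  (forall i, finite_set (S i)) ->
  finite_set [set f : {ffun I -> T} | forall i, S i (f i)].
Proof.
move=> fS.
have [s sP] := choice (fun i => proj1 (finite_seqP _) (fS i)).
pose r := flatten [seq s i | i <- enum I].
have mem_r i x : S i x -> x \in r.
  rewrite (sP i) => xs; apply/flattenP; exists (s i) => //.
  by apply: map_f; rewrite mem_enum.
apply: (@sub_finite_set _ _
  ((fun h : {ffun I -> seq_sub r} => [ffun i => val (h i)]) @` setT)).
  move=> f /= fP; exists [ffun i => SeqSub (mem_r i _ (fP i))] => //.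
  by apply/ffunP => i; rewrite !ffunE.
apply: finite_image; exact: finite_finset.
Qed.

Section NormalForm.
Variable R : realType.
Variable n : nat.
Local Open Scope ring_scope.
Local Open Scope classical_set_scope.
Local Notation herm := (herm R).
Implicit Types (u v w : 'I_n).

(** A dilation by l turns the pair (hA, hC) of a form into (l hA, hC / l). Every orbit meets one of
    these four lines, on which the pair has a single parameter. *)
Definition charts : seq (R * R) := [:: (1, 1); (1, -1); (1, 0); (0, 1)].

(* Two crossing points of the disks u and v are moved to infinity and 0, the disk u to
   a half-plane with normal 1, and the remaining dilation is used up by the disk w. *)
Definition normal (kl : R * R) u v w (x : 'I_n -> herm) :=
  [/\ forall j, unit_herm (x j),
      [/\ hA (x u) = 0, hC (x u) = 0 & hY (x u) = 0],
      hA (x v) = 0 /\ hC (x v) = 0 &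
      exists s, hA (x w) = kl.1 * s /\ hC (x w) = kl.2 * s].

Definition coord (x : 'I_n -> herm) (jc : 'I_n * 'I_4) : R :=
  match nat_of_ord jc.2 with
  | 0 => hA (x jc.1) | 1 => hC (x jc.1) | 2 => hX (x jc.1) | _ => hY (x jc.1)
  end.

Section Gram.
Variables (I : finType) (ends : I -> 'I_n * 'I_n) (sg : R).

Definition gram (k : nat) (x : 'I_n -> herm) : R :=
  if insub k is Some e then
    hip (x (ends (enum_val (e : 'I_#|I|))).1) (x (ends (enum_val e)).2) else sg.

Variables (u v w : 'I_n) (kl : R * R).
Hypotheses (uvw : uniq [:: u; v; w]) (klin : kl \in charts).
Hypothesis dim_le : (3 * n <= #|I| + 6)%N.

(** Indices 0, 1, 2 stand for hA, hC, hY, while hX is a square root in these. Six of the 3 n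
    coordinates drop out: hA and hC of u and v, hY of u, and one of the pair (hA, hC) of w, whose
    common parameter sits at (w, 0). Six is the real dimension of the Moebius group. *)
Definition free_coord (jc : 'I_n * 'I_3) : bool :=
  jc \notin [:: (u, inord 0); (v, inord 0); (u, inord 1); (v, inord 1); (w, inord 1);
              (u, inord 2)].

Let uv : u != v. Proof. by move: uvw; rewrite /= !inE negb_or => /andP[/andP[]]. Qed.
Let uw : u != w. Proof. by move: uvw; rewrite /= !inE negb_or => /andP[/andP[]]. Qed.
Let vw : v != w. Proof. by move: uvw; rewrite /= !inE negb_or => /and3P[]. Qed.

Lemma eq_inord m (a b : nat) : (a <= m)%N -> (b <= m)%N -> ((inord a : 'I_m.+1) == inord b) = (a == b).
Proof. by move=> am bm; rewrite -val_eqE /= !inordK. Qed.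

Lemma card_free_coord : (#|{: {jc | free_coord jc}}| <= #|I|)%N.
Proof.
rewrite card_sig.
have h : #|[predC free_coord]| = 6%N.
  rewrite (@eq_card _ _ (mem [:: (u, inord 0 : 'I_3); (v, inord 0); (u, inord 1); (v, inord 1);
    (w, inord 1); (u, inord 2)])); last by move=> jc; rewrite [LHS]unfold_in /= /free_coord negbK.
  apply/card_uniqP; rewrite /= !inE !xpair_eqE !eq_inord //= !andbF !andbT /= ?orbF.
  by rewrite ?(negPf uv) ?(negPf uw) ?(negPf vw).
have := cardC free_coord; rewrite h card_prod !card_ord.
have -> : #|[pred x | free_coord x]| = #|free_coord| by apply: eq_card.
by move: dim_le; lia.
Qed.

Definition Pt := {x : 'I_n -> herm | normal kl u v w x}.
Let pt (x : Pt) (j : 'I_n) : herm := proj1_sig x j.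

(** The parameter of w is recovered by projecting onto the line of [kl], which avoids dividing by a
    component that may be zero. *)
Definition free_val (jc : {jc | free_coord jc}) (x : Pt) : R :=
  let: (j, c) := val jc in
  match nat_of_ord c with
  | 0 => if j == w then (kl.1 * hA (pt x j) + kl.2 * hC (pt x j)) / (kl.1 ^+ 2 + kl.2 ^+ 2)
         else hA (pt x j)
  | 1 => hC (pt x j)
  | _ => hY (pt x j)
  end.

Definition hX_val (j : 'I_n) (x : Pt) : R := hX (pt x j).

Local Notation smul := (st_mul free_val hX_val).

Lemma kl_neq0 : kl.1 ^+ 2 + kl.2 ^+ 2 != 0.
Proof.
have h : 1 <= kl.1 ^+ 2 + kl.2 ^+ 2.
  move: klin; rewrite !inE => /or4P[] /eqP -> /=;
  by rewrite ?sqrrN ?expr1n ?expr0n /= ?addr0 ?add0r // lerDl.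
by rewrite gt_eqF // (lt_le_trans _ h).
Qed.

Lemma smul_free j (c : 'I_3) (jc : free_coord (j, c)) (f : Pt -> R) k :
  f =1 (fun x => k * free_val (exist _ (j, c) jc) x) -> smul 1 f.
Proof.
move=> fE; apply: (@st_mul_ext _ _ _ _ _ _ _ _ _ (fsym fE)).
by apply: st_mulZ; exact: st_mul_t.
Qed.

Lemma smul0 (f : Pt -> R) : f =1 (fun=> 0) -> smul 1 f.
Proof.
move=> fE; apply: (@st_mul_ext _ _ _ _ _ _ _ _ _ (fsym fE)).
by apply: (@st_mul_le _ _ _ _ _ _ 0) => //; exact: st_mulC.
Qed.

Lemma smul_w (kl' : R) (f : Pt -> R) : (f =1 fun x => kl' * ((kl.1 * hA (pt x w) + kl.2 * hC (pt x w)) / (kl.1 ^+ 2 + kl.2 ^+ 2))) -> smul 1 f.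
Proof.
have wfree : free_coord (w, inord 0).
  rewrite /free_coord /= !inE !xpair_eqE !eq_inord //= !andbF !andbT /= ?orbF.
  by rewrite !(eq_sym w) (negPf uw) (negPf vw).
move=> fE; apply: (smul_free (jc := wfree) (k := kl')) => x; rewrite fE /free_val /= inordK //.
by rewrite eqxx.
Qed.

Lemma smul_hA j : smul 1 (fun x => hA (pt x j)).
Proof.
have [->|ju] := eqVneq j u; first by apply: smul0 => x; have [_ [] ] := proj2_sig x.
have [->|jv] := eqVneq j v; first by apply: smul0 => x; have [_ _ [] ] := proj2_sig x.
have [->|jw] := eqVneq j w.
  apply: (smul_w (kl' := kl.1)) => x /=.
  have [_ _ _ [s [h1 h2]]] := proj2_sig x.
  by rewrite /pt /= h1 h2; field; exact: kl_neq0.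
have jc : free_coord (j, inord 0).
  rewrite /free_coord /= !inE !xpair_eqE !eq_inord //= !andbF !andbT /= ?orbF.
  by rewrite negb_or ju jv.
apply: (smul_free (jc := jc) (k := 1)) => x; rewrite /free_val /= inordK //= (negPf jw) mul1r //.
Qed.

Lemma smul_hC j : smul 1 (fun x => hC (pt x j)).
Proof.
have [->|ju] := eqVneq j u; first by apply: smul0 => x; have [_ [] ] := proj2_sig x.
have [->|jv] := eqVneq j v; first by apply: smul0 => x; have [_ _ [] ] := proj2_sig x.
have [->|jw] := eqVneq j w.
  apply: (smul_w (kl' := kl.2)) => x /=.
  have [_ _ _ [s [h1 h2]]] := proj2_sig x.
  by rewrite /pt /= h1 h2; field; exact: kl_neq0.
have jc : free_coord (j, inord 1).
  rewrite /free_coord /= !inE !xpair_eqE !eq_inord //= !andbF !andbT /= ?orbF.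
  by rewrite !negb_or ju jv jw.
apply: (smul_free (jc := jc) (k := 1)) => x; rewrite /free_val /= inordK //= mul1r //.
Qed.

Lemma smul_hY j : smul 1 (fun x => hY (pt x j)).
Proof.
have [->|ju] := eqVneq j u; first by apply: smul0 => x; have [_ [] ] := proj2_sig x.
have jc : free_coord (j, inord 2).
  rewrite /free_coord /= !inE !xpair_eqE !eq_inord //= !andbF !andbT /= ?orbF.
  by rewrite ju.
apply: (smul_free (jc := jc) (k := 1)) => x; rewrite /free_val /= inordK //= mul1r //.
Qed.

(** [unit_herm] reads hX^2 = 1 + hA hC - hY^2, of degree 2 in the parameters. *)
Lemma smul_hX j : smul 2 (fun x => hX (pt x j)).
Proof.
apply: (@st_mul_s _ _ _ _ free_val hX_val j).
apply: (@st_mul_ext _ _ _ _ _ _ _ (fun x => (1 + hA (pt x j) * hC (pt x j)) + (-1) * (hY (pt x j) * hY (pt x j)))).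
  move=> x; have [/(_ j) + _ _ _] := proj2_sig x; rewrite /unit_herm /hX_val -/(pt x j).
  by move=> h; rewrite -h; ring.
apply: st_mulD; last by apply: st_mulZ; apply: (st_mulM (e := 1) (e' := 1)); exact: smul_hY.
apply: st_mulD; last by apply: (st_mulM (e := 1) (e' := 1)); [exact: smul_hA|exact: smul_hC].
by apply: (@st_mul_le _ _ _ _ _ _ 0) => //; exact: st_mulC.
Qed.

Lemma smul_coord jc : smul 4 (fun x => coord (pt x) jc).
Proof.
apply: (@st_mul_le _ _ _ _ _ _ 2) => //.
case: jc => j c; rewrite /coord /=; case: (nat_of_ord c) => [|[|[|_]]].
- by apply: (@st_mul_le _ _ _ _ _ _ 1) => //; exact: smul_hA.
- by apply: (@st_mul_le _ _ _ _ _ _ 1) => //; exact: smul_hC.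
- exact: smul_hX.
- by apply: (@st_mul_le _ _ _ _ _ _ 1) => //; exact: smul_hY.
Qed.

Lemma smul_gram k : smul 4 (fun x => gram k (pt x)).
Proof.
rewrite /gram; case: insubP => [e _ _|_]; last first.
  by apply: (@st_mul_le _ _ _ _ _ _ 0) => //; exact: st_mulC.
set a := (ends _).1; set b := (ends _).2.
apply: (@st_mul_ext _ _ _ _ _ _ _ (fun x => (hX (pt x a) * hX (pt x b) + hY (pt x a) * hY (pt x b))
   + (- (1 / 2)) * (hA (pt x a) * hC (pt x b) + hA (pt x b) * hC (pt x a)))).
  by move=> x; rewrite /hip; field.
have h1 f g : smul 1 f -> smul 1 g -> smul 4 (fun x => f x * g x).
  by move=> hf hg; apply: (@st_mul_le _ _ _ _ _ _ 2) => //; apply: (st_mulM (e := 1) (e' := 1)).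
apply: st_mulD; last by apply: st_mulZ; apply: st_mulD; apply: h1; (exact: smul_hA || exact: smul_hC).
apply: st_mulD; last by apply: h1; exact: smul_hY.
by apply: (st_mulM (e := 2) (e' := 2)); exact: smul_hX.
Qed.

(** Each coordinate has its own test polynomial; where none of them vanishes, the family of forms
    lies in the image of a finite product of finite sets of coordinate values. *)
Lemma normal_forms_finite : exists p : 'I_n * 'I_4 -> mpol R #|I|,
  (forall jc, mpnz (p jc)) /\ forall y : nat -> R, (forall jc, mpeval (p jc) y <> 0) ->
  finite_set [set x | normal kl u v w x /\ forall k, gram k x = y k].
Proof.
have [p pP] := choice (fun jc => @finite_fibres _ _ _ _ free_val hX_val #|I| _
  (fun k x => gram k (pt x)) 4 card_free_coord (smul_coord jc) (fun k _ => smul_gram k)).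
exists p; split=> [jc|y py]; first by have [] := pP jc.
pose S jc := [set coord (pt x) jc | x in [set x | forall k, gram k (pt x) = y k]].
have fS jc : finite_set (S jc) by have [_] := pP jc; apply; exact: py.
pose back (f : {ffun 'I_n * 'I_4 -> R}) (j : 'I_n) : herm :=
  Herm (f (j, inord 0)) (f (j, inord 1)) (f (j, inord 2)) (f (j, inord 3)).
apply: sub_finite_set (finite_image back (finite_ffun fS)) => x [nx gx].
exists [ffun jc => coord x jc].
  by move=> jc; rewrite /= ffunE; exists (exist _ x nx).
apply/funext => j; rewrite /back !ffunE /coord /= !inordK //.
by case: (x j).
Qed.

End Gram.
End NormalForm.

(** * Normalization of a pattern and the exceptional angles *)

Section GenericFiniteness.
Variable R : realType.
Local Open Scope ring_scope.
Local Open Scope classical_set_scope.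
Local Notation C := R[i].
Local Notation Re := (@complex.Re R).
Local Notation Im := (@complex.Im R).

Lemma pull_dilation (a b c d rho : C) (H : herm R) (P := pull a b c d H) :
  pull (rho * a) b (rho * c) d H =
  Herm (sqn rho * hA P) (hC P) (Re rho * hX P + Im rho * hY P) (Re rho * hY P - Im rho * hX P).
Proof.
rewrite /P; move: H {P} => [A C0 X Y]; case: a b c d rho => [a a'] [b b'] [c c'] [d d'] [r r'].
by rewrite /pull /= /hform /= /sqn !ReImE /=; congr Herm; field.
Qed.

Lemma npull_dilation (a b c d rho : C) (H : herm R) (P := npull a b c d H) :
  a * d - b * c != 0 -> rho != 0 ->
  npull (rho * a) b (rho * c) d H =
  Herm (normc rho * hA P) (hC P / normc rho)
    ((Re rho * hX P + Im rho * hY P) / normc rho) ((Re rho * hY P - Im rho * hX P) / normc rho).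
Proof.
move=> det0 rho0; rewrite /P /npull pull_dilation /scaleh /=.
have -> : rho * a * d - b * (rho * c) = rho * (a * d - b * c) by ring.
have n1 := normc_gt0 rho0; have n2 := normc_gt0 det0.
have -> : normc (rho * (a * d - b * c)) = normc rho * normc (a * d - b * c).
  exact: normcM.
by rewrite -sqr_normc; congr Herm; field; rewrite !gt_eqF.
Qed.

(** If neither number is zero, l^2 = |C0 / A| makes l A and C0 / l equal in absolute value, and
    their signs choose between (1, 1) and (1, -1); otherwise the pair already lies on an axis. *)
Lemma balance (A C0 : R) : exists l : R, 0 < l /\ exists2 kl, kl \in charts R &
  exists s, l * A = kl.1 * s /\ C0 / l = kl.2 * s.
Proof.
have [->|A0] := eqVneq A 0.
  exists 1; split => //; exists (0, 1); first by rewrite !inE eqxx !orbT.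
  by exists C0 => /=; split; field.
have [->|C00] := eqVneq C0 0.
  exists 1; split => //; exists (1, 0); first by rewrite !inE eqxx !orbT.
  by exists A => /=; split; field.
pose l := Num.sqrt `|C0 / A|.
have l0 : 0 < l by rewrite sqrtr_gt0 normr_gt0 mulf_neq0 // invr_neq0.
have l2 : l ^+ 2 = `|C0 / A| by rewrite sqr_sqrtr.
exists l; split => //.
have [s0|s0] := leP 0 (C0 / A).
  exists (1, 1); first by rewrite !inE eqxx.
  exists (l * A) => /=; rewrite !mul1r; split => //.
  apply: (canLR (mulfK _)); first by rewrite gt_eqF.
  rewrite (_ : l * A * l = l ^+ 2 * A); last by ring.
  by rewrite l2 ger0_norm // divfK.
exists (1, -1); first by rewrite !inE eqxx !orbT.
exists (l * A) => /=; rewrite !mul1r; split => //.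
apply: (canLR (mulfK _)); first by rewrite gt_eqF.
rewrite (_ : -1 * (l * A) * l = - (l ^+ 2 * A)); last by ring.
by rewrite l2 ltr0_norm // mulNr opprK divfK.
Qed.

(** The inward normals make the angle pi - Theta under the first convention and Theta under the
    second, so the convention enters only as the sign of cos Theta. *)
Definition conv_sign (conv : angle_convention) : R :=
  if conv is lens_is_Theta then -1 else 1.

Lemma exterior_angle_crossing conv (d1 d2 : disk R) theta : round d1 -> round d2 ->
  theta != 0 -> exterior_angle conv d1 d2 theta ->
  hip (herm_of d1) (herm_of d2) = conv_sign conv * cos theta /\
  exists p q, [/\ p <> q, boundary d1 p /\ boundary d2 p & boundary d1 q /\ boundary d2 q].
Proof.
move=> r1 r2 t0 [[p [_ /eqP]]|[p [q [pq Bpq Bt]]]]; first by rewrite (negPf t0).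
have [b1p b2p] : (boundary d1 `&` boundary d2) p by rewrite Bpq; left.
have [b1q b2q] : (boundary d1 `&` boundary d2) q by rewrite Bpq; right.
split; last by exists p, q.
(* As p and q differ, at least one of them is finite, and the angle is read there. *)
have [z [b1z b2z]] : exists z, (boundary d1 `&` boundary d2) (Some z).
  case: p q pq b1p b2p b1q b2q {Bpq} => [z|] [z'|] // pq *;
  by [exists z|exists z'].
rewrite (Bt z) // /lens_angle -(cos_vector_angle r1 r2 b1z b2z).
case: conv {Bt} => /=.
  by rewrite cosB cospi sinpi mul0r addr0 mulrA mulrNN !mul1r.
by rewrite subKr mul1r.
Qed.

Variables (n : nat) (K : {set {set 'I_n}}).

Lemma normalize_pattern (u v w : 'I_n) (P : 'I_n -> disk R) :
  uniq [:: u; v; w] -> circle_pattern P ->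
  (exists p q, [/\ p <> q, boundary (P u) p /\ boundary (P v) p
     & boundary (P u) q /\ boundary (P v) q]) ->
  exists2 x, moebius_equiv (@disk_of R \o x) P &
    (exists2 kl, kl \in charts R & normal kl u v w x) /\
    forall i j, hip (x i) (x j) = hip (herm_of (P i)) (herm_of (P j)).
Proof.
move=> uvw rP [p [q [pq [up vp] [uq vq]]]].
(* The matrix with columns p and q sends infinity to p and 0 to q. Pulled back along it, hA and hC
   are, up to a positive factor, the values of a form at p and q, which vanish for u and v. *)
pose det := num p * den q - num q * den p.
have det0 : num p * den q - num q * den p != 0.
  apply/eqP => h; apply: pq.
  case: p q h {up vp uq vq det} => [z|] [z'|] //=;
    rewrite ?mulr1 ?mulr0 ?mul0r ?mul1r ?subr0 ?sub0r.
  - by move/eqP; rewrite subr_eq0 => /eqP ->.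
  - by move/eqP; rewrite oppr_eq0 oner_eq0.
  - by move/eqP; rewrite oner_eq0.
pose Q j := npull (num p) (num q) (den p) (den q) (herm_of (P j)).
have Qu j : unit_herm (Q j).
  by apply/hip_id; rewrite hip_npull //; apply/hip_id/unit_herm_of.
have QA j : boundary (P j) p -> hA (Q j) = 0.
  by move=> /(hform_boundary (rP j)) h; rewrite /= h mulr0.
have QC j : boundary (P j) q -> hC (Q j) = 0.
  by move=> /(hform_boundary (rP j)) h; rewrite /= h mulr0.
have [l [l0 [kl klin [s [s1 s2]]]]] := balance (hA (Q w)) (hC (Q w)).
(* The argument of rho turns the normal of u to 1; its modulus is the dilation l that balances w. *)
pose rho : C := Complex (l * hX (Q u)) (l * hY (Q u)).
have B1 : hX (Q u) ^+ 2 + hY (Q u) ^+ 2 = 1.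
  by have := Qu u; rewrite /unit_herm QA // mul0r addr0.
have nrho : normc rho = l.
  rewrite /rho; move: (hX _) (hY _) B1 => a b ab.
  rewrite normcE_sqn /sqn /= (_ : _ + _ = l ^+ 2); last first.
    by rewrite -[RHS]mulr1 -ab; ring.
  by rewrite sqrtr_sqr ger0_norm // ltW.
have rho0 : rho != 0.
  by rewrite -sqn_eq0 -sqr_normc nrho expf_neq0 // gt_eqF.
pose x j := npull (rho * num p) (num q) (rho * den p) (den q) (herm_of (P j)).
have det0' : rho * num p * den q - num q * (rho * den p) != 0.
  by rewrite (_ : _ - _ = rho * det) ?mulf_neq0 // /det; ring.
have xE j := npull_dilation (herm_of (P j)) det0 rho0.
have xu j : unit_herm (x j).
  by apply/hip_id; rewrite hip_npull //; apply/hip_id/unit_herm_of.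
exists x.
  exists (linear_fractional (rho * num p) (num q) (rho * den p) (den q)).
    by exists (rho * num p), (num q), (rho * den p), (den q); split => //; left.
  move=> j; rewrite disk_set_herm // (herm_disk_npull _ det0').
  have [r1 r2] := disk_ofK (xu j).
  by rewrite /= disk_set_herm // r2.
split; last by move=> i j; rewrite hip_npull.
exists kl => //; split => //.
- rewrite /x !xE nrho -/(Q u) QA // QC // mulr0 mul0r; split => //.
  by rewrite [hY _]/= (_ : _ - _ = 0) ?mul0r //= -/(Q u); ring.
- by rewrite /x !xE nrho -/(Q v) QA // QC // mulr0 mul0r.
- by exists s; rewrite /x !xE nrho.
Qed.

Hypothesis edges_enough : (3 * n <= #|{: edge K}| + 6)%N.
Hypothesis n_gt4 : (4 < n)%N.

Lemma edge_inhabited : (0 < #|{: edge K}|)%N.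
Proof. by move: edges_enough n_gt4; lia. Qed.

Lemma third_vertex (u v : 'I_n) : u != v -> exists w, uniq [:: u; v; w].
Proof.
move=> uv.
have : (0 < #|~: [set u; v]%SET|)%N.
  by have := cardsC [set u; v]%SET; rewrite cards2 uv card_ord; move: n_gt4; lia.
case/card_gt0P => w; rewrite !inE negb_or => /andP[wu wv]; exists w.
by rewrite /= !inE negb_or uv (eq_sym u) (eq_sym v) wu wv.
Qed.

Theorem generic_finiteness (conv : angle_convention) :
  almost_every_in (@W R n K)
    [set Theta : {ffun edge K -> R} | finite_up_to (@moebius_equiv R n)
       [set P : 'I_n -> disk R | [/\ circle_pattern P, irreducible P
                  & realizes conv Theta P]]].
Proof.
pose sg := conv_sign conv.
have sg1 : `|sg| = 1 by rewrite /sg; case: (conv); rewrite /= ?normrN normr1.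
(* A key records which disks belong to each edge, the three disks of the normalization and the
   chart. There are finitely many keys, so the exceptional angles can be excluded before any pattern
   is given. *)
pose triple := {t : 'I_n * 'I_n * 'I_n | uniq [:: t.1.1; t.1.2; t.2]}.
pose key := ({ffun edge K -> 'I_n * 'I_n} * (triple * seq_sub (charts R)))%type.
have kP (k : key) := normal_forms_finite k.1 sg (valP k.2.1) (valP k.2.2) edges_enough.
have [p pP] := choice kP.
apply: (finitely_null_lebesgue_null edge_inhabited).
pose bad1 (e : edge K) := [set Theta : {ffun edge K -> R} |
  (forall i, 0 <= Theta i <= pi) /\ Theta e = 0].
pose bad2 (kjc : key * ('I_n * 'I_4)) := [set Theta : {ffun edge K -> R} |
  (forall i, 0 <= Theta i < pi) /\ mpeval (p kjc.1 kjc.2) (cosines sg Theta) = 0].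
have nb : finitely_null ([set Th | exists e, bad1 e Th] `|` [set Th | exists k, bad2 k Th]).
  apply: finitely_nullU; apply: finitely_null_bigcup => k.
    exact: finitely_null_hyperplane.
  by apply: finitely_null_zeros => //; have [] := pP k.1.
apply: finitely_null_sub nb => Theta [[Tb _] notfin].
apply: contrapT => /not_orP[/forallNP nb1 /forallNP nb2]; apply: notfin.
have T0 e : Theta e != 0.
  apply/eqP => Te; apply: (nb1 e); split => // i.
  by have /andP[-> /ltW ->] := Tb i.
have pk k jc : mpeval (p k jc) (cosines sg Theta) <> 0.
  by move=> h; apply: (nb2 (k, jc)); split.
pose NF (k : key) := [set x | normal (val k.2.2) (val k.2.1).1.1 (val k.2.1).1.2 (val k.2.1).2 x /\
   forall j, gram k.1 sg j x = cosines sg Theta j].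
have NFfin k : finite_set (NF k) by have [_] := pP k; apply; exact: pk.
exists (\bigcup_(k in [set: key]) ((fun x => @disk_of R \o x) @` NF k)); split.
  by apply: bigcup_finite => [|k _]; [exact: finite_finset|exact: finite_image].
move=> P [rP _ [phi phib [_ ang]]].
have [psi phiK psiK] := phib.
have ends_ex (e : edge K) : exists ab : 'I_n * 'I_n, ab.1 != ab.2 /\ val e = [set phi ab.1; phi ab.2]%SET.
  have /andP[_ /cards2P[a [b [ab ->]]]] := valP e.
  exists (psi a, psi b); rewrite /= !psiK; split => //.
  by rewrite (can_eq psiK).
have [ends endsP] := choice ends_ex.
have hipE e : hip (herm_of (P (ends e).1)) (herm_of (P (ends e).2)) = sg * cos (Theta e) /\
   exists p q, [/\ p <> q, boundary (P (ends e).1) p /\ boundary (P (ends e).2) p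
     & boundary (P (ends e).1) q /\ boundary (P (ends e).2) q].
  apply: exterior_angle_crossing => //; apply: ang; exact: (endsP e).2.
have /card_gt0P[e0 _] := edge_inhabited.
have [w uvw] := third_vertex (endsP e0).1.
have [x xP [[kl klin nx] xip]] := normalize_pattern uvw rP (hipE e0).2.
exists (@disk_of R \o x) => //.
pose k : key := ([ffun e => ends e], (exist _ ((ends e0).1, (ends e0).2, w) uvw, SeqSub klin)).
exists k => //; exists x => //; split => // j.
rewrite /gram /cosines; case: insubP => [j' _ _|_]; last by rewrite cos0 mulr1.
by rewrite ffunE xip (hipE _).1.
Qed.

End GenericFiniteness.

(** * Lifting maps to the circle *)

Section Lifting.
Context {R : realType}.
Local Open Scope ring_scope.
Local Open Scope classical_set_scope.

Definition con {T U : topologicalType} (A : set T) (f : T -> U) :=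
  forall x, A x -> f @ within A (nbhs x) --> f x.

Lemma con_subspace {T U : topologicalType} (A : set T) (f : T -> U) :
  con A f <-> {within A, continuous f}.
Proof. by split => h; apply/subspace_continuousP. Qed.

Lemma con_sub {T U : topologicalType} (A B : set T) (f : T -> U) :
  A `<=` B -> con B f -> con A f.
Proof.
move=> AB cf x Ax; apply: cvg_trans (cf x (AB x Ax)).
apply: cvg_app => P; rewrite !nbhs_simpl /within /=.
by apply: filterS => y By Ay; apply/By/AB.
Qed.

Lemma con_continuous {T U : topologicalType} (A : set T) (f : T -> U) :
  continuous f -> con A f.
Proof. by move=> cf x _; apply: cvg_within_filter; exact: cf. Qed.

Lemma con_ext {T U : topologicalType} (A : set T) (f g : T -> U) :
  (forall x, A x -> f x = g x) -> con A f -> con A g.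
Proof.
move=> fg cf x Ax; rewrite -(fg x Ax); apply: cvg_trans (cf x Ax).
apply: near_eq_cvg; rewrite /prop_near1 nbhs_simpl /within /=.
by apply: filterE => y Ay; rewrite fg.
Qed.

Lemma con_comp {S T U : topologicalType} (B : set S) (A : set T) (g : S -> T) (f : T -> U) :
  con B g -> (forall x, B x -> A (g x)) -> con A f -> con B (f \o g).
Proof.
move=> cg gA cf x Bx; apply: cvg_trans (cf (g x) (gA x Bx)).
move=> P /= hP; have := cg x Bx _ hP; rewrite /within /= !nbhs_simpl /=.
by apply: filterS => y h By; apply: h => //; exact: gA.
Qed.

Lemma con_cont_comp {S T U : topologicalType} (B : set S) (g : S -> T) (f : T -> U) :
  con B g -> (forall x, {for x, continuous f}) -> con B (f \o g).
Proof. by move=> cg cf; apply: (con_comp (A := setT)) => //; apply: con_continuous. Qed.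

Lemma conU {T U : topologicalType} (A B : set T) (f : T -> U) : closed A -> closed B ->
  con A f -> con B f -> con (A `|` B) f.
Proof.
move=> cA cB /con_subspace fA /con_subspace fB; apply/con_subspace.
exact: withinU_continuous.
Qed.

Section RealValued.
Context {T : topologicalType}.
Implicit Types (A : set T) (f g : T -> R).

Lemma con_cst A (k : R) : con A (fun=> k).
Proof. by move=> x _; exact: cvg_cst. Qed.
Lemma conD A f g : con A f -> con A g -> con A (fun x => f x + g x).
Proof. by move=> cf cg x Ax; apply: cvgD; [exact: cf|exact: cg]. Qed.
Lemma conN A f : con A f -> con A (fun x => - f x).
Proof. by move=> cf x Ax; apply: cvgN; exact: cf. Qed.
Lemma conB A f g : con A f -> con A g -> con A (fun x => f x - g x).
Proof. by move=> cf cg x Ax; apply: cvgB; [exact: cf|exact: cg]. Qed.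
Lemma conM A f g : con A f -> con A g -> con A (fun x => f x * g x).
Proof. by move=> cf cg x Ax; apply: cvgM; [exact: cf|exact: cg]. Qed.
Lemma conV A f : (forall x, A x -> f x != 0) -> con A f -> con A (fun x => (f x)^-1).
Proof. by move=> f0 cf x Ax; apply: cvgV; [exact: f0|exact: cf]. Qed.
Lemma con_sum A (I : Type) (r : seq I) (F : I -> T -> R) :
  (forall i, con A (F i)) -> con A (fun x => \sum_(i <- r) F i x).
Proof.
move=> cF; elim: r => [|i r IH].
  by apply: (@con_ext _ _ _ (fun=> 0)) => [x _|]; [rewrite big_nil|exact: con_cst].
apply: (@con_ext _ _ _ (fun x => F i x + \sum_(i <- r) F i x)) => [x _|].
  by rewrite big_cons.
exact: conD.
Qed.

Lemma con_distP A f : con A f -> forall x, A x -> forall e, 0 < e ->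
  \forall y \near x, A y -> `|f x - f y| < e.
Proof. by move=> cf x Ax e e0; have /cvgrPdist_lt/(_ e e0) := cf x Ax. Qed.

End RealValued.

(** Heine-Cantor relative to A. The radius found at each centre is halved, so that two close points
    fall into one neighbourhood. *)
Lemma compact_uniform {T : normedModType R} (A : set T) (f : T -> R) :
  compact A -> con A f -> forall e, 0 < e -> exists d : R, 0 < d /\
  forall x y, A x -> A y -> `|x - y| < d -> `|f x - f y| < e.
Proof.
move=> cA cf e e0.
have /near_covering_withinP cov := (compact_near_coveringP A).1 cA.
pose P (d : R) (x : T) := forall y, A y -> `|x - y| < d -> `|f x - f y| < e.
have : \forall d \near (0 : R)^'+, A `<=` P d.
  apply: (cov R ((0 : R)^'+) P) => x Ax.
  have e2 : 0 < e / 2 by rewrite divr_gt0.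
  have /nbhs_normP[r /= r0 hr] := con_distP cf Ax e2.
  have r2 : 0 < r / 2 by rewrite divr_gt0.
  exists (ball x (r / 2), [set d | 0 < d < r / 2]); first split => /=.
  - exact: nbhsx_ballx.
  - near=> d; apply/andP; split; near: d; first exact: nbhs_right_gt.
    exact: nbhs_right_lt.
  move=> [x' d] /= [xx' /andP[d0 dr]] Ax' y Ay x'y.
  have h1 : `|f x - f x'| < e / 2.
    apply: (hr x') => //=; move: xx'; rewrite -ball_normE /ball_ /=; lra.
  have h2 : `|f x - f y| < e / 2.
    apply: (hr y) => //=.
    move: xx'; rewrite -ball_normE /ball_ /= => xx'.
    have := ler_distD x' x y; lra.
  by have := ler_distD (f x) (f x') (f y); rewrite (distrC (f x') (f x)); lra.
move=> [d /= d0 hd]; exists (d / 2); split; first by rewrite divr_gt0.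
move=> x y Ax Ay xy; apply: (hd (d / 2)) xy => //=; last by rewrite divr_gt0.
by rewrite /ball /= sub0r normrN gtr0_norm; lra.
Unshelve. all: by end_near. Qed.

Lemma sin_atan_cos (x : R) : sin (atan x) = x * cos (atan x).
Proof.
have c0 : cos (atan x) != 0 by rewrite gt_eqF // cos_gt0_pihalf // atan_gtNpi2 atan_ltpi2.
by rewrite -{2}(atanK x) /tan divfK.
Qed.

(** The increment is the oriented angle from (c, s) to (c', s'). When the dot product is positive it
    is the arctangent of cross product over dot product, which is continuous without any choice of
    branch. *)
Lemma rotate_atan (c s c' s' a : R) : c ^+ 2 + s ^+ 2 = 1 -> c' ^+ 2 + s' ^+ 2 = 1 ->
  0 < c' * c + s' * s -> cos a = c -> sin a = s ->
  cos (a + atan ((s' * c - c' * s) / (c' * c + s' * s))) = c' /\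
  sin (a + atan ((s' * c - c' * s) / (c' * c + s' * s))) = s'.
Proof.
move=> cs cs' d0 ca sa.
set x := (_ / _).
have cx : cos (atan x) = c' * c + s' * s.
  rewrite cos_atan (_ : 1 + x ^+ 2 = (c' * c + s' * s) ^- 2).
    by rewrite sqrtrV ?sqr_ge0 // sqrtr_sqr ger0_norm ?invrK // ltW.
  rewrite -[LHS]mul1r -[X in X * _](_ : (c' ^+ 2 + s' ^+ 2) * (c ^+ 2 + s ^+ 2) = 1); last by rewrite cs cs' mulr1.
  have -> : 1 + x ^+ 2 = ((c' ^+ 2 + s' ^+ 2) * (c ^+ 2 + s ^+ 2)) / (c' * c + s' * s) ^+ 2.
    by rewrite /x; field; rewrite gt_eqF.
  by rewrite cs cs' !mul1r.
have sx : sin (atan x) = s' * c - c' * s.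
  by rewrite sin_atan_cos cx /x divfK // gt_eqF.
rewrite cosD sinD ca sa cx sx; split.
  by rewrite -[RHS]mulr1 -cs; ring.
by rewrite -[RHS]mulr1 -cs; ring.
Qed.

Lemma angle_exists (c s : R) : c ^+ 2 + s ^+ 2 = 1 -> exists a, cos a = c /\ sin a = s.
Proof.
move=> cs.
have c1 : -1 <= c <= 1.
  rewrite -ler_norml -(@ler_pXn2r _ 2) ?nnegrE // expr1n real_normK ?num_real //.
  by rewrite -cs lerDl sqr_ge0.
have sE : Num.sqrt (1 - c ^+ 2) = `|s|.
  by rewrite -cs addrAC subrr add0r sqrtr_sqr.
have [s0|s0] := leP 0 s.
  by exists (acos c); rewrite acosK // sin_acos // sE ger0_norm.
exists (- acos c); rewrite cosN sinN acosK // sin_acos // sE ltr0_norm // opprK //.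
Qed.

Definition star {T : lmodType R} (A : set T) (a : T) :=
  A a /\ forall x t, A x -> 0 <= t <= 1 -> A (a + t *: (x - a)).

Lemma star_convex {T : lmodType R} (A : set T) (a : T) : A a ->
  (forall x y t, A x -> A y -> 0 <= t <= 1 -> A (x + t *: (y - x))) -> star A a.
Proof. by move=> Aa h; split => // x t Ax t01; exact: h. Qed.

Lemma homothety_continuous {T : normedModType R} (a : T) (k : R) :
  continuous (fun x => a + k *: (x - a)).
Proof.
move=> x; apply: cvgD; first exact: cvg_cst.
by apply: cvgZr; apply: cvgB; [exact: cvg_id|exact: cvg_cst].
Qed.

(** Each x is reached from the centre a in N equal steps, short enough by uniform continuity that
    consecutive values have positive dot product. The lift is an angle at a plus the sum of the N
    arctangent increments. *)
Lemma lift_star {T : normedModType R} (A : set T) (a : T) (c s : T -> R) :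
  compact A -> star A a -> con A c -> con A s ->
  (forall x, A x -> c x ^+ 2 + s x ^+ 2 = 1) ->
  exists th, con A th /\ forall x, A x -> cos (th x) = c x /\ sin (th x) = s x.
Proof.
move=> cA [Aa stA] cc cs cs1.
have [dc [dc0 hc]] := compact_uniform cA cc ltr01.
have [ds [ds0 hs]] := compact_uniform cA cs ltr01.
have [M [M0 hM]] : exists M : R, 0 < M /\ forall x, A x -> `|x - a| <= M.
  have [B [Breal hB]] := compact_bounded cA.
  have h := hB (B + 1); exists (`|B| + 1 + `|a|); split.
    by rewrite ltr_pwDl // ltr_wpDl.
  move=> x Ax; rewrite (le_trans (ler_normB _ _)) // lerD2r.
  apply: (hB (`|B| + 1)) => //; by rewrite (le_lt_trans (ler_norm B)) // ltrDl.
pose d := Num.min dc ds.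
have d0 : 0 < d by rewrite lt_min dc0.
pose N := (Num.truncn (M / d)).+1.
have N0 : 0 < N%:R :> R by rewrite ltr0n.
have NM : M / N%:R < d.
  by rewrite ltr_pdivrMr // mulrC -ltr_pdivrMr // truncnS_gt.
pose g (i : nat) (x : T) := a + (i%:R / N%:R) *: (x - a).
have Ag i x : (i <= N)%N -> A x -> A (g i x).
  move=> iN Ax; apply: stA => //; rewrite divr_ge0 //= ler_pdivrMr // mul1r.
  by rewrite ler_nat.
have gcont i : continuous (g i) by exact: homothety_continuous.
have gstep i x : A x -> `|g i.+1 x - g i x| < d.
  move=> Ax; rewrite /g opprD addrACA subrr add0r -scalerBl -mulrBl.
  rewrite (_ : i.+1%:R - i%:R = 1); last by rewrite -natr1 addrAC subrr add0r.
  rewrite mul1r normrZ ger0_norm ?invr_ge0 ?(ltW N0) // mulrC.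
  by rewrite (le_lt_trans _ NM) // ler_wpM2r ?invr_ge0 ?(ltW N0) // hM.
pose dot i x := c (g i.+1 x) * c (g i x) + s (g i.+1 x) * s (g i x).
pose cro i x := s (g i.+1 x) * c (g i x) - c (g i.+1 x) * s (g i x).
(* Both coordinates move by less than 1, so two consecutive unit vectors have squared distance below
   2. *)
have dot_gt0 i x : (i < N)%N -> A x -> 0 < dot i x.
  move=> iN Ax; have A1 := Ag _ _ iN Ax; have A0 := Ag _ _ (ltnW iN) Ax.
  have h1 : `|c (g i.+1 x) - c (g i x)| < 1.
    by apply: hc => //; rewrite (lt_le_trans (gstep i x Ax)) // ge_min lexx.
  have h2 : `|s (g i.+1 x) - s (g i x)| < 1.
    by apply: hs => //; rewrite (lt_le_trans (gstep i x Ax)) // ge_min lexx orbT.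
  have e1 := cs1 _ A1; have e0 := cs1 _ A0.
  have sq1 (z : R) : `|z| < 1 -> z ^+ 2 < 1.
    by move=> z1; rewrite -real_normK ?num_real // exprn_ilt1.
  have := sq1 _ h1; have := sq1 _ h2; rewrite /dot !sqrrB; lra.
have [a0 [ca sa]] := angle_exists (cs1 a Aa).
pose th j x := a0 + \sum_(0 <= i < j) atan (cro i x / dot i x).
have g0 x : g 0%N x = a by rewrite /g mul0r scale0r addr0.
have gN x : g N x = x by rewrite /g divff ?gt_eqF // scale1r addrC subrK.
have thE j x : (j <= N)%N -> A x -> cos (th j x) = c (g j x) /\ sin (th j x) = s (g j x).
  move=> + Ax; elim: j => [_|j IH jN]; first by rewrite /th big_nil addr0 g0.
  have [IHc IHs] := IH (ltnW jN).
  rewrite /th big_nat_recr //= addrA.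
  apply: rotate_atan => //.
  - by apply: cs1; apply: Ag => //; exact: ltnW.
  - by apply: cs1; exact: Ag.
  - exact: dot_gt0.
exists (th N); split; last by move=> x Ax; have := thE N x (leqnn N) Ax; rewrite gN.
apply: (@con_ext _ _ _ (fun x => a0 + \sum_(i < N) atan (cro i x / dot i x))).
  by move=> x _; rewrite /th big_mkord.
apply: conD; first exact: con_cst.
apply: con_sum => i.
apply: (@con_cont_comp _ _ _ _ (fun x => cro i x / dot i x) atan); last by move=> x; exact: continuous_atan.
have cg k (f : T -> R) : (k <= N)%N -> con A f -> con A (f \o g k).
  by move=> kN; apply: con_comp; [exact: con_continuous|move=> x; exact: Ag].
have iN := ltn_ord i.
apply: conM; first by apply: conB; apply: conM; apply: cg => //; exact: ltnW.
apply: conV; first by move=> x Ax; rewrite gt_eqF // dot_gt0.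
by apply: conD; apply: conM; apply: cg => //; exact: ltnW.
Qed.

End Lifting.

(** * Arguments of planar maps and their ambiguity modulo 2 pi *)

Section Polar.
Context {R : realType}.
Local Open Scope ring_scope.
Local Open Scope classical_set_scope.

Definition tpz (x : R) := exists k : int, x = k%:~R * (2 * pi).

Lemma tpz0 : tpz 0. Proof. by exists 0; rewrite mul0r. Qed.
Lemma tpz_2pi : tpz (2 * pi). Proof. by exists 1; rewrite mul1r. Qed.
Lemma tpzD x y : tpz x -> tpz y -> tpz (x + y).
Proof. by move=> [k ->] [l ->]; exists (k + l); rewrite intrD -mulrDl. Qed.
Lemma tpzN x : tpz x -> tpz (- x).
Proof. by move=> [k ->]; exists (- k); rewrite mulrNz mulNr. Qed.
Lemma tpzB x y : tpz x -> tpz y -> tpz (x - y).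
Proof. by move=> hx hy; apply: tpzD => //; exact: tpzN. Qed.
Lemma tpzM (k : int) x : tpz x -> tpz (k%:~R * x).
Proof. by move=> [l ->]; exists (k * l); rewrite intrM mulrA. Qed.
Lemma tpz_sum (I : Type) (r : seq I) (F : I -> R) :
  (forall i, tpz (F i)) -> tpz (\sum_(i <- r) F i).
Proof. by move=> h; elim/big_ind: _ => //; [exact: tpz0|exact: tpzD]. Qed.

Lemma trig_tpz (d : R) : tpz d -> forall x, cos (x + d) = cos x /\ sin (x + d) = sin x.
Proof.
move=> [k ->] x.
have nat_case (m : nat) (y : R) : cos (y + m%:R * (2 * pi)) = cos y /\ sin (y + m%:R * (2 * pi)) = sin y.
  have -> : m%:R * (2 * pi) = pi *+ 2 *+ m :> R.
    by rewrite -mulr_natr -[pi *+ 2]mulr_natr; ring.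
  by rewrite (periodicn (@cosD2pi R)) (periodicn (@sinD2pi R)).
case: k => m; first exact: nat_case.
have [h1 h2] := nat_case m.+1 (x + (Negz m)%:~R * (2 * pi)).
rewrite -h1 -h2; have -> : x + (Negz m)%:~R * (2 * pi) + m.+1%:R * (2 * pi) = x; last by [].
by rewrite NegzE mulrNz mulNr subrK.
Qed.

Lemma not_tpz_pi (k : R) : tpz k -> k <> pi /\ k <> - pi.
Proof.
move=> /trig_tpz/(_ 0)[+ _]; rewrite add0r cos0 => h.
by split=> kE; move: h; rewrite kE ?cosN cospi => h; lra.
Qed.

Lemma tpz_cos1 (x : R) : cos x = 1 -> tpz x.
Proof.
move=> cx; have p0 := @pi_gt0 R.
have p20 : 0 < 2 * pi :> R by rewrite mulr_gt0.
pose k := Num.floor (x / (2 * pi)).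
exists k; have /andP[h1 h2] := floor_itv (x / (2 * pi)).
pose y := x - k%:~R * (2 * pi).
have cy : cos y = 1.
  have /trig_tpz/(_ x)[-> //] : tpz (- (k%:~R * (2 * pi))) by apply: tpzN; exists k.
have y0 : 0 <= y by rewrite subr_ge0 -ler_pdivlMr.
have y1 : y < 2 * pi.
  by move: h2; rewrite ltr_pdivrMr // intrD mulrDl mul1r /y; lra.
suff : y = 0 by rewrite /y => /eqP; rewrite subr_eq0 => /eqP.
have [yp|yp] := leP y pi.
  by apply: (@cos_inj R); rewrite ?in_itv /= ?lexx ?y0 ?yp ?pi_ge0 // cos0.
have : 2 * pi - y = 0; last by lra.
apply: (@cos_inj R); rewrite ?in_itv /= ?lexx ?pi_ge0 //.
  by apply/andP; split; lra.
have t2 := tpz_2pi.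
by rewrite cos0 -[RHS]cy -[RHS]cosN -[RHS](trig_tpz t2 (- y)).1 addrC.
Qed.

(** This says that t is an argument of (X, Y). At the origin every t qualifies, whence the
    nonvanishing hypothesis of [polar_tpz]. *)
Definition polar (X Y t : R) :=
  X = Num.sqrt (X ^+ 2 + Y ^+ 2) * cos t /\ Y = Num.sqrt (X ^+ 2 + Y ^+ 2) * sin t.

Lemma sqrt_gt0 (X Y : R) : (X, Y) <> (0, 0) -> 0 < Num.sqrt (X ^+ 2 + Y ^+ 2).
Proof.
move=> XY; rewrite sqrtr_gt0 lt_neqAle addr_ge0 ?sqr_ge0 // andbT eq_sym.
by apply/eqP => /eqP; rewrite paddr_eq0 ?sqr_ge0 // !sqrf_eq0 => /andP[/eqP X0 /eqP Y0];
  apply: XY; rewrite X0 Y0.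
Qed.

Lemma polar_tpz X Y t t' : (X, Y) <> (0, 0) -> polar X Y t -> polar X Y t' -> tpz (t - t').
Proof.
move=> /sqrt_gt0 N0; rewrite /polar; set N := Num.sqrt _ in N0 * => -[h1 h2] [h1' h2'].
have N0' : N != 0 by rewrite gt_eqF.
have ec : cos t = cos t' by apply: (mulfI N0'); rewrite -h1 -h1'.
have es : sin t = sin t' by apply: (mulfI N0'); rewrite -h2 -h2'.
by apply: tpz_cos1; rewrite cosB ec es -!expr2 cos2Dsin2.
Qed.

Lemma polarD_tpz X Y t d : tpz d -> polar X Y t -> polar X Y (t + d).
Proof. by move=> td; rewrite /polar; have [-> ->] := trig_tpz td t. Qed.

Lemma polar_scale (r X Y t : R) : 0 < r -> X = r * cos t -> Y = r * sin t -> polar X Y t.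
Proof.
move=> r0 hX hY; rewrite /polar.
have -> : X ^+ 2 + Y ^+ 2 = r ^+ 2.
  by rewrite hX hY !exprMn -mulrDr cos2Dsin2 mulr1.
by rewrite sqrtr_sqr gtr0_norm.
Qed.

Definition polar_lift {T : topologicalType} (A : set T) (X Y th : T -> R) :=
  con A th /\ forall x, A x -> polar (X x) (Y x) (th x).

Lemma polar_lift_star {T : normedModType R} (A : set T) (a : T) (X Y : T -> R) :
  compact A -> star A a -> con A X -> con A Y ->
  (forall x, A x -> (X x, Y x) <> (0, 0)) -> exists th, polar_lift A X Y th.
Proof.
move=> cA stA cX cY XY.
pose N x := Num.sqrt (X x ^+ 2 + Y x ^+ 2).
have N0 x : A x -> 0 < N x by move=> /XY/sqrt_gt0.
have N2 x : N x ^+ 2 = X x ^+ 2 + Y x ^+ 2 by rewrite sqr_sqrtr // addr_ge0 ?sqr_ge0.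
have cN : con A N.
  apply: (@con_cont_comp _ _ _ _ (fun x => X x ^+ 2 + Y x ^+ 2) Num.sqrt); last exact: sqrt_continuous.
  by apply: conD; [have := conM cX cX|have := conM cY cY]; apply: con_ext => x _; rewrite expr2.
have cNV : con A (fun x => (N x)^-1) by apply: conV => // x Ax; rewrite gt_eqF // N0.
have cs1 x : A x -> (X x / N x) ^+ 2 + (Y x / N x) ^+ 2 = 1.
  move=> Ax.
  by rewrite !expr_div_n -mulrDl -N2 divff // expf_neq0 // gt_eqF // N0.
have [th [cth hth]] := lift_star cA stA (conM cX cNV) (conM cY cNV) cs1.
exists th; split => // x Ax; have [ct st] := hth x Ax.
by rewrite /polar -/(N x) ct st; split; rewrite [RHS]mulrC divfK // gt_eqF // N0.
Qed.

(** Two distinct values would be more than pi apart, and the intermediate value theorem would yield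
    a value at distance exactly pi from the smaller one, outside 2 pi Z. *)
Lemma tpz_segment (f : R -> R) a b : a <= b -> con `[a, b] f ->
  (forall t, a <= t <= b -> tpz (f t)) -> f b = f a.
Proof.
move=> ab /con_subspace cf tf; have p0 := @pi_gt0 R.
have [ta tb] : tpz (f a) /\ tpz (f b) by split; apply: tf; rewrite lexx ?ab.
have noval v : Num.min (f a) (f b) <= v <= Num.max (f a) (f b) -> tpz v.
  by move=> /(IVT ab cf)[c]; rewrite in_itv /= => hc <-; exact: tf.
have big (d : R) : tpz d -> 0 < d -> pi <= d.
  move=> [k ->] d0.
  have k0 : (0 < k)%R.
    by move: d0; rewrite pmulr_lgt0 ?mulr_gt0 // ltr0z.
  have : 1 <= k%:~R :> R by rewrite -[1]/(1%:~R) ler_int; lia.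
  nra.
have [fab|fba|->//] := ltgtP (f a) (f b).
  have h := big _ (tpzB tb ta); rewrite subr_gt0 in h.
  have /noval/tpzB/(_ ta) : Num.min (f a) (f b) <= f a + pi <= Num.max (f a) (f b).
    by rewrite (min_idPl (ltW fab)) (max_idPr (ltW fab)); have := h fab; lra.
  by rewrite addrAC subrr add0r => /not_tpz_pi[].
have h := big _ (tpzB ta tb); rewrite subr_gt0 in h.
have /noval/tpzB/(_ tb) : Num.min (f a) (f b) <= f b + pi <= Num.max (f a) (f b).
  by rewrite (min_idPr (ltW fba)) (max_idPl (ltW fba)); have := h fba; lra.
by rewrite addrAC subrr add0r => /not_tpz_pi[].
Qed.

Lemma tpz_star {T : normedModType R} (A : set T) (a : T) (f : T -> R) :
  star A a -> con A f -> (forall x, A x -> tpz (f x)) -> forall x, A x -> f x = f a.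
Proof.
move=> [Aa stA] cf tf x Ax.
pose g (t : R) := a + t *: (x - a).
have gA (t : R) : `[0, 1] t -> A (g t).
  by rewrite /= in_itv /= => t01; exact: stA.
have g1 : g 1 = x by rewrite /g scale1r addrC subrK.
have g0 : g 0 = a by rewrite /g scale0r addr0.
rewrite -{1}g1 -{1}g0; apply: (@tpz_segment (f \o g)) => //.
  apply: con_comp cf => //; apply: con_continuous => t.
  by apply: cvgD; [exact: cvg_cst|apply: cvgZl; exact: cvg_id].
by move=> t t01; apply: tf; apply: gA; rewrite /= in_itv.
Qed.

(** The second lift is shifted by k. That a single k serves the whole overlap is what star-shaped
    overlaps provide later. *)
Lemma polar_glue {T : topologicalType} (A B : set T) (X Y th th' : T -> R) (k : R) :
  closed A -> closed B -> polar_lift A X Y th -> polar_lift B X Y th' ->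
  tpz k -> (forall x, A x -> B x -> th x - th' x = k) ->
  exists2 th2, polar_lift (A `|` B) X Y th2 & (forall x, A x -> th2 x = th x).
Proof.
move=> cA cB [c1 p1] [c2 p2] tk h.
pose th2 x := if `[< A x >] then th x else th' x + k.
have hA x : A x -> th2 x = th x by rewrite /th2 => Ax; case: asboolP.
have hB x : B x -> th2 x = th' x + k.
  by rewrite /th2 => Bx; case: asboolP => // Ax; rewrite -(h x Ax Bx) addrC subrK.
exists th2 => //; split.
  apply: conU => //; first by apply: con_ext c1 => x Ax; rewrite hA.
  apply: (con_ext (f := fun x => th' x + k)) => [x Bx|]; first by rewrite hB.
  by apply: conD => //; exact: con_cst.
by move=> x [Ax|Bx]; [rewrite hA //; exact: p1|rewrite hB //; apply: polarD_tpz => //; exact: p2].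
Qed.

Lemma no_circle_lift (th : R -> R) : con `[0, 2 * pi] th -> th (2 * pi) = th 0 ->
  (forall t, 0 <= t <= 2 * pi -> tpz (th t - t)) -> False.
Proof.
move=> cth th0 h; have p0 := @pi_gt0 R.
have : th (2 * pi) - 2 * pi = th 0 - 0.
  apply: (@tpz_segment (fun t => th t - t)) => //; first by rewrite mulr_ge0 // ltW.
  by apply: conB => //; apply: con_continuous => t; exact: cvg_id.
rewrite th0; lra.
Qed.

End Polar.

(** * Winding numbers in triangulated spheres *)

Section Chart.
Context {R : realType}.
Local Open Scope ring_scope.
Local Open Scope classical_set_scope.

Lemma con_row {T : topologicalType} n (A : set T) (f : T -> 'rV[R]_n) :
  (forall j, con A (fun x => f x ord0 j)) -> con A f.
Proof.
move=> cf x Ax B [P hP PB]; rewrite nbhs_simpl /=.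
have : \forall y \near within A (nbhs x), forall j, P ord0 j (f y ord0 j).
  by apply: filter_forall => j; exact: (cf j x Ax _ (hP ord0 j)).
by apply: filterS => y h; apply: PB => i j; rewrite ord1.
Qed.

Lemma con_coord {T : topologicalType} n (A : set T) (f : T -> 'rV[R]_n) j :
  con A f -> con A (fun x => f x ord0 j).
Proof.
move=> cf; apply: (@con_cont_comp _ _ _ _ f (fun M : 'rV[R]_n => M ord0 j)) => // x.
exact: coord_continuous.
Qed.

Local Notation i0 := (@Ordinal 3 0 isT).
Local Notation i1 := (@Ordinal 3 1 isT).
Local Notation i2 := (@Ordinal 3 2 isT).

Lemma ord3E (P : 'I_3 -> Prop) : P i0 -> P i1 -> P i2 -> forall i, P i.
Proof.
move=> h0 h1 h2 [[|[|[|//]]] hi]; [move: h0|move: h1|move: h2];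
by congr P; apply: val_inj.
Qed.

Lemma unit_sphereE (x : 'rV[R]_3) : @unit_sphere R x <->
  x ord0 i0 ^+ 2 + x ord0 i1 ^+ 2 + x ord0 i2 ^+ 2 = 1.
Proof.
rewrite /unit_sphere /= !big_ord_recl big_ord0 addr0 addrA.
have -> : ord0 = i0 :> 'I_3 by apply: val_inj.
have -> : lift i0 ord0 = i1 :> 'I_3 by apply: val_inj.
by have -> : lift i0 (lift ord0 ord0) = i2 :> 'I_3 by apply: val_inj.
Qed.

Definition row3 (a b c : R) : 'rV[R]_3 := \row_i nth 0 [:: a; b; c] i.

Lemma row3_eta (x : 'rV[R]_3) : row3 (x ord0 i0) (x ord0 i1) (x ord0 i2) = x.
Proof. by apply/rowP; apply: ord3E; rewrite !mxE. Qed.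

(* The reflection exchanging q with the north pole (the identity when q is the pole,
   since then the quotient is 0 / 0 = 0). *)
Definition reflect_coef (q x : 'rV[R]_3) : R :=
  2 * (x ord0 i0 * q ord0 i0 + x ord0 i1 * q ord0 i1 + x ord0 i2 * (q ord0 i2 - 1)) /
  (q ord0 i0 ^+ 2 + q ord0 i1 ^+ 2 + (q ord0 i2 - 1) ^+ 2).
Definition reflect_pole (q x : 'rV[R]_3) : 'rV[R]_3 :=
  row3 (x ord0 i0 - reflect_coef q x * q ord0 i0) (x ord0 i1 - reflect_coef q x * q ord0 i1)
       (x ord0 i2 - reflect_coef q x * (q ord0 i2 - 1)).

Lemma reflect_poleP (q : 'rV[R]_3) : @unit_sphere R q ->
  [/\ forall x, reflect_pole q (reflect_pole q x) = x,
      forall x, @unit_sphere R x -> @unit_sphere R (reflect_pole q x) &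
      reflect_pole q q = row3 0 0 1].
Proof.
move=> /unit_sphereE; rewrite /reflect_pole /reflect_coef.
move: (q ord0 i0) (q ord0 i1) (q ord0 i2) (row3_eta q) => a b c qE q1.
have [D0|D0] := eqVneq (a ^+ 2 + b ^+ 2 + (c - 1) ^+ 2) 0.
  move: (D0) => /eqP; rewrite paddr_eq0 ?addr_ge0 ?sqr_ge0 //.
  rewrite paddr_eq0 ?sqr_ge0 // !sqrf_eq0 => /andP[/andP[/eqP a0 /eqP b0] /eqP c1].
  rewrite !D0 invr0 a0 b0 c1; split=> [x|x|]; rewrite ?mulr0 ?mul0r ?subr0 ?row3_eta //.
  - by congr row3; lra.
split=> [x|x /unit_sphereE x1|].
- rewrite -[RHS]row3_eta !mxE /=; congr row3; field; exact: D0.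
- apply/unit_sphereE; rewrite !mxE /= -[RHS]x1; field; exact: D0.
- rewrite (_ : 2 * _ / _ = 1); last first.
    apply: (canLR (mulfK D0)); rewrite mul1r; rewrite -q1 in D0 *; nra.
  by congr row3; ring.
Qed.

Lemma con_reflect (T : topologicalType) (A : set T) (f : T -> 'rV[R]_3) q :
  con A f -> con A (fun x => reflect_pole q (f x)).
Proof.
move=> cf; apply: con_row.
have cc j : con A (fun x => f x ord0 j) by exact: con_coord.
have ck (k : R) j : con A (fun x => f x ord0 j * k) by apply: conM => //; exact: con_cst.
have cr : con A (fun x => reflect_coef q (f x)).
  apply: conM; last exact: con_cst; apply: conM; first exact: con_cst.
  by apply: conD => //; apply: conD.
by apply: ord3E; apply: (con_ext (f := fun x => _ - _)) => [x _|];
  [rewrite mxE /=; reflexivity| | rewrite mxE /=; reflexivity| |rewrite mxE /=; reflexivity|];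
  apply: conB => //; apply: conM => //; exact: con_cst.
Qed.

(** Stereographic projection, after a reflection that carries the image of p to the north pole. The
    inverse [kap] is defined on the whole plane, so every circle drawn there becomes a loop that
    avoids p. *)
Lemma plane_chart (n : nat) (X : set 'rV[R]_n) (p : 'rV[R]_n) :
  homeomorphic X (@unit_sphere R) -> X p ->
  exists (zx zy : 'rV[R]_n -> R) (kap : R * R -> 'rV[R]_n),
  [/\ con (X `\ p) zx /\ con (X `\ p) zy, continuous kap,
      forall z, (X `\ p) (kap z),
      forall z, (zx (kap z), zy (kap z)) = z &
      forall x, (X `\ p) x -> kap (zx x, zy x) = x].
Proof.
move=> [f [g [[/con_subspace cf /con_subspace cg] fX gS gf fg]]] Xp.
have Sq : @unit_sphere R (f p) by apply: fX; exists p.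
set q := f p in Sq.
have [HH HS Hq] := reflect_poleP Sq.
pose H := reflect_pole q.
pose y x := H (f x).
have Sy x : X x -> @unit_sphere R (y x) by move=> Xx; apply: HS; apply: fX; exists x.
have y2 x : (X `\ p) x -> 1 - y x ord0 i2 != 0.
  move=> [Xx xp]; rewrite subr_eq0; apply/eqP => h.
  have /unit_sphereE := Sy x Xx; rewrite -h expr1n => s1.
  have : y x ord0 i0 ^+ 2 + y x ord0 i1 ^+ 2 == 0 by apply/eqP; lra.
  rewrite paddr_eq0 ?sqr_ge0 // !sqrf_eq0 => /andP[/eqP y0 /eqP y1].
  apply: xp => /=; rewrite -(gf x Xx) -(gf p Xp) -/q; congr g.
  rewrite -[LHS]HH -[RHS]HH; congr (reflect_pole q _).
  by rewrite Hq -/H -/(y x) -[LHS]row3_eta y0 y1 -h.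
pose zx x := y x ord0 i0 / (1 - y x ord0 i2).
pose zy x := y x ord0 i1 / (1 - y x ord0 i2).
pose D (z : R * R) := 1 + z.1 ^+ 2 + z.2 ^+ 2.
have D0 z : D z != 0.
  by rewrite gt_eqF // /D -addrA ltr_wpDr // addr_ge0 // sqr_ge0.
pose s (z : R * R) := row3 (2 * z.1 / D z) (2 * z.2 / D z) ((z.1 ^+ 2 + z.2 ^+ 2 - 1) / D z).
have Ss z : @unit_sphere R (s z).
  by apply/unit_sphereE; rewrite !mxE /=; have := D0 z; rewrite /D => ?; field.
have s2 z : s z ord0 i2 != 1.
  rewrite mxE /=; apply/eqP => /(canRL (mulfVK (D0 z))); rewrite mul1r /D; lra.
pose kap z := g (H (s z)).
have fkap z : y (kap z) = s z by rewrite /y /kap fg ?HH //; exact: HS.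
have kapX z : (X `\ p) (kap z).
  split; first by apply: gS; exists (H (s z)) => //; exact: HS.
  move=> /= h; have := s2 z; rewrite -fkap h /y -/q /H Hq mxE /= eqxx //.
have cy : con (X `\ p) y.
  by apply: con_reflect; apply: con_sub cf => x [].
have c1 (k : R) (h : R * R -> R) : con setT h -> con setT (fun z => k * h z).
  by move=> ch; apply: conM => //; exact: con_cst.
have cfst : con setT (fun z : R * R => z.1) by apply: con_continuous => z; exact: cvg_fst.
have csnd : con setT (fun z : R * R => z.2) by apply: con_continuous => z; exact: cvg_snd.
have csq (h : R * R -> R) : con setT h -> con setT (fun z => h z ^+ 2).
  by move=> ch; have := conM ch ch; apply: con_ext => z _; rewrite expr2.
have cD : con setT D.
  apply: conD; last exact: csq; apply: conD; [exact: con_cst|exact: csq].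
have cDV : con setT (fun z => (D z)^-1) by apply: conV => // z _.
have cs : con setT s.
  apply: con_row; apply: ord3E.
  - by apply: (con_ext (f := fun z : R * R => 2 * z.1 / D z)) => [z _|];
      [rewrite mxE|apply: conM => //; exact: c1].
  - by apply: (con_ext (f := fun z : R * R => 2 * z.2 / D z)) => [z _|];
      [rewrite mxE|apply: conM => //; exact: c1].
  - apply: (con_ext (f := fun z : R * R => (z.1 ^+ 2 + z.2 ^+ 2 - 1) / D z)) => [z _|];
      first by rewrite mxE.
    apply: conM => //; apply: conB; last exact: con_cst.
    by apply: conD; exact: csq.
exists zx, zy, kap; split => //.
- have cz j : con (X `\ p) (fun x => y x ord0 j / (1 - y x ord0 i2)).
    apply: conM; first exact: con_coord.
    by apply: conV => //; apply: conB; [exact: con_cst|exact: con_coord].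
  by split; exact: cz.
- move=> z; have ck : con setT kap.
    by apply: (con_comp (A := @unit_sphere R)) cg;
      [exact: con_reflect|move=> x _; exact: HS].
  by move=> P /(ck z I); rewrite !nbhs_simpl /within /=; apply: filterS => y' /(_ I).
- move=> [a b]; rewrite /zx /zy fkap !mxE /=; have := D0 (a, b); rewrite /D /= => D0'.
  have -> : 1 - (a ^+ 2 + b ^+ 2 - 1) / (1 + a ^+ 2 + b ^+ 2) = 2 / (1 + a ^+ 2 + b ^+ 2) by field.
  by congr pair; field.
- move=> x xX; have Xx := xX.1; rewrite /kap -[RHS](gf x Xx); congr g.
  rewrite -[RHS]HH; congr (H _).
  have y20 := y2 x xX; have /unit_sphereE yS := Sy x Xx.
  change (s (zx x, zy x) = y x); rewrite -[RHS]row3_eta /s /D /zx /zy /=.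
  move: (y x ord0 i0) (y x ord0 i1) (y x ord0 i2) y20 yS => a b c c0 abc.
  have hD : 1 + (a / (1 - c)) ^+ 2 + (b / (1 - c)) ^+ 2 = 2 / (1 - c).
    have -> : 1 + (a / (1 - c)) ^+ 2 + (b / (1 - c)) ^+ 2 = ((1 - c) ^+ 2 + (a ^+ 2 + b ^+ 2)) / (1 - c) ^+ 2 by field.
    have -> : a ^+ 2 + b ^+ 2 = 1 - c ^+ 2 by lra.
    by field.
  rewrite hD; congr row3; try by field.
  have -> : (a / (1 - c)) ^+ 2 + (b / (1 - c)) ^+ 2 - 1 = 2 / (1 - c) - 2.
    by rewrite -hD; ring.
  by field.
Qed.

End Chart.

(** * Simplices, stars and the exclusion of tetrahedra *)

Section SimplicialGeometry.
Context {R : realType} {n : nat}.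
Local Open Scope ring_scope.
Local Open Scope classical_set_scope.
Implicit Types (x y : 'rV[R]_n) (v w : 'I_n) (s tau : {set 'I_n}) (K : {set {set 'I_n}}).

Definition barycentric x := (forall v, 0 <= x ord0 v) /\ \sum_v x ord0 v = 1.

Definition simplex s : set 'rV[R]_n :=
  [set x | barycentric x /\ forall v, v \notin s -> x ord0 v = 0].

(** The closed star: joining tau to the carrier also admits points on faces that miss tau. *)
Definition star_of K tau : set 'rV[R]_n :=
  [set x | barycentric x /\ (carrier x :|: tau)%SET \in K].

Lemma mem_carrier x v : (v \in carrier x) = (x ord0 v != 0).
Proof. by rewrite inE. Qed.

Lemma barycentric_neq0 x : barycentric x -> exists v, v \in carrier x.
Proof.
move=> [x0 x1]; apply: contrapT => /forallNP h.
have : \sum_v x ord0 v = 0.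
  by apply: big1 => v _; apply/eqP; apply: contraPT (h v); rewrite mem_carrier => ->.
by rewrite x1 => /eqP; rewrite oner_eq0.
Qed.

Lemma realizationE K x : realization K x <-> barycentric x /\ carrier x \in K.
Proof. by split=> [[h1 h2 h3]|[[h1 h2] h3]]; split. Qed.

Lemma carrier_simplex s x : simplex s x -> carrier x \subset s.
Proof.
move=> [_ h]; apply/fintype.subsetP => v; rewrite mem_carrier.
by apply: contraR => /h ->.
Qed.

Lemma simplex_carrier x : barycentric x -> simplex (carrier x) x.
Proof. by move=> bx; split => // v; rewrite mem_carrier negbK => /eqP. Qed.

Lemma barycentric_le1 x v : barycentric x -> x ord0 v <= 1.
Proof.
move=> [x0 <-]; rewrite (bigD1 v) //= lerDl; apply: sumr_ge0 => w _; exact: x0.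
Qed.

Lemma coord_cont v : continuous (fun x : 'rV[R]_n => x ord0 v).
Proof. by move=> x; exact: coord_continuous. Qed.

Lemma con_sum_coord (A : set 'rV[R]_n) : con A (fun x : 'rV[R]_n => \sum_v x ord0 v).
Proof. by apply: con_sum => v; apply: con_continuous; exact: coord_cont. Qed.

Lemma con_setT {T U : topologicalType} (f : T -> U) : con setT f -> continuous f.
Proof. by move=> cf x P /(cf x I); rewrite !nbhs_simpl /within /=; apply: filterS => y /(_ I). Qed.

Lemma closed_sublevel (f : 'rV[R]_n -> R) (k : R) : continuous f -> closed [set x | f x <= k].
Proof. by move=> cf; apply: (@preimage_closed _ _ f [set x | x <= k]); [move=> x _; exact: cf|exact: closed_le]. Qed.

Lemma simplex_closed s : closed (simplex s).
Proof.
have -> : simplex s = \bigcap_(v in setT) [set x : 'rV[R]_n | - x ord0 v <= 0] `&`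
    [set x : 'rV[R]_n | \sum_v x ord0 v = 1] `&`
    \bigcap_(v in [set v | v \notin s]) [set x : 'rV[R]_n | x ord0 v = 0].
  apply/seteqP; split => x /=.
    by move=> [[x0 x1] xs]; split => //; split => // v _ /=; rewrite oppr_le0.
  by move=> [[x0 x1] xs]; split => //; split => // v; have := x0 v I; rewrite /= oppr_le0.
apply: closedI; first apply: closedI.
- apply: closed_bigI => v _; apply: (@closed_sublevel (fun x : 'rV[R]_n => - x ord0 v)).
  by apply: con_setT; apply: conN; apply: con_continuous; exact: coord_cont.
- apply: (@preimage_closed _ _ (fun x : 'rV[R]_n => \sum_v x ord0 v) [set x | x = 1]).
    by move=> x _; apply: con_setT; exact: con_sum_coord.
  exact: closed_eq.
- apply: closed_bigI => v _.
  by apply: (@preimage_closed _ _ (fun x : 'rV[R]_n => x ord0 v) [set x | x = 0]);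
    [move=> x _; exact: coord_cont|exact: closed_eq].
Qed.

Lemma barycentric_compact (A : set 'rV[R]_n) : closed A -> (forall x, A x -> barycentric x) ->
  compact A.
Proof.
move=> cA bA; apply: (subclosed_compact cA (B := [set x : 'rV[R]_n | forall v, `[0, 1] (x ord0 v)])).
  have := @rV_compact R n (fun=> [set` `[0, 1]%R]).
  by apply => v; exact: segment_compact.
move=> x /bA bx v /=; rewrite in_itv /= bx.1 /=; exact: barycentric_le1.
Qed.

Section Complex.
Variable K : {set {set 'I_n}}.
Hypothesis cK : simplicial_complex K.

Lemma star_ofE tau : star_of K tau =
  \bigcup_(s in [set s : {set 'I_n} | (s \in K) && (tau \subset s)]) simplex s.
Proof.
apply/seteqP; split => x /=.
  move=> [bx h]; exists (carrier x :|: tau)%SET; first by rewrite /= h finset.subsetUr.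
  split => // v; rewrite inE negb_or => /andP[+ _].
  by rewrite mem_carrier negbK => /eqP.
move=> [s /= /andP[sK ts] xs]; split; first by case: xs.
apply: (simplex_face cK sK); first by rewrite finset.subUset (carrier_simplex xs) ts.
have [v vx] := barycentric_neq0 xs.1.
by apply/finset.set0Pn; exists v; rewrite inE vx.
Qed.

Lemma star_of_closed tau : closed (star_of K tau).
Proof.
rewrite star_ofE; apply: closed_bigcup; first exact: finite_finset.
by move=> s _; exact: simplex_closed.
Qed.

Lemma vertexE v w : (vertex_point R v : 'rV[R]_n) ord0 w = (w == v)%:R.
Proof. by rewrite /vertex_point mxE eqxx. Qed.

Lemma barycentric_vertex v : barycentric (vertex_point R v).
Proof.
split=> [w|]; first by rewrite vertexE ler0n.
rewrite (bigD1 v) //= vertexE eqxx big1 ?addr0 // => w /negbTE wv.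
by rewrite vertexE wv.
Qed.

Lemma carrier_vertex v : carrier (vertex_point R v) = [set v]%SET.
Proof.
by apply/setP => w; rewrite mem_carrier vertexE inE pnatr_eq0 eqb0 negbK.
Qed.

Lemma vertex_realization v : realization K (vertex_point R v).
Proof.
apply/realizationE; split; first exact: barycentric_vertex.
by rewrite carrier_vertex; exact: (simplex_vertex cK).
Qed.

Lemma barycentric_segment x y (t : R) : barycentric x -> barycentric y -> 0 <= t <= 1 ->
  barycentric (x + t *: (y - x)).
Proof.
move=> [x0 x1] [y0 y1] /andP[t0 t1]; split=> [v|].
  rewrite !mxE.
  have -> : x ord0 v + t * (y ord0 v - x ord0 v) = (1 - t) * x ord0 v + t * y ord0 v by ring.
  by rewrite addr_ge0 ?mulr_ge0 // subr_ge0.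
under eq_bigr do rewrite !mxE.
by rewrite big_split /= -mulr_sumr sumrB x1 y1 subrr mulr0 addr0.
Qed.

Lemma star_of_segment tau w x (t : R) : star_of K tau x -> w \in tau -> 0 <= t <= 1 ->
  star_of K tau (vertex_point R w + t *: (x - vertex_point R w)).
Proof.
move=> [bx h] wt t01; split; first by apply: barycentric_segment => //; exact: barycentric_vertex.
apply: (simplex_face cK h).
  apply/fintype.subsetP => v; rewrite !inE => /orP[|->]; last by rewrite orbT.
  rewrite !mxE eqxx /=; have [->|vw] := eqVneq v w; first by rewrite wt orbT.
  by rewrite add0r subr0; apply: contraNT; rewrite negb_or negbK => /andP[/eqP -> _]; rewrite mulr0.
by apply/finset.set0Pn; exists w; rewrite inE wt orbT.
Qed.

Lemma star_of_vertex tau w : (w |: tau)%SET \in K -> star_of K tau (vertex_point R w).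
Proof. by move=> h; split; [exact: barycentric_vertex|rewrite carrier_vertex]. Qed.

(** For a triangle tau with vertex v and m < 1/3 this leaves out the barycentre of tau, yet it
    remains star-shaped about every vertex of tau other than v. *)
Definition low_star tau (m : R) v := star_of K tau `&` [set x | x ord0 v <= m].

Lemma low_star_closed tau m v : closed (low_star tau m v).
Proof. by apply: closedI; [exact: star_of_closed|apply: closed_sublevel; exact: coord_cont]. Qed.

Lemma low_star_compact tau m v : compact (low_star tau m v).
Proof. by apply: barycentric_compact; [exact: low_star_closed|move=> x [[]]]. Qed.

Lemma low_star_segment tau m v w x (t : R) : low_star tau m v x -> w \in tau -> w != v ->
  0 <= t <= 1 -> low_star tau m v (vertex_point R w + t *: (x - vertex_point R w)).
Proof.
move=> [sx xm] wt wv t01; split; first exact: star_of_segment.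
rewrite /= !mxE eqxx (eq_sym v) (negPf wv) /= add0r subr0 (le_trans _ xm) //.
have /andP[t0 t1] := t01; have := sx.1.1 v => x0; nra.
Qed.

Lemma low_star_vertex tau m v w : tau \in K -> w \in tau -> w != v -> 0 <= m ->
  low_star tau m v (vertex_point R w).
Proof.
move=> tK wt wv m0; split; last by rewrite /= vertexE eq_sym (negPf wv).
by apply: star_of_vertex; rewrite (finset.setUidPr _) // finset.sub1set.
Qed.

Lemma low_star_star tau m v w : tau \in K -> w \in tau -> w != v -> 0 <= m ->
  star (low_star tau m v) (vertex_point R w).
Proof.
move=> tK wt wv m0; split; first exact: low_star_vertex.
by move=> x t lx t01; exact: low_star_segment.
Qed.

Lemma low_starI_star tau m v v' w : tau \in K -> w \in tau -> w != v -> w != v' -> 0 <= m ->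
  star (low_star tau m v `&` low_star tau m v') (vertex_point R w).
Proof.
move=> tK wt wv wv' m0; split; first by split; exact: low_star_vertex.
by move=> x t [lx lx'] t01; split; exact: low_star_segment.
Qed.

Definition circle (z : R * R) (r t : R) : R * R := (z.1 + r * cos t, z.2 + r * sin t).

Lemma circle_continuous z r : continuous (circle z r).
Proof.
move=> t.
have h1 : (fun t => z.1 + r * cos t) @ t --> z.1 + r * cos t.
  by apply: cvgD; [exact: cvg_cst|apply: cvgM; [exact: cvg_cst|exact: continuous_cos]].
have h2 : (fun t => z.2 + r * sin t) @ t --> z.2 + r * sin t.
  by apply: cvgD; [exact: cvg_cst|apply: cvgM; [exact: cvg_cst|exact: continuous_sin]].
exact: (cvg_pair h1 h2).
Qed.

Lemma circle_2pi z r : circle z r (2 * pi) = circle z r 0.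
Proof.
have t2 := @tpz_2pi R.
by rewrite /circle -[2 * pi]add0r; have [-> ->] := trig_tpz t2 0.
Qed.

Lemma small_disc (kap : R * R -> 'rV[R]_n) (z : R * R) (e : R) : continuous kap -> 0 < e ->
  exists r : R, 0 < r /\ forall z', `|z'.1 - z.1| <= r -> `|z'.2 - z.2| <= r ->
    forall v, `|kap z' ord0 v - kap z ord0 v| < e.
Proof.
move=> ck e0.
have : \forall z' \near z, forall v, `|kap z' ord0 v - kap z ord0 v| < e.
  apply: (@filter_forall _ _ (fun v => [set z' | `|kap z' ord0 v - kap z ord0 v| < e]) (nbhs z)) => v.
  have /cvgrPdist_lt/(_ e e0) : (fun z' => kap z' ord0 v) @ z --> kap z ord0 v.
    by apply: (@continuous_comp _ _ _ kap (fun x : 'rV[R]_n => x ord0 v)); [exact: ck|exact: coord_cont].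
  by apply: filterS => z'; rewrite distrC.
move=> /nbhs_ballP[d /= d0 hd].
exists (d / 2); split; first by rewrite divr_gt0.
move=> z' h1 h2; apply: hd; split; rewrite /ball /= distrC; lra.
Qed.

Lemma circle_near z r t : 0 <= r ->
  `|(circle z r t).1 - z.1| <= r /\ `|(circle z r t).2 - z.2| <= r.
Proof.
move=> r0; rewrite /circle /= ![_ + _ * _ - _]addrAC !subrr !add0r !normrM (ger0_norm r0).
by split; rewrite ler_piMr // ler_norml ?cos_geN1 ?cos_le1 ?sin_geN1 ?sin_le1.
Qed.

Hypothesis hK : homeomorphic (@realization R n K) (@unit_sphere R).

Lemma polar_star_diff (A B : set 'rV[R]_n) (a : 'rV[R]_n) (X Y th th' : 'rV[R]_n -> R) :
  star (A `&` B) a -> (forall x, A x -> (X x, Y x) <> (0, 0)) ->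
  polar_lift A X Y th -> polar_lift B X Y th' ->
  tpz (th a - th' a) /\ forall x, A x -> B x -> th x - th' x = th a - th' a.
Proof.
move=> st XY [c1 p1] [c2 p2].
have tz x : (A `&` B) x -> tpz (th x - th' x).
  by move=> [Ax Bx]; apply: (polar_tpz (XY x Ax)); [exact: p1|exact: p2].
split; first by apply: tz; case: st.
move=> x Ax Bx; apply: (tpz_star (f := fun x => th x - th' x) st _ tz) => //.
by apply: conB; [apply: con_sub c1 => ? []|apply: con_sub c2 => ? []].
Qed.

(** A fourth vertex d would allow a loop around the barycentre p of abc to be filled in without
    meeting p. The low stars for a, b, c overlap pairwise in sets star-shaped about the remaining
    vertex, so lifts on them differ by constants there; since d lies in all three, the constants are
    compatible. An argument around p then exists on the whole union, which contains a loop of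
    winding number 1. *)
Lemma no_tetrahedron (a b c d : 'I_n) : uniq [:: a; b; c; d] ->
  [set a; b; c; d]%SET \notin K.
Proof.
move=> abcd; apply/negP => TK.
have [ab ac bc] : [/\ a != b, a != c & b != c].
  by move: abcd; rewrite /= !inE !negb_or => /and4P[/and3P[-> -> _] /andP[-> _] _ _].
have [ba ca cb] : [/\ b != a, c != a & c != b] by rewrite !(eq_sym c) (eq_sym b).
have [da db dc] : [/\ d != a, d != b & d != c].
  move: abcd; rewrite /= !inE !negb_or => /and4P[/and3P[_ _ +] /andP[_ +] + _].
  by rewrite !(eq_sym d) => -> -> ->.
pose tau := [set a; b; c]%SET.
have [at_ bt ct] : [/\ a \in tau, b \in tau & c \in tau] by rewrite !inE !eqxx !orbT.
have tauK : tau \in K.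
  apply: (simplex_face cK TK); first by apply/fintype.subsetP => v; rewrite !inE => ->.
  by apply/finset.set0Pn; exists a.
have dtauK : (d |: tau)%SET \in K by rewrite finset.setUC.
pose p : 'rV[R]_n := \row_v (if v \in tau then 3^-1 else 0).
have pE v : p ord0 v = if v \in tau then 3^-1 else 0 by rewrite mxE.
have sum3 (f : 'I_n -> R) : \sum_v f v = f a + f b + f c + \sum_(v | v \notin tau) f v.
  rewrite (bigID (mem tau)) /=; congr (_ + _).
  rewrite /tau -!finset.setUA !big_setU1 /= ?big_set1 ?addrA // !inE ?negb_or ?ab ?ac ?bc //.
have bp : barycentric p.
  split=> [v|]; first by rewrite pE; case: ifP => //; rewrite invr_ge0.
  rewrite sum3 !pE at_ bt ct big1 ?addr0; first by field.
  by move=> v /negbTE vt; rewrite pE vt.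
have carp : carrier p = tau.
  apply/setP => v; rewrite mem_carrier pE; case: ifP => _; last by rewrite eqxx.
  by rewrite invr_eq0 pnatr_eq0.
have Xp : realization K p by apply/realizationE; rewrite carp.
pose p' : 'rV[R]_n := vertex_point R a.
have pp' : p <> p'.
  move=> /(congr1 (fun x : 'rV[R]_n => x ord0 b)); rewrite pE bt vertexE eq_sym (negPf ab) => /eqP.
  by rewrite invr_eq0 pnatr_eq0.
have [zx [zy [kap [[czx czy] ck kX zk kz]]]] := plane_chart hK (vertex_realization a).
pose z0 := (zx p, zy p).
have kz0 : kap z0 = p by apply: kz; split => // /esym /pp'.
have e0 : 0 < 6^-1 :> R by rewrite invr_gt0.
have [r [r0 hr]] := small_disc z0 ck e0.
pose gam t := kap (circle z0 r t).
have gam_in t v : v \in tau -> 6^-1 < gam t ord0 v.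
  move=> vt; have [h1 h2] := circle_near z0 t (ltW r0).
  have := hr _ h1 h2 v; rewrite kz0 pE vt -/(gam t) ltr_norml => /andP[h _].
  have -> : 6^-1 = - 6^-1 + 3^-1 :> R by field.
  by rewrite -ltrBrDr.
(* [eta] is the small circle around p blown up by the homothety of centre p and ratio 2,
   so that contracting the star back towards p avoids the point removed by the chart. *)
pose eta t : 'rV[R]_n := gam t + (gam t - p).
have etaE t v : eta t ord0 v = 2 * gam t ord0 v - p ord0 v by rewrite !mxE; ring.
have gamK t : barycentric (gam t) /\ carrier (gam t) \in K.
  by apply/realizationE; case: (kX (circle z0 r t)).
have eta_star t : star_of K tau (eta t).
  have [[g0 g1] gK] := gamK t; split; first split=> [v|].
  - rewrite etaE pE; case: ifP => vt; last by have := g0 v; lra.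
    have := gam_in t v vt; have -> : 6^-1 = 3^-1 / 2 :> R by field.
    lra.
  - under eq_bigr do rewrite etaE.
    by rewrite sumrB -mulr_sumr g1 bp.2; ring.
  apply: (simplex_face cK gK).
    apply/fintype.subsetP => v; rewrite finset.in_setU !mem_carrier => /orP[|vt]; last first.
      by rewrite gt_eqF // (lt_trans _ (gam_in t v vt)).
    apply: contra => /eqP gv; rewrite etaE gv pE; case: ifP => vt.
      by have := gam_in t v vt; rewrite gv ltNge invr_ge0 ler0n.
    by rewrite mulr0 subr0.
  by apply/finset.set0Pn; exists a; rewrite inE at_ orbT.
have min_lt x : star_of K tau x -> x <> p ->
    Num.min (x ord0 a) (Num.min (x ord0 b) (x ord0 c)) < 3^-1.
  move=> [[x0 x1] _] xp; rewrite ltNge; apply/negP; rewrite !le_min => /and3P[xa xb xc].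
  apply: xp; move: x1; rewrite sum3 => x1.
  have xs : \sum_(v | v \notin tau) x ord0 v = 0.
    apply/eqP; rewrite eq_le sumr_ge0 ?andbT //.
    have : 3^-1 + 3^-1 + 3^-1 = 1 :> R by field.
    lra.
  have third : 3^-1 + 3^-1 + 3^-1 = 1 :> R by field.
  apply/rowP => v; rewrite pE; case: ifP => [|/negbT vt].
    by rewrite !inE -orbA => /or3P[] /eqP ->; rewrite xs in x1; lra.
  have /psumr_eq0P h : forall v, v \notin tau -> 0 <= x ord0 v by [].
  by apply: h.
have ceta : continuous eta.
  have cgam : continuous gam.
    by move=> t; apply: continuous_comp; [exact: circle_continuous|exact: ck].
  by move=> t; apply: cvgD; [exact: cgam|apply: cvgB; [exact: cgam|exact: cvg_cst]].
have eta_p t : eta t <> p.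
  move=> h; have : gam t = p.
    apply/rowP => v; have := congr1 (fun x : 'rV[R]_n => x ord0 v) h; rewrite /= etaE; lra.
  move=> gp; have := zk (circle z0 r t); rewrite -/(gam t) gp -/z0 => /(congr1 (fun z => (z.1 - z0.1) ^+ 2 + (z.2 - z0.2) ^+ 2)).
  rewrite /circle /= !subrr expr0n addr0 ![_ + _ * _ - _]addrAC !subrr !add0r.
  rewrite !exprMn -mulrDr cos2Dsin2 mulr1 => /esym/eqP.
  by rewrite sqrf_eq0 gt_eqF.
(* On the loop the least of the three coordinates is below 1/3. Its maximum m over the compact
   parameter interval confines the loop to the union of the three low stars. *)
have [m [m0 m1 hm]] : exists m : R, [/\ 0 <= m, m < 3^-1 & forall t, 0 <= t <= 2 * pi ->
    Num.min (eta t ord0 a) (Num.min (eta t ord0 b) (eta t ord0 c)) <= m].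
  pose f t := Num.min (eta t ord0 a) (Num.min (eta t ord0 b) (eta t ord0 c)).
  have cf : continuous f.
    have cc v : continuous (fun t => eta t ord0 v).
      by move=> t; apply: (@continuous_comp _ _ _ eta (fun x : 'rV[R]_n => x ord0 v)); [exact: ceta|exact: coord_cont].
    move=> t; apply: (@continuous_min _ _ (fun t => eta t ord0 a) (fun t => Num.min (eta t ord0 b) (eta t ord0 c))).
      exact: cc.
    by apply: (@continuous_min _ _ (fun t => eta t ord0 b) (fun t => eta t ord0 c)); exact: cc.
  have p20 : 0 <= 2 * pi :> R by rewrite mulr_ge0 // pi_ge0.
  have [t0 _ ht0] := EVT_max p20 (continuous_subspaceT cf).
  exists (f t0); split.
  - by rewrite /f !le_min !(eta_star t0).1.1.
  - by apply: min_lt.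
  - by move=> t t01; apply: ht0; rewrite in_itv.
pose hh (x : 'rV[R]_n) := p + 2^-1 *: (x - p).
have hhX x : star_of K tau x -> (realization K `\ p') (hh x).
  move=> [bx xK]; split.
    apply/realizationE; split; first by apply: barycentric_segment => //; rewrite invr_ge0 invf_le1 // ler1n ler0n.
    apply: (simplex_face cK xK).
      apply/fintype.subsetP => v; rewrite finset.in_setU !mem_carrier -carp mem_carrier.
      rewrite !mxE -pE; apply: contraNT; rewrite negb_or !negbK => /andP[/eqP -> /eqP ->].
      by rewrite subrr mulr0 addr0.
    have [v vh] : exists v, v \in carrier (hh x).
      by apply: barycentric_neq0; apply: barycentric_segment => //; rewrite invr_ge0 invf_le1 // ler1n ler0n.
    by apply/finset.set0Pn; exists v.
  move=> /(congr1 (fun x : 'rV[R]_n => x ord0 b)).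
  rewrite vertexE eq_sym (negPf ab) !mxE bt => h.
  have := bx.1 b; have : 0 < 3^-1 :> R by rewrite invr_gt0.
  move: h; set u := x _ _; move=> h h1 h2.
  have : 3^-1 + 2^-1 * (u - 3^-1) = 3^-1 / 2 + u / 2 by field.
  rewrite h mulr0n; lra.
pose XX x := zx (hh x) - z0.1.
pose YY x := zy (hh x) - z0.2.
have chh : continuous hh by exact: homothety_continuous.
have cXX v : con (low_star tau m v) XX.
  apply: conB; last exact: con_cst.
  by apply: con_comp czx; [exact: con_continuous|move=> x [+ _]; exact: hhX].
have cYY v : con (low_star tau m v) YY.
  apply: conB; last exact: con_cst.
  by apply: con_comp czy; [exact: con_continuous|move=> x [+ _]; exact: hhX].
have XY0 v x : v \in tau -> low_star tau m v x -> (XX x, YY x) <> (0, 0).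
  move=> vt [sx xm] [/eqP + /eqP]; rewrite !subr_eq0 => /eqP hx /eqP hy.
  have := kz (hh x) (hhX x sx); rewrite hx hy -/z0 kz0 => /(congr1 (fun x : 'rV[R]_n => x ord0 v)).
  rewrite !mxE vt; move: xm => /=; set u := x _ _ => xm h.
  have : 3^-1 = 3^-1 / 2 + u / 2 by rewrite {1}h; field.
  lra.
have [tha la] := polar_lift_star (@low_star_compact tau m a)
  (low_star_star tauK bt ba m0) (cXX a) (cYY a) (fun x => XY0 a x at_).
have [thb lb] := polar_lift_star (@low_star_compact tau m b)
  (low_star_star tauK ct cb m0) (cXX b) (cYY b) (fun x => XY0 b x bt).
have [thc lc] := polar_lift_star (@low_star_compact tau m c)
  (low_star_star tauK at_ ac m0) (cXX c) (cYY c) (fun x => XY0 c x ct).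
have [tk hk] := polar_star_diff (low_starI_star tauK ct ca cb m0)
  (fun x => XY0 a x at_) la lb.
have [th2 l2 _] := polar_glue (@low_star_closed tau m a) (@low_star_closed tau m b) la lb tk hk.
have l2a : polar_lift (low_star tau m a) XX YY th2.
  by split; [apply: con_sub l2.1 => x; left|move=> x ax; apply: l2.2; left].
have l2b : polar_lift (low_star tau m b) XX YY th2.
  by split; [apply: con_sub l2.1 => x; right|move=> x ax; apply: l2.2; right].
have [tk1 hk1] := polar_star_diff (low_starI_star tauK bt ba bc m0)
  (fun x => XY0 a x at_) l2a lc.
have [tk2 hk2] := polar_star_diff (low_starI_star tauK at_ ab ac m0)
  (fun x => XY0 b x bt) l2b lc.
have dlow v : v \in tau -> low_star tau m v (vertex_point R d).
  move=> vt; split; first exact: star_of_vertex.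
  rewrite /= vertexE; case: eqP => // vd; move: vt; rewrite vd !inE.
  by rewrite (negPf da) (negPf db) (negPf dc).
(* The constants on the overlaps of the third star with the other two are both the difference of the
   lifts at d. *)
have kk : th2 (vertex_point R a) - thc (vertex_point R a) = th2 (vertex_point R b) - thc (vertex_point R b).
  by rewrite -(hk1 (vertex_point R d)) -?(hk2 (vertex_point R d)) //; exact: dlow.
have [|th3 l3 _] := polar_glue (closedU (@low_star_closed tau m a) (@low_star_closed tau m b))
  (@low_star_closed tau m c) l2 lc tk1.
  by move=> x [xa|xb] xc; [exact: hk1|rewrite hk2].
have eta_in t : 0 <= t <= 2 * pi -> (low_star tau m a `|` low_star tau m b `|` low_star tau m c) (eta t).
  move=> /hm; rewrite !ge_min => /or3P[h|h|h]; [left; left|left; right|right]; split => //.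
apply: (@no_circle_lift R (th3 \o eta)).
- apply: con_comp l3.1; first exact: con_continuous.
  by move=> t /=; rewrite in_itv; exact: eta_in.
- by rewrite /= /eta /gam circle_2pi.
- move=> t t01; have := l3.2 _ (eta_in t t01).
  have hg : hh (eta t) = gam t.
    by apply/rowP => v; rewrite !mxE; field.
  have -> : XX (eta t) = r * cos t.
    have := congr1 fst (zk (circle z0 r t)); rewrite /XX hg -/(gam t) /= => ->; ring.
  have -> : YY (eta t) = r * sin t.
    have := congr1 snd (zk (circle z0 r t)); rewrite /YY hg -/(gam t) /= => ->; ring.
  move=> pl; apply: (polar_tpz _ pl); last exact: polar_scale r0 _ _.
  move=> [/eqP + /eqP]; rewrite !mulf_eq0 gt_eqF //= => /eqP c0 /eqP s0.
  by have := cos2Dsin2 t; rewrite c0 s0 expr0n addr0 => /esym/eqP; rewrite oner_eq0.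
Qed.

End Complex.
End SimplicialGeometry.

(** * At most two triangles on an edge *)

Section Book.
Context {R : realType}.
Local Open Scope ring_scope.
Local Open Scope classical_set_scope.

Definition rectangle (a b c d : R) : set (R * R) :=
  [set z | a <= z.1 <= b /\ c <= z.2 <= d].

Lemma rectangle_compact a b c d : compact (rectangle a b c d).
Proof.
have -> : rectangle a b c d = `[a, b] `*` `[c, d].
  by apply/seteqP; split => z /=; rewrite !in_itv.
by apply: compact_setX; exact: segment_compact.
Qed.

Lemma rectangle_star a b c d : a <= b -> c <= d -> star (rectangle a b c d) (a, c).
Proof.
move=> ab cd; split; first by split; rewrite /= lexx.
move=> [x y] t [/= /andP[h1 h2] /andP[h3 h4]] /andP[t0 t1].
split; apply/andP; split; rewrite /= /GRing.scale /=; nra.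
Qed.

Lemma fst_cont : continuous (fun z : R * R => z.1).
Proof. by move=> z; exact: cvg_fst. Qed.
Lemma snd_cont : continuous (fun z : R * R => z.2).
Proof. by move=> z; exact: cvg_snd. Qed.

Lemma con_pair {T : topologicalType} (A : set T) (f g : T -> R) :
  con A f -> con A g -> con A (fun x => (f x, g x)).
Proof. by move=> cf cg x Ax; exact: (cvg_pair (cf x Ax) (cg x Ax)). Qed.

Lemma con_circle {T : topologicalType} (A : set T) (z0 : R * R) (f g : T -> R) :
  con A f -> con A g -> con A (fun x => circle z0 (f x) (g x)).
Proof.
move=> cf cg; apply: con_pair; apply: conD; try exact: con_cst;
apply: conM => //; apply: (@con_cont_comp _ _ _ _ g) => //;
by move=> x; first [exact: continuous_cos|exact: continuous_sin].
Qed.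

(** Polar coordinates unroll the annulus to a rectangle, on which an argument Phi of the map exists;
    a full turn adds a constant kappa to it. A loop that turns m times around z0 therefore picks up
    m kappa, with the same kappa for all loops. *)
Lemma winding_mult (fX fY : R * R -> R) (z0 : R * R) (r0 r T : R) :
  r0 <= r -> 0 <= T -> continuous fX -> continuous fY ->
  (forall s t, r0 <= s <= r -> (fX (circle z0 s t), fY (circle z0 s t)) <> (0, 0)) ->
  exists kappa : R, forall (rho tau th : R -> R) (m : int),
    con `[0, 2 * pi] rho -> con `[0, 2 * pi] tau -> con `[0, 2 * pi] th ->
    (forall t, 0 <= t <= 2 * pi -> [/\ r0 <= rho t <= r, - T <= tau t <= T &
       polar (fX (circle z0 (rho t) (tau t))) (fY (circle z0 (rho t) (tau t))) (th t)]) ->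
    rho (2 * pi) = rho 0 -> tau (2 * pi) = tau 0 + m%:~R * (2 * pi) ->
    th (2 * pi) - th 0 = m%:~R * kappa.
Proof.
move=> r0r T0 cfX cfY f0.
have p20 : 0 < 2 * pi :> R by rewrite mulr_gt0 // pi_gt0.
have t2 := @tpz_2pi R.
pose c (z : R * R) := circle z0 z.1 z.2.
have cc A : con A c by apply: con_circle; apply: con_continuous; [exact: fst_cont|exact: snd_cont].
have cf A (f : R * R -> R) : continuous f -> con A (f \o c).
  by move=> hf; apply: (@con_cont_comp _ _ _ _ c).
have TT : - T <= T by lra.
have [Phi [cPhi pPhi]] := polar_lift_star (@rectangle_compact r0 r (- T) T)
  (rectangle_star r0r TT) (cf _ _ cfX) (cf _ _ cfY) (fun z hz => f0 z.1 z.2 hz.1).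
have [kappa hk] : exists kappa, forall s t, r0 <= s <= r -> - T <= t -> t + 2 * pi <= T ->
    Phi (s, t + 2 * pi) = Phi (s, t) + kappa.
  (* If the rectangle is shorter than a full turn, no translate fits into it and the condition on
     kappa is vacuous. *)
  have [TT'|TT'] := leP (- T) (T - 2 * pi); last first.
    by exists 0 => s t _ h1 h2; exfalso; lra.
  pose sh (z : R * R) := (z.1, z.2 + 2 * pi).
  have shR z : rectangle r0 r (- T) (T - 2 * pi) z -> rectangle r0 r (- T) T (sh z).
    by case: z => x y [/= h /andP[h1 h2]]; split => //=; apply/andP; split; lra.
  have RR z : rectangle r0 r (- T) (T - 2 * pi) z -> rectangle r0 r (- T) T z.
    by case: z => x y [/= h /andP[h1 h2]]; split => //=; apply/andP; split; lra.
  have hst := rectangle_star r0r TT'.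
  exists (Phi (sh (r0, - T)) - Phi (r0, - T)) => s t rs t1 t3.
  have hin : rectangle r0 r (- T) (T - 2 * pi) (s, t).
    by split => //=; rewrite t1 /=; lra.
  suff : Phi (sh (s, t)) - Phi (s, t) = Phi (sh (r0, - T)) - Phi (r0, - T).
    rewrite /sh /=; lra.
  apply: (@tpz_star _ _ _ _ (fun z => Phi (sh z) - Phi z) hst) hin.
  - apply: conB; last exact: con_sub RR cPhi.
    apply: con_comp cPhi => //; apply: con_pair; first exact: con_continuous fst_cont.
    by apply: conD; [exact: con_continuous snd_cont|exact: con_cst].
  - move=> z hz; apply: (polar_tpz (f0 z.1 z.2 hz.1)); last exact: pPhi (RR z hz).
    by have := pPhi _ (shR z hz); rewrite /c /circle /=; have [-> ->] := trig_tpz t2 z.2.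
have iter (k : nat) s t : r0 <= s <= r -> - T <= t -> t + k%:R * (2 * pi) <= T ->
    Phi (s, t + k%:R * (2 * pi)) = Phi (s, t) + k%:R * kappa.
  move=> rs t1; elim: k => [|k IH] hk2; first by rewrite !mul0r !addr0.
  have e1 : t + k.+1%:R * (2 * pi) = t + k%:R * (2 * pi) + 2 * pi by rewrite -natr1; ring.
  rewrite e1 in hk2 *.
  have k0 : 0 <= k%:R * (2 * pi) :> R by rewrite mulr_ge0 // ltW.
  rewrite hk ?IH //; [by rewrite -natr1; ring|lra|lra].
exists kappa => rho tau th m crho ctau cth hpt rho2 tau2.
have h0 : 0 <= (0 : R) <= 2 * pi by rewrite lexx ltW.
have h2 : 0 <= (2 * pi : R) <= 2 * pi by rewrite lexx ltW.
have : Phi (rho (2 * pi), tau (2 * pi)) - th (2 * pi) = Phi (rho 0, tau 0) - th 0.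
  apply: (@tpz_segment _ (fun t => Phi (rho t, tau t) - th t)) => //; first exact: ltW.
    apply: conB => //; apply: (con_comp (A := rectangle r0 r (- T) T)) cPhi.
      exact: con_pair.
    by move=> t /=; rewrite in_itv /= => /hpt[].
  move=> t /hpt[h1 h3 h4]; apply: (polar_tpz _ _ h4); first exact: f0.
  by apply: (pPhi (rho t, tau t)).
rewrite rho2 => e.
have -> : th (2 * pi) - th 0 = Phi (rho 0, tau (2 * pi)) - Phi (rho 0, tau 0) by lra.
have [r00 t00 _] := hpt 0 h0; have [_ t22 _] := hpt _ h2.
case: m tau2 => k tau2.
  by rewrite tau2 iter //; [rewrite addrC addKr|case/andP: t00|rewrite -tau2; case/andP: t22].
have tau0 : tau 0 = tau (2 * pi) + k.+1%:R * (2 * pi).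
  by rewrite tau2 NegzE mulrNz mulNr subrK.
rewrite tau0 iter //; [|by case/andP: t22|by rewrite -tau0; case/andP: t00].
by rewrite NegzE mulrNz mulNr opprD addrA subrr sub0r.
Qed.

Context {n : nat}.
Implicit Types (x : 'rV[R]_n) (K : {set {set 'I_n}}).
Variable K : {set {set 'I_n}}.
Hypothesis cK : simplicial_complex K.
Hypothesis hK : homeomorphic (@realization R n K) (@unit_sphere R).

(** Since barycentric coordinates add up to 1, the second component is x_c minus the sum of the
    coordinates outside {a, b, c}: positive inside the page of c and negative inside the other pages
    on the edge ab. *)
Definition page (a b c : 'I_n) : 'rV[R]_n -> R * R :=
  fun x => (x ord0 a - x ord0 b, 2 * x ord0 c + x ord0 a + x ord0 b - 1).

(** At a zero with x_c > 0 some further coordinate v is nonzero, and a, b, c, v span a simplex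
    against [no_tetrahedron]. The only zero is thus the midpoint of ab. *)
Lemma page_zero a b c x : uniq [:: a; b; c] -> star_of K [set a; b]%SET x ->
  page a b c x = (0, 0) ->
  x = \row_v (if v \in [set a; b]%SET then 2^-1 else 0).
Proof.
move=> abc [[x0 x1] xK] [hab hc].
have [ab ac bc] : [/\ a != b, a != c & b != c].
  by move: abc; rewrite /= !inE !negb_or => /and3P[/andP[-> ->] -> _].
have sum3 (f : 'I_n -> R) : \sum_v f v = f a + f b + f c + \sum_(v | v \notin [set a; b; c]%SET) f v.
  rewrite (bigID (mem [set a; b; c]%SET)) /=; congr (_ + _).
  rewrite -!finset.setUA !big_setU1 /= ?big_set1 ?addrA // !inE ?negb_or ?ab ?ac ?bc //.
have h : x ord0 c = \sum_(v | v \notin [set a; b; c]%SET) x ord0 v.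
  by move: x1; rewrite sum3 => x1; lra.
have [c0|c0] := eqVneq (x ord0 c) 0.
  apply/rowP => v; rewrite mxE; case: ifP => [|/negbT vab].
    by rewrite !inE => /orP[] /eqP ->; rewrite c0 in hc; lra.
  have [->//|vc] := eqVneq v c.
  have /psumr_eq0P hs : forall v, v \notin [set a; b; c]%SET -> 0 <= x ord0 v by [].
  by apply: hs; rewrite -?h // inE negb_or vab inE vc.
suff : x ord0 c = 0 by move/eqP; rewrite (negPf c0).
rewrite h; apply: big1 => v; rewrite !inE !negb_or -andbA => /and3P[va vb vc].
apply/eqP; apply: contraT => xv.
have /(no_tetrahedron cK hK)/negP[] : uniq [:: a; b; c; v].
  by rewrite /= !inE !negb_or ab ac bc !(eq_sym _ v) va vb vc.
apply: (simplex_face cK xK); last by apply/finset.set0Pn; exists a; rewrite !inE eqxx.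
apply/fintype.subsetP => w; rewrite !inE -!orbA => /or4P[] /eqP ->;
by rewrite ?eqxx ?c0 ?xv ?orbT.
Qed.

Section Loop.
Variables (a b c c' : 'I_n) (eta : R).
Hypotheses (uabc : uniq [:: a; b; c; c']) (eta0 : 0 < eta) (eta1 : eta <= 4^-1).
Hypotheses (Kc : [set a; b; c]%SET \in K) (Kc' : [set a; b; c']%SET \in K).

Lemma max0E (Y : R) : Num.max Y 0 = (Y + `|Y|) / 2.
Proof. by rewrite maxr_absE subr0 addr0. Qed.

(** A loop around the midpoint of ab, in the page of c while sin t >= 0 and in the page of c'
    otherwise, shaped so that [page a b c] maps it to a circle of radius eta. The bound eta <= 1/4
    keeps the coordinates of a and b positive. *)
Definition page_loop (t : R) : 'rV[R]_n := \row_v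
  let X := eta * cos t in let Y := eta * sin t in
  if v == a then 2^-1 * (1 + X - `|Y|) else if v == b then 2^-1 * (1 - X - `|Y|)
  else if v == c then Num.max Y 0 else if v == c' then Num.max (- Y) 0 else 0.

Let ab : a != b. Proof. by move: uabc; rewrite /= !inE !negb_or => /andP[/and3P[]]. Qed.
Let ac : a != c. Proof. by move: uabc; rewrite /= !inE !negb_or => /andP[/and3P[]]. Qed.
Let ac' : a != c'. Proof. by move: uabc; rewrite /= !inE !negb_or => /andP[/and3P[]]. Qed.
Let bc : b != c. Proof. by move: uabc; rewrite /= !inE !negb_or => /and4P[_ /andP[]]. Qed.
Let bc' : b != c'. Proof. by move: uabc; rewrite /= !inE !negb_or => /and4P[_ /andP[]]. Qed.
Let cc' : c != c'. Proof. by move: uabc; rewrite /= !inE !negb_or => /and4P[_ _ ->]. Qed.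

Lemma page_loopE t (X := eta * cos t) (Y := eta * sin t) (x := page_loop t) :
  [/\ x ord0 a = 2^-1 * (1 + X - `|Y|), x ord0 b = 2^-1 * (1 - X - `|Y|),
     x ord0 c = Num.max Y 0, x ord0 c' = Num.max (- Y) 0 &
     forall v, v \notin [set a; b; c; c']%SET -> x ord0 v = 0].
Proof.
rewrite /x !mxE !eqxx (eq_sym b a) (eq_sym c a) (eq_sym c b) (eq_sym c' a) (eq_sym c' b) (eq_sym c' c).
rewrite (negPf ab) (negPf ac) (negPf bc) (negPf ac') (negPf bc') (negPf cc'); split => // v.
by rewrite !inE !negb_or !mxE -!andbA => /and4P[/negPf-> /negPf-> /negPf-> /negPf->].
Qed.

Lemma loop_bound t : `|eta * cos t| <= 4^-1 /\ `|eta * sin t| <= 4^-1.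
Proof.
rewrite !normrM (gtr0_norm eta0); split; rewrite (le_trans _ eta1) // ler_piMr ?(ltW eta0) //;
by rewrite ler_norml ?cos_geN1 ?cos_le1 ?sin_geN1 ?sin_le1.
Qed.

Lemma page_loop_in t : realization K (page_loop t) /\
  0 < page_loop t ord0 a /\ 0 < page_loop t ord0 b.
Proof.
have [xa xb xc xc' xo] := page_loopE t; have [hX hY] := loop_bound t.
move: hX hY xa xb xc xc'; set X := eta * cos t; set Y := eta * sin t => hX hY xa xb xc xc'.
have hX2 := ler_norm X; have hX3 := ler_norm (- X); rewrite normrN in hX3.
have q4 : 4^-1 <= 1 / 4 :> R by rewrite mul1r.
have pa : 0 < page_loop t ord0 a by rewrite xa mulr_gt0 ?invr_gt0 //; lra.
have pb : 0 < page_loop t ord0 b by rewrite xb mulr_gt0 ?invr_gt0 //; lra.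
split => //; apply/realizationE; split; first split=> [v|].
- have [] := boolP (v \in [set a; b; c; c']%SET); last by move=> /xo ->.
  rewrite !inE -!orbA => /or4P[] /eqP ->; rewrite ?(ltW pa) ?(ltW pb) // ?xc ?xc' le_max lexx orbT //.
- rewrite (bigID (mem [set a; b; c; c']%SET)) /= [X in _ + X]big1 ?addr0 //.
  rewrite -!finset.setUA !big_setU1 /= ?big_set1 ?addrA // ?inE ?negb_or ?ab ?ac ?ac' ?bc ?bc' ?cc' //.
  rewrite xa xb xc xc'.
  by rewrite !max0E normrN; field.
- have ex : (carrier (page_loop t) != finset.set0).
    by apply/finset.set0Pn; exists a; rewrite mem_carrier gt_eqF.
  have [Y0|Y0] := leP 0 Y.
    apply: (simplex_face cK Kc) => //; apply/fintype.subsetP => v; rewrite mem_carrier.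
    apply: contraR => h; have [->|vc'] := eqVneq v c'; first by rewrite xc' (max_idPr _) //; lra.
    by rewrite xo // inE negb_or h inE vc'.
  apply: (simplex_face cK Kc') => //; apply/fintype.subsetP => v; rewrite mem_carrier.
  apply: contraR => h; have [->|vc] := eqVneq v c; first by rewrite xc (max_idPr _) //; lra.
  by rewrite xo //; move: h; rewrite !inE !negb_or vc -!andbA => /and3P[-> -> ->].
Qed.

Lemma page_loop_near t v :
  `|page_loop t ord0 v - (if v \in [set a; b]%SET then 2^-1 else 0)| <= eta.
Proof.
have [xa xb xc xc' xo] := page_loopE t.
have e0 := ltW eta0.
have hX : `|eta * cos t| <= eta.
  by rewrite normrM (gtr0_norm eta0) ler_piMr // ler_norml cos_geN1 cos_le1.
have hY : `|eta * sin t| <= eta.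
  by rewrite normrM (gtr0_norm eta0) ler_piMr // ler_norml sin_geN1 sin_le1.
move: xa xb xc xc' hX hY; rewrite !max0E normrN.
set X := eta * cos t; set Y := eta * sin t => xa xb xc xc' hX hY.
move: (hX) (hY); rewrite !ler_norml => /andP[X1 X2] /andP[Y1 Y2].
have Y0 := normr_ge0 Y; have Y3 := ler_norm Y.
have Y4 := ler_norm (- Y); rewrite normrN in Y4.
have inv2 : 2^-1 * 2 = 1 :> R by rewrite mulVf.
have [->|va] := eqVneq v a; first by rewrite !inE eqxx xa /=; apply/andP; split; lra.
have [->|vb] := eqVneq v b; first by rewrite xb !inE eqxx orbT /=; apply/andP; split; lra.
rewrite !inE (negPf va) (negPf vb) /= subr0.
have [->|vc] := eqVneq v c; first by rewrite xc; apply/andP; split; lra.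
have [->|vc'] := eqVneq v c'; first by rewrite xc'; apply/andP; split; lra.
by rewrite xo ?oppr_le0 ?e0 //= !inE !negb_or va vb vc vc'.
Qed.

Lemma page_of_loop t : page a b c (page_loop t) = (eta * cos t, eta * sin t).
Proof.
have [xa xb xc _ _] := page_loopE t.
by rewrite /page xa xb xc !max0E; congr pair; field.
Qed.

(** Seen from a page that the loop does not enter, it runs along the lower semicircle and back, with
    winding number 0. *)
Lemma page_of_loop_other t d : d \notin [set a; b; c; c']%SET ->
  page a b d (page_loop t) = (eta * cos t, - `|eta * sin t|).
Proof.
move=> dn; have [xa xb _ _ xo] := page_loopE t.
by rewrite /page xa xb (xo d dn); congr pair; field.
Qed.

Lemma page_loop_continuous : continuous page_loop.
Proof.
apply: con_setT; apply: con_row => v.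
have cX : con setT (fun t => eta * cos t).
  by apply: conM; [exact: con_cst|apply: con_continuous; exact: continuous_cos].
have cY : con setT (fun t => eta * sin t).
  by apply: conM; [exact: con_cst|apply: con_continuous; exact: continuous_sin].
have cN : con setT (fun t => `|eta * sin t|).
  by apply: (@con_cont_comp _ _ _ _ (fun t => eta * sin t) Num.norm) => // y; exact: norm_continuous.
have cmax (f : R -> R) : con setT f -> con setT (fun t => Num.max (f t) 0).
  move=> cf; apply: con_continuous => t.
  apply: (@continuous_max _ _ f (fun=> 0)); last exact: cvg_cst.
  by move: t; exact: con_setT.
apply: (con_ext (f := fun t : R => if v == a then 2^-1 * (1 + eta * cos t - `|eta * sin t|)
  else if v == b then 2^-1 * (1 - eta * cos t - `|eta * sin t|)
  else if v == c then Num.max (eta * sin t) 0 else if v == c' then Num.max (- (eta * sin t)) 0 else 0)).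
  by move=> t _; rewrite mxE.
case: eqP => _; last case: eqP => _; last case: eqP => _; last case: eqP => _.
- by apply: conM; [exact: con_cst|apply: conB => //; apply: conD => //; exact: con_cst].
- by apply: conM; [exact: con_cst|apply: conB => //; apply: conB => //; exact: con_cst].
- exact: cmax.
- by apply: cmax; exact: conN.
- exact: con_cst.
Qed.

Lemma page_loop_2pi : page_loop (2 * pi) = page_loop 0.
Proof.
have t2 := @tpz_2pi R.
by apply/rowP => v; rewrite !mxE -[2 * pi]add0r; have [-> ->] := trig_tpz t2 0.
Qed.

End Loop.

(** Here m is the winding number of the loop around the origin; r0 and T confine its polar
    coordinates to a rectangle as in [winding_mult]. *)
Lemma loop_coordinates (dx dy : R -> R) (r : R) :
  con `[0, 2 * pi] dx -> con `[0, 2 * pi] dy ->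
  (forall t, 0 <= t <= 2 * pi -> (dx t, dy t) <> (0, 0)) ->
  (forall t, 0 <= t <= 2 * pi -> `|dx t| <= r / 2 /\ `|dy t| <= r / 2) -> 0 < r ->
  dx (2 * pi) = dx 0 -> dy (2 * pi) = dy 0 ->
  exists (rho tau : R -> R) (m : int) (r0 T : R), [/\ con `[0, 2 * pi] rho, con `[0, 2 * pi] tau,
    0 < r0 /\ 0 <= T,
    rho (2 * pi) = rho 0 /\ tau (2 * pi) = tau 0 + m%:~R * (2 * pi) &
    forall t, 0 <= t <= 2 * pi -> [/\ r0 <= rho t <= r, - T <= tau t <= T,
      dx t = rho t * cos (tau t) & dy t = rho t * sin (tau t)]].
Proof.
move=> cdx cdy d0 dr r_gt0 dx2 dy2.
have p20 : 0 <= 2 * pi :> R by rewrite mulr_ge0 // pi_ge0.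
have in0 : 0 <= (0 : R) <= 2 * pi by rewrite lexx.
have in2 : 0 <= (2 * pi : R) <= 2 * pi by rewrite lexx p20.
pose rho t := Num.sqrt (dx t ^+ 2 + dy t ^+ 2).
have crho : con `[0, 2 * pi] rho.
  apply: (@con_cont_comp _ _ _ _ (fun t => dx t ^+ 2 + dy t ^+ 2) Num.sqrt); last exact: sqrt_continuous.
  by apply: conD; [have := conM cdx cdx|have := conM cdy cdy]; apply: con_ext => t _; rewrite expr2.
have cseg : compact (`[0, 2 * pi]%classic : set R) by exact: segment_compact.
have hst : star (T := R^o) (`[0, 2 * pi]%classic : set R) 0.
  apply: star_convex; first by rewrite /= in_itv.
  move=> x y t; rewrite /= !in_itv /= => /andP[h1 h2] /andP[h3 h4] /andP[h5 h6].
  by rewrite /GRing.scale /=; apply/andP; split; nra.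
have d0' t : (`[0, 2 * pi]%classic : set R) t -> (dx t, dy t) <> (0, 0).
  by rewrite /= in_itv; exact: d0.
have [tau [ctau ptau]] := @polar_lift_star R R _ 0 dx dy cseg hst cdx cdy d0'.
have ptau' t : 0 <= t <= 2 * pi -> polar (dx t) (dy t) (tau t).
  by move=> ht; apply: ptau; rewrite /= in_itv.
have [m tau2] : tpz (tau (2 * pi) - tau 0).
  apply: (polar_tpz (d0 0 in0)); last exact: ptau'.
  by rewrite -dx2 -dy2; exact: ptau'.
have [tm htm rmin] := EVT_min p20 ((con_subspace _ _).1 crho).
have cabs : con `[0, 2 * pi] (fun t => `|tau t|).
  by apply: (@con_cont_comp _ _ _ _ tau Num.norm) => // y; exact: norm_continuous.
have [tM htM tmax] := EVT_max p20 ((con_subspace _ _).1 cabs).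
exists rho, tau, m, (rho tm), `|tau tM|; split => //.
- by split => //; apply: sqrt_gt0; apply: d0; move: htm; rewrite in_itv.
- by split; [rewrite /rho dx2 dy2|rewrite -tau2 addrC subrK].
- move=> t ht; have ht' : t \in `[0, 2 * pi]%R by rewrite in_itv.
  have [hx hy] := ptau' t ht; split => //.
  + rewrite rmin //=; have [h1 h2] := dr t ht.
    have sq (z : R) : `|z| <= r / 2 -> z ^+ 2 <= (r / 2) ^+ 2.
      by move=> hz; rewrite -real_normK ?num_real // lerXn2r // nnegrE // divr_ge0 // ltW.
    have -> : r = Num.sqrt (r ^+ 2) by rewrite sqrtr_sqr gtr0_norm.
    rewrite ler_sqrt ?sqr_ge0 //; have := sq _ h1; have := sq _ h2.
    by have := sqr_ge0 r; rewrite expr_div_n; lra.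
  + by rewrite -ler_norml; exact: tmax.
Qed.

Lemma sin_le0 (t : R) : pi <= t <= 2 * pi -> sin t <= 0.
Proof.
move=> /andP[h1 h2]; rewrite -[t](subrK pi) sinDpi oppr_le0 sin_ge0_pi //.
by apply/andP; split; lra.
Qed.

(** Let k1, k2 be the constants of [winding_mult] for the maps of pages 1 and 2. The loop through
    pages 1 and 3 gives m k1 = 2 pi, the loop through pages 2 and 3 gives m' k2 = 2 pi, so k1 and m'
    are nonzero. Yet the second loop has winding number 0 seen from page 1, that is m' k1 = 0. *)
Lemma no_book (a b c1 c2 c3 : 'I_n) : uniq [:: a; b; c1; c2; c3] ->
  [set a; b; c1]%SET \in K -> [set a; b; c2]%SET \in K -> [set a; b; c3]%SET \in K -> False.
Proof.
move=> u K1 K2 K3.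
move: (u); rewrite /= !inE !negb_or.
move=> /and5P[/and4P[ab ac1 ac2 ac3] /and3P[bc1 bc2 bc3] /andP[c12 c13] c23 _].
have u13 : uniq [:: a; b; c1; c3] by rewrite /= !inE !negb_or ab ac1 ac3 bc1 bc3 c13.
have u23 : uniq [:: a; b; c2; c3] by rewrite /= !inE !negb_or ab ac2 ac3 bc2 bc3 c23.
have u1 : uniq [:: a; b; c1] by rewrite /= !inE !negb_or ab ac1 bc1.
have u2 : uniq [:: a; b; c2] by rewrite /= !inE !negb_or ab ac2 bc2.
have d23 : c1 \notin [set a; b; c2; c3]%SET.
  by rewrite !inE !negb_or (eq_sym c1 a) (eq_sym c1 b) ac1 bc1 c12 c13.
have p20 : 0 < 2 * pi :> R by rewrite mulr_gt0 // pi_gt0.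
have t2 := @tpz_2pi R.
pose p : 'rV[R]_n := \row_v (if v \in [set a; b]%SET then 2^-1 else 0).
have pa : p ord0 a = 2^-1 by rewrite mxE !inE eqxx.
have pb : p ord0 b = 2^-1 by rewrite mxE !inE eqxx orbT.
have sum2 (f : 'I_n -> R) : \sum_v f v = f a + f b + \sum_(v | v \notin [set a; b]%SET) f v.
  rewrite (bigID (mem [set a; b]%SET)) /=; congr (_ + _).
  by rewrite !big_setU1 /= ?big_set1 // !inE.
have bp : barycentric p.
  split=> [v|]; first by rewrite mxE; case: ifP => //; rewrite invr_ge0.
  rewrite sum2 pa pb big1 ?addr0; first by field.
  by move=> v /negbTE vt; rewrite mxE vt.
have carp : carrier p = [set a; b]%SET.
  apply/setP => v; rewrite mem_carrier mxE; case: ifP => _; last by rewrite eqxx.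
  by rewrite invr_eq0 pnatr_eq0.
have abK : [set a; b]%SET \in K.
  apply: (simplex_face cK K1); first by apply/fintype.subsetP => v; rewrite !inE => ->.
  by apply/finset.set0Pn; exists a; rewrite !inE eqxx.
have Xp : realization K p by apply/realizationE; rewrite carp.
pose p' : 'rV[R]_n := vertex_point R a.
have pp' x : 0 < x ord0 b -> x <> p'.
  by move=> xb xp; move: xb; rewrite xp vertexE eq_sym (negPf ab) ltxx.
have [zx [zy [kap [[czx czy] ck kX zk kz]]]] := plane_chart hK (vertex_realization cK a).
pose z0 := (zx p, zy p).
have Xp' : (realization K `\ p') p by split => //; apply: pp'; rewrite pb invr_gt0.
have kz0 : kap z0 = p by exact: kz.
(* As p has coordinates 1/2 at a and b, points within 1/2 of it keep both nonzero, which places the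
   disc in the star of ab. *)
have e0 : 0 < 2^-1 :> R by rewrite invr_gt0.
have [r [r_gt0 hr]] := small_disc z0 ck e0.
have kap_star s t : 0 <= s <= r -> star_of K [set a; b]%SET (kap (circle z0 s t)).
  move=> /andP[s0 sr]; have [h1 h2] := circle_near z0 t s0.
  have {}hr := hr _ (le_trans h1 sr) (le_trans h2 sr).
  have [bk Kk] := (realizationE _ _).1 (kX (circle z0 s t)).1.
  split => //; rewrite (finset.setUidPl _) //; apply/fintype.subsetP => v vab.
  have := hr v; rewrite kz0 mxE vab mem_carrier; apply: contraTneq => ->.
  by rewrite sub0r normrN ger0_norm ?ltxx // invr_ge0.
pose fX c z := (page a b c (kap z)).1.
pose fY c z := (page a b c (kap z)).2.
have ckv v : continuous (fun z => kap z ord0 v).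
  by move=> z; apply: (@continuous_comp _ _ _ kap (fun x : 'rV[R]_n => x ord0 v)); [exact: ck|exact: coord_cont].
have ckc v : con setT (fun z => kap z ord0 v) by exact: con_continuous.
have cfX c : continuous (fX c) by apply: con_setT; apply: conB.
have cfY c : continuous (fY c).
  apply: con_setT; apply: conB; last exact: con_cst.
  by apply: conD => //; apply: conD => //; apply: conM => //; exact: con_cst.
have f0 c s t : uniq [:: a; b; c] -> 0 < s <= r -> (fX c (circle z0 s t), fY c (circle z0 s t)) <> (0, 0).
  move=> uc /andP[s0 sr] h.
  have /(page_zero uc (kap_star s t _)) kp : page a b c (kap (circle z0 s t)) = (0, 0).
    by rewrite -h /fX /fY; case: page.
  have := zk (circle z0 s t); rewrite kp ?(ltW s0) // -/p -/z0.
  move=> /(congr1 (fun z => (z.1 - z0.1) ^+ 2 + (z.2 - z0.2) ^+ 2)).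
  rewrite /circle /= !subrr expr0n addr0 ![_ + _ * _ - _]addrAC !subrr !add0r.
  rewrite !exprMn -mulrDr cos2Dsin2 mulr1 => /esym/eqP.
  by rewrite sqrf_eq0 gt_eqF.
have [eta [eta0 eta1 near_p]] : exists eta : R, [/\ 0 < eta, eta <= 4^-1 & forall x,
    (realization K `\ p') x -> (forall v, `|x ord0 v - p ord0 v| <= eta) ->
    `|zx x - z0.1| <= r / 2 /\ `|zy x - z0.2| <= r / 2].
  have r2 : 0 < r / 2 by rewrite divr_gt0.
  have : \forall x \near p, (realization K `\ p') x -> `|zx p - zx x| < r / 2 /\ `|zy p - zy x| < r / 2.
    have h1 := con_distP czx Xp' r2; have h2 := con_distP czy Xp' r2.
    by apply: filterS2 h1 h2 => x k1 k2 Xx; split; [exact: k1|exact: k2].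
  move=> /nbhs_ballP[d /= d0 hd].
  exists (Num.min (d / 2) 4^-1); split.
  - by rewrite lt_min divr_gt0 // invr_gt0 ltr0n.
  - by rewrite ge_min lexx orbT.
  - move=> x Xx xp; have [|//|h1 h2] := hd x.
      split => // i j; rewrite ord1 /ball /= distrC (le_lt_trans (xp j)) //.
      by rewrite gt_min ltr_pdivrMr // ltr_pMr // ltr1n.
    by rewrite distrC (ltW h1) distrC (ltW h2).
have loop_data c c' : uniq [:: a; b; c; c'] -> [set a; b; c]%SET \in K -> [set a; b; c']%SET \in K ->
  exists (rho tau : R -> R) (m : int) (r0 T : R), [/\ con `[0, 2 * pi] rho, con `[0, 2 * pi] tau,
    0 < r0 /\ 0 <= T,
    rho (2 * pi) = rho 0 /\ tau (2 * pi) = tau 0 + m%:~R * (2 * pi) &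
    forall t, 0 <= t <= 2 * pi -> [/\ r0 <= rho t <= r, - T <= tau t <= T &
      kap (circle z0 (rho t) (tau t)) = page_loop a b c c' eta t]].
  move=> uc Kc Kc'; pose g := page_loop a b c c' eta.
  have gX t : (realization K `\ p') (g t).
    have [h1 [h2 h3]] := page_loop_in uc eta0 eta1 Kc Kc' t.
    by split => //; exact: pp'.
  have gp t : g t <> p.
    move=> gp; have := page_of_loop eta uc t; rewrite -/(g t) gp /page pa pb => -[hX hY].
    have cn : p ord0 c = 0.
      rewrite mxE ifF // !inE; move: uc; rewrite /= !inE !negb_or !(eq_sym c) => /andP[/and3P[_ /negPf -> _] /and3P[/andP[/negPf -> _] _ _]].
      by [].
    move: hX hY; rewrite cn subrr mulr0 add0r.
    have -> : 2^-1 + 2^-1 - 1 = 0 :> R by field.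
    move=> /esym/eqP; rewrite mulf_eq0 (gt_eqF eta0) /= => /eqP c0 /esym/eqP.
    rewrite mulf_eq0 (gt_eqF eta0) /= => /eqP s0.
    by have := cos2Dsin2 t; rewrite c0 s0 expr0n addr0 => /esym/eqP; rewrite oner_eq0.
  have cg : continuous g by exact: page_loop_continuous.
  have gnear t v : `|g t ord0 v - p ord0 v| <= eta.
    by rewrite [p ord0 v]mxE; exact: page_loop_near.
  have cdz (zz : 'rV[R]_n -> R) k : con (realization K `\ p') zz -> con `[0, 2 * pi] (fun t => zz (g t) - k).
    move=> cz; apply: conB; last exact: con_cst.
    by apply: con_comp cz => //; exact: con_continuous.
  have [|||||||rho [tau [m [r0 [T [h1 h2 h3 h4 h5]]]]]] :=
    @loop_coordinates (fun t => zx (g t) - z0.1) (fun t => zy (g t) - z0.2) r.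
  - exact: cdz.
  - exact: cdz.
  - move=> t _ [/eqP + /eqP]; rewrite !subr_eq0 => /eqP hx /eqP hy.
    by apply: (gp t); rewrite -(kz (g t) (gX t)) hx hy -/z0 -kz0.
  - by move=> t _; apply: near_p.
  - exact: r_gt0.
  - by rewrite /g page_loop_2pi.
  - by rewrite /g page_loop_2pi.
  exists rho, tau, m, r0, T; split => // t ht.
  have [k1 k2 k3 k4] := h5 t ht; split => //.
  rewrite -/(g t) -(kz (g t) (gX t)); congr kap.
  by rewrite /circle -k3 -k4; congr pair; rewrite addrC subrK.
have [rho [tau [m [r0 [T [cr ct [r0_gt0 T0] [rp tp] h]]]]]] := loop_data c1 c3 u13 K1 K3.
have [rho' [tau' [m' [r0' [T' [cr' ct' [r0'_gt0 T0'] [rp' tp'] h']]]]]] := loop_data c2 c3 u23 K2 K3.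
(* Bounds common to both loops, so that a single constant for page 1 applies to each of them. *)
pose q0 := Num.min (Num.min r0 r0') r; pose TT := Num.max T T'.
have q0_gt0 : 0 < q0 by rewrite !lt_min r0_gt0 r0'_gt0.
have q0r : q0 <= r by rewrite ge_min lexx orbT.
have TT0 : 0 <= TT by rewrite le_max T0.
have ff c (uc : uniq [:: a; b; c]) s t : q0 <= s <= r -> (fX c (circle z0 s t), fY c (circle z0 s t)) <> (0, 0).
  by move=> /andP[h1 h2]; apply: f0; rewrite // h2 (lt_le_trans q0_gt0 h1).
have [k1 hk1] := winding_mult q0r TT0 (cfX c1) (cfY c1) (ff c1 u1).
have [k2 hk2] := winding_mult q0r TT0 (cfX c2) (cfY c2) (ff c2 u2).
have bnd t : 0 <= t <= 2 * pi -> q0 <= rho t <= r /\ - TT <= tau t <= TT.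
  move=> /h[/andP[h1 h2] /andP[h3 h4] _]; split; apply/andP; split => //.
  - by rewrite (le_trans _ h1) // !ge_min lexx.
  - by rewrite (le_trans _ h3) // lerN2 le_max lexx.
  - by rewrite (le_trans h4) // le_max lexx.
have bnd' t : 0 <= t <= 2 * pi -> q0 <= rho' t <= r /\ - TT <= tau' t <= TT.
  move=> /h'[/andP[h1 h2] /andP[h3 h4] _]; split; apply/andP; split => //.
  - by rewrite (le_trans _ h1) // !ge_min lexx orbT.
  - by rewrite (le_trans _ h3) // lerN2 le_max lexx orbT.
  - by rewrite (le_trans h4) // le_max lexx orbT.
have cid : con `[0, 2 * pi] (id : R -> R) by apply: con_continuous => t; exact: cvg_id.
have e1 : 2 * pi - 0 = m%:~R * k1.
  apply: (hk1 rho tau id) => // t ht; have [b1 b2] := bnd t ht; split => //.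
  have [_ _ hkap] := h t ht; rewrite /fX /fY hkap page_of_loop //.
  exact: polar_scale eta0 _ _.
have e2 : 2 * pi - 0 = m'%:~R * k2.
  apply: (hk2 rho' tau' id) => // t ht; have [b1 b2] := bnd' t ht; split => //.
  have [_ _ hkap] := h' t ht; rewrite /fX /fY hkap page_of_loop //.
  exact: polar_scale eta0 _ _.
(* On the loop through the pages of c2 and c3, the map given by the page of c1 stays in a
   half-plane, with angle |t - pi| - pi. *)
have e3 : (`|2 * pi - pi| - pi) - (`|0 - pi| - pi) = m'%:~R * k1 :> R.
  apply: (hk1 rho' tau' (fun t => `|t - pi| - pi)) => //.
    apply: conB; last exact: con_cst.
    apply: (@con_cont_comp _ _ _ _ (fun t : R => t - pi) Num.norm); last by move=> y; exact: norm_continuous.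
    by apply: conB => //; exact: con_cst.
  move=> t ht; have [b1 b2] := bnd' t ht; split => //.
  have [_ _ hkap] := h' t ht; rewrite /fX /fY hkap page_of_loop_other //=.
  move: ht => /andP[t0 tpi].
  apply: (polar_scale eta0); have [tp1|tp1] := leP t pi.
  - by rewrite ler0_norm ?subr_le0 // opprB addrAC subrr add0r cosN.
  - by rewrite gtr0_norm ?subr_gt0 // -addrA -opprD -mulr2n -mulr_natl -(trig_tpz t2 (t - 2 * pi)).1 subrK.
  - rewrite [`|t - pi|]ler0_norm ?subr_le0 // opprB addrAC subrr add0r sinN ger0_norm ?mulrN //.
    by rewrite mulr_ge0 ?(ltW eta0) // sin_ge0_pi // t0.
  - rewrite [`|t - pi|]gtr0_norm ?subr_gt0 // -addrA -opprD -mulr2n -mulr_natl.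
    rewrite -(trig_tpz t2 (t - 2 * pi)).2 subrK.
    rewrite ler0_norm ?opprK //; rewrite pmulr_rle0 //.
    by apply: sin_le0; rewrite ltW.
have : m'%:~R * k1 = 0 :> R.
  rewrite -e3 sub0r normrN; have -> : 2 * pi - pi = pi :> R by ring.
  by rewrite subrr.
move=> /eqP; rewrite mulf_eq0 => /orP[] /eqP z.
  by move: e2 => /eqP; rewrite z mul0r subr0 gt_eqF.
by move: e1 => /eqP; rewrite z mulr0 subr0 gt_eqF.
Qed.

End Book.

(** * Counting edges *)

(** A rational solution is multiplied by the product of its denominators. Integrality matters
    because the coefficients will multiply angles known modulo 2 pi. *)
Lemma int_kernel (I J : finType) (M : I -> J -> int) : (#|J| < #|I|)%N ->
  exists c : I -> int, (exists i, c i != 0)%R /\ forall j, (\sum_i c i * M i j = 0)%R.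
Proof.
move=> JI; have [c [[i0 ci0] c0]] := @wide_kernel rat I J (fun i j => (M i j)%:~R%R) JI.
pose z i := (numq (c i) * \prod_(j | j != i) denq (c j))%R.
pose D := (\prod_j denq (c j))%R.
have zE i : ((z i)%:~R = c i * D%:~R :> rat)%R.
  have -> : D = (denq (c i) * \prod_(j | j != i) denq (c j))%R by rewrite /D (bigD1 i).
  rewrite /z !intrM mulrA; congr (_ * _)%R.
  by rewrite -{2}(divq_num_den (c i)) divfK // intr_eq0 denq_neq0.
have D0 : (D%:~R != 0 :> rat)%R.
  by rewrite intr_eq0; apply/prodf_neq0 => j _; exact: denq_neq0.
exists z; split.
  by exists i0; rewrite -(intr_eq0 rat) zE mulf_neq0.
move=> j; apply/eqP; rewrite -(intr_eq0 rat); apply/eqP.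
rewrite rmorph_sum /= (eq_bigr (fun i => D%:~R * (c i * (M i j)%:~R))%R); last first.
  by move=> i _; rewrite intrM zE; ring.
by rewrite -mulr_sumr c0 mulr0.
Qed.

(** * Connectedness of the plane minus finitely many points *)

Section PlaneMinusFinite.
Context {R : realType}.
Local Open Scope ring_scope.
Local Open Scope classical_set_scope.

Lemma avoid_finite (s : seq R) (a b : R) : a < b -> exists2 x, a < x < b & x \notin s.
Proof.
elim: s b => [|y s IH] b ab; first by exists ((a + b) / 2) => //; apply/andP; split; lra.
have [x /andP[ax xb] xs] := IH b ab.
have [xy|xy] := eqVneq x y; last first.
  by exists x; rewrite ?ax //= inE negb_or xy.
have [x' /andP[ax' x'x] xs'] := IH x ax.
by exists x'; rewrite ?ax' ?(lt_trans x'x xb) //= inE negb_or xs' -xy lt_eqF.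
Qed.

Lemma locally_constant_line (T : eqType) (f : R -> T) :
  (forall t, \forall t' \near t, f t' = f t) -> forall a b, f a = f b.
Proof.
move=> lf.
suff H a b : a <= b -> f a = f b.
  by move=> a b; have [/H //|/ltW/H ->] := leP a b.
(* Local constancy is recast as continuity of a function with values 0 and 2 pi, to which
   [tpz_segment] applies. *)
move=> ab; pose g t : R := if f t == f a then 0 else 2 * pi.
have : g b = g a.
  apply: tpz_segment ab _ _.
    apply: con_continuous => t; apply: cvg_near_cst; have := lf t.
    by apply: filterS => t' ft; rewrite /g ft.
  move=> t _; rewrite /g; case: eqP => _; first exact: tpz0.
  by exists 1; rewrite mul1r.
rewrite /g eqxx; case: eqP => [->//|_] /eqP.
by rewrite mulf_eq0 pnatr_eq0 /= gt_eqF // pi_gt0.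
Qed.

Lemma plane_minus_finite (T : eqType) (Z : seq (R * R)) (f : R * R -> T) :
  (forall w, w \notin Z -> \forall w' \near w, f w' = f w) ->
  forall w w', w \notin Z -> w' \notin Z -> f w = f w'.
Proof.
move=> lf.
have vert x y y' : x \notin [seq z.1 | z <- Z] -> f (x, y) = f (x, y').
  move=> xZ; apply: (@locally_constant_line _ (fun t => f (x, t))) => t.
  have /lf : (x, t) \notin Z by apply: contra xZ => h; apply/mapP; exists (x, t).
  move=> /nbhs_ballP[d /= d0 hd].
  apply/nbhs_ballP; exists d => // t' tt'; apply: hd; split => //=; exact: ballxx.
have hori x x' y : y \notin [seq z.2 | z <- Z] -> f (x, y) = f (x', y).
  move=> yZ; apply: (@locally_constant_line _ (fun t => f (t, y))) => t.
  have /lf : (t, y) \notin Z by apply: contra yZ => h; apply/mapP; exists (t, y).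
  move=> /nbhs_ballP[d /= d0 hd].
  apply/nbhs_ballP; exists d => // t' tt'; apply: hd; split => //=; exact: ballxx.
have shift w : w \notin Z -> exists2 x, x \notin [seq z.1 | z <- Z] & f w = f (x, w.2).
  move=> /lf/nbhs_ballP[d /= d0 hd].
  have wd : w.1 < w.1 + d by rewrite ltrDl.
  have [x /andP[x1 x2] xZ] := avoid_finite [seq z.1 | z <- Z] wd.
  exists x => //; apply/esym/hd; split => /=; last exact: ballxx.
  by rewrite /ball /= ltr0_norm; lra.
have [y0 _ yZ] := avoid_finite [seq z.2 | z <- Z] (ltr01 : 0 < 1 :> R).
move=> w w' /shift[x xZ ->] /shift[x' xZ' ->].
by rewrite (vert _ _ y0 xZ) (vert _ _ y0 xZ'); exact: hori.
Qed.

End PlaneMinusFinite.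

(** * Edges and triangles with their vertices cut off *)

Section Counting.
Context {R : realType} {n : nat}.
Local Open Scope ring_scope.
Local Open Scope classical_set_scope.
Variable K : {set {set 'I_n}}.
Hypothesis cK : simplicial_complex K.
Hypothesis hK : homeomorphic (@realization R n K) (@unit_sphere R).

Lemma simplex_card_le3 (s : {set 'I_n}) : s \in K -> (#|s| <= 3)%N.
Proof.
move=> sK; rewrite leqNgt; apply/negP => s4.
have : (4 <= size (enum s))%N by rewrite -cardE.
have : uniq (enum s) by exact: enum_uniq.
have : {subset enum s <= s} by move=> v; rewrite mem_enum.
case: (enum s) => [|a [|b [|c [|d l]]]] //= sub.
rewrite !inE !negb_or => /and5P[/and4P[ab ac ad _] /and3P[bc bd _] /andP[cd _] _ _] _.
have /(no_tetrahedron cK hK)/negP[] : uniq [:: a; b; c; d].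
  by rewrite /= !inE !negb_or ab ac ad bc bd cd.
apply: (simplex_face cK sK); last by apply/finset.set0Pn; exists a; rewrite !inE eqxx.
apply/fintype.subsetP => v; rewrite !inE -!orbA => /or4P[] /eqP ->;
by apply: sub; rewrite !inE eqxx ?orbT.
Qed.

Definition cell := {s : {set 'I_n} | (s \in K) && (1 < #|s|)%N}.

Definition incidence := {p : cell * cell | val p.1 \proper val p.2}.

Lemma cell_card (s : cell) : (#|val s| == 2)%N || (#|val s| == 3)%N.
Proof. by have /andP[/simplex_card_le3 h1 h2] := valP s; lia. Qed.

(** Still compact and convex, and for d > 0 free of vertices, so that the angles around the vertices
    lift on it. *)
Definition cut_simplex (d : R) (s : {set 'I_n}) : set 'rV[R]_n :=
  simplex s `&` [set x | forall v, x ord0 v <= 1 - d].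

Lemma cut_simplex_closed d s : closed (cut_simplex d s).
Proof.
have -> : cut_simplex d s = simplex s `&` \bigcap_(v in setT) [set x : 'rV[R]_n | x ord0 v <= 1 - d].
  by apply/seteqP; split => x [h1 h2]; split => //; [move=> v _; exact: h2|move=> v; exact: h2].
apply: closedI; first exact: simplex_closed.
apply: closed_bigI => v _; exact: (@closed_sublevel _ _ (fun x => x ord0 v)) (@coord_cont _ _ v).
Qed.

Lemma cut_simplex_compact d s : compact (cut_simplex d s).
Proof. by apply: barycentric_compact; [exact: cut_simplex_closed|move=> x [[]]]. Qed.

Lemma cut_simplex_star d s x : cut_simplex d s x -> star (cut_simplex d s) x.
Proof.
move=> hx; apply: star_convex => // {hx} x y t [[bx xs] xd] [[by_ ys] yd] t01.
have /andP[t0 t1] := t01.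
split; first split; first exact: barycentric_segment.
  by move=> v vs; rewrite !mxE xs // ys // subrr mulr0 addr0.
by move=> v; rewrite !mxE; have := xd v; have := yd v; nra.
Qed.

Lemma cut_simplexS d (s s' : {set 'I_n}) : s \subset s' -> cut_simplex d s `<=` cut_simplex d s'.
Proof.
move=> ss x [[bx xs] xd]; split => //; split => // v vs; apply: xs.
by apply: contra vs; exact: (fintype.subsetP ss).
Qed.

Lemma simplex_realization s : s \in K -> (simplex s : set 'rV[R]_n) `<=` realization K.
Proof.
move=> sK x xs; apply/realizationE; split; first by case: xs.
apply: (simplex_face cK sK); first exact: carrier_simplex.
by have [v vx] := barycentric_neq0 xs.1; apply/finset.set0Pn; exists v.
Qed.

Lemma coord1_vertex (x : 'rV[R]_n) v : barycentric x -> x ord0 v = 1 -> x = vertex_point R v.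
Proof.
move=> [x0 x1] xv; apply/rowP => w; rewrite vertexE.
have [->|wv] := eqVneq w v; first by rewrite xv.
move: x1; rewrite (bigD1 v) //= xv => /(canRL (addKr _)); rewrite addNr => h.
have /psumr_eq0P h' : forall w, w != v -> 0 <= x ord0 w by [].
by apply: h'.
Qed.

Lemma cut_carrier (d : R) (x : 'rV[R]_n) : 0 < d -> realization K x -> (forall v, x ord0 v <= 1 - d) ->
  (1 < #|carrier x|)%N.
Proof.
move=> d0 /realizationE[bx xK] xd; rewrite ltnNge; apply/negP => c1.
have [v vx] := barycentric_neq0 bx.
have cE : carrier x = [set v]%SET.
  by apply/eqP; rewrite eq_sym eqEcard finset.sub1set vx cards1.
have : x ord0 v = 1.
  rewrite -bx.2 (bigD1 v) //= big1 ?addr0 // => w wv.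
  by apply/eqP; apply: contraNT wv => xw; rewrite -finset.in_set1 -cE mem_carrier.
by have := xd v => /[swap] ->; lra.
Qed.

Lemma fin_pos_bound (I : finType) (f : I -> R) : (forall i, 0 < f i) ->
  exists2 r, 0 < r & forall i, r < f i.
Proof.
move=> f0; suff [r r0 hr] : exists2 r, 0 < r & forall i, i \in enum I -> r < f i.
  by exists r => // i; apply: hr; rewrite mem_enum.
elim: (enum I) => [|i s [r r0 hr]]; first by exists 1.
exists (Num.min r (f i / 2)); first by rewrite lt_min r0 divr_gt0.
move=> j; rewrite inE => /predU1P[->|js]; last by rewrite gt_min hr.
by rewrite gt_min [X in _ || X](_ : _ = true) ?orbT //; have := f0 i; lra.
Qed.

Lemma con_bigU {T U : topologicalType} (I : eqType) (s : seq I) (A : I -> set T) (f : T -> U) :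
  (forall i, i \in s -> closed (A i)) -> (forall i, i \in s -> con (A i) f) ->
  con [set x | exists2 i, i \in s & A i x] f.
Proof.
move=> cA cf.
suff [] : closed [set x | exists2 i, i \in s & A i x] /\ con [set x | exists2 i, i \in s & A i x] f by [].
elim: s cA cf => [|i s IH] cA cf.
  rewrite (_ : [set x | _] = set0); first by split; [exact: closed0|move=> x []].
  by apply/seteqP; split => [x [j]|x []]; rewrite ?in_nil.
have [|| cl co] := IH.
- by move=> j js; apply: cA; rewrite inE js orbT.
- by move=> j js; apply: cf; rewrite inE js orbT.
rewrite (_ : [set x | exists2 i0, i0 \in i :: s & A i0 x] = A i `|` [set x | exists2 i, i \in s & A i x]).
  by split; [apply: closedU => //; apply: cA|apply: conU => //; [apply: cA|apply: cf]]; rewrite inE eqxx.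
apply/seteqP; split => x /=.
  by move=> [j]; rewrite inE => /predU1P[->|js] Aj; [left|right; exists j].
move=> [Ax|[j js Aj]]; first by exists i; rewrite ?inE ?eqxx.
by exists j; rewrite ?inE ?js ?orbT.
Qed.

End Counting.

(** * The Euler inequality from integer relations between angles *)

Section EulerBound.
Context {R : realType} {n : nat}.
Local Open Scope ring_scope.
Local Open Scope classical_set_scope.
Variable K : {set {set 'I_n}}.
Hypothesis cK : simplicial_complex K.
Hypothesis hK : homeomorphic (@realization R n K) (@unit_sphere R).
Local Notation cell := (cell K).
Local Notation incidence := (incidence K).

Lemma not_vertex_carrier (x : 'rV[R]_n) : realization K x -> (forall v, x <> vertex_point R v) ->
  (1 < #|carrier x|)%N.
Proof.
move=> Xx xv; have [bx _] := (realizationE _ _).1 Xx.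
have [v|d d0 hd] := @fin_pos_bound R _ (fun v => 1 - x ord0 v).
  rewrite subr_gt0 lt_neqAle barycentric_le1 // andbT; apply/eqP => h.
  by apply: (xv v); exact: coord1_vertex.
by apply: (cut_carrier d0 Xx) => v; have := hd v; lra.
Qed.

Lemma insub_carrier (x : 'rV[R]_n) : realization K x -> (1 < #|carrier x|)%N ->
  exists2 s : cell, val s = carrier x & insub (carrier x) = Some s.
Proof.
move=> /realizationE[_ xK] x1.
have h : (carrier x \in K) && (1 < #|carrier x|)%N by rewrite xK.
by exists (@exist _ (fun s => (s \in K) && (1 < #|s|)%N) (carrier x) h); rewrite ?insubT.
Qed.

Lemma cell_point (s : cell) : exists x : 'rV[R]_n,
  [/\ realization K x, carrier x = val s & forall v, x <> vertex_point R v].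
Proof.
have /andP[sK s1] := valP s.
have s0 : 0 < #|val s|%:R :> R by rewrite ltr0n (leq_trans _ s1).
pose x : 'rV[R]_n := \row_v (if v \in val s then #|val s|%:R^-1 else 0).
have cx : carrier x = val s.
  apply/setP => v; rewrite mem_carrier mxE; case: ifP => _; last by rewrite eqxx.
  by rewrite invr_eq0 gt_eqF.
exists x; split => //.
  apply/realizationE; rewrite cx; split => //; split=> [v|].
    by rewrite mxE; case: ifP => // _; rewrite invr_ge0 ltW.
  under eq_bigr do rewrite mxE.
  by rewrite -big_mkcond /= sumr_const -[LHS]mulr_natl divff // gt_eqF.
by move=> v xv; move: s1; rewrite -cx xv carrier_vertex cards1.
Qed.

Lemma square_normE (z w : R * R) (r : R) :
  rectangle (z.1 - r) (z.1 + r) (z.2 - r) (z.2 + r) w <-> `|w.1 - z.1| <= r /\ `|w.2 - z.2| <= r.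
Proof. by rewrite /rectangle /= !ler_distl. Qed.

(** Otherwise there are more unknowns (a weight lam for each vertex but v0, an integer gam for each
    cell) than equations (one for each incidence, and sum gam = 0), hence a nonzero integer
    solution. It makes the weighted sums of angles, shifted by -2 pi gam, agree across cells. Small
    loops around the vertices force lam = 0, connectedness then makes gam constant, and the extra
    equation makes it 0. *)
Lemma euler_bound (v0 : 'I_n) : (n.-1 + #|{: cell}| <= #|{: incidence}|.+1)%N.
Proof.
rewrite leqNgt; apply/negP => too_many.
have p20 : 0 < 2 * pi :> R by rewrite mulr_gt0 // pi_gt0.
have t2 := @tpz_2pi R.
pose p' : 'rV[R]_n := vertex_point R v0.
have [zx [zy [kap [[czx czy] ck kX zk kz]]]] := plane_chart hK (vertex_realization cK v0).
pose J := {i : 'I_n | i != v0}.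
have cardJ : #|{: J}| = n.-1.
  by rewrite card_sig -[n in RHS]card_ord (cardC1 v0).
pose z (i : J) : R * R := (zx (vertex_point R (val i)), zy (vertex_point R (val i))).
have vert_inj (v w : 'I_n) : vertex_point R v = vertex_point R w -> v = w.
  move=> /(congr1 (fun x : 'rV[R]_n => x ord0 v)); rewrite !vertexE eqxx.
  by case: eqP => // _ /eqP; rewrite oner_eq0.
have kapz i : kap (z i) = vertex_point R (val i).
  apply: kz; split; first exact: vertex_realization.
  by move=> /vert_inj/eqP; rewrite (negPf (valP i)).
have zinj i j : z i = z j -> i = j.
  by move=> /(congr1 kap); rewrite !kapz => /vert_inj /val_inj.
have kap_vertex w (v : 'I_n) : kap w = vertex_point R v -> exists2 i : J, val i = v & w = z i.
  move=> kw; have v0' : v != v0.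
    by apply/eqP => h; have [_ /=] := kX w; rewrite kw h.
  exists (exist _ v v0') => //.
  by rewrite -(zk w) kw.
have [|r r0 hr] := @fin_pos_bound R _ (fun ij : J * J =>
    if ij.1 == ij.2 then 1 else Num.max `|(z ij.2).1 - (z ij.1).1| `|(z ij.2).2 - (z ij.1).2|).
  move=> [i j] /=; case: eqP => // ij; rewrite lt_max !normr_gt0 !subr_eq0 -negb_and.
  apply/negP => /andP[/eqP h1 /eqP h2]; apply/ij/esym/zinj.
  have h1' : (z j).1 = (z i).1 := h1; have h2' : (z j).2 = (z i).2 := h2.
  by rewrite (surjective_pairing (z j)) h1' h2' -surjective_pairing.
have sep i j : `|(z j).1 - (z i).1| <= r -> `|(z j).2 - (z i).2| <= r -> i = j.
  move=> h1 h2; apply/eqP; apply: contraT => ij; have := hr (i, j); rewrite /= (negPf ij).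
  by rewrite lt_max => /orP[]; rewrite ltNge ?h1 ?h2.
pose g i t := kap (circle (z i) r t).
have cg i : continuous (g i).
  by move=> t; apply: continuous_comp; [exact: circle_continuous|exact: ck].
have gv i t (v : 'I_n) : g i t <> vertex_point R v.
  move=> /kap_vertex[j _ cj].
  have [h1 h2] := circle_near (z i) t (ltW r0).
  have ij : i = j by apply: sep; rewrite -cj.
  move: cj; rewrite -ij => /(congr1 (fun w => (w.1 - (z i).1) ^+ 2 + (w.2 - (z i).2) ^+ 2)).
  rewrite /circle /= !subrr expr0n addr0 ![_ + _ * _ - _]addrAC !subrr !add0r.
  rewrite !exprMn -mulrDr cos2Dsin2 mulr1 => /eqP.
  by rewrite sqrf_eq0 gt_eqF.
have gX i t : realization K (g i t) by have [] := kX (circle (z i) r t).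
have maxs (iv : J * 'I_n) : exists m : R, m < 1 /\ forall t, 0 <= t <= 2 * pi -> g iv.1 t ord0 iv.2 <= m.
  have cgv : continuous (fun t => g iv.1 t ord0 iv.2).
    by move=> t; apply: (@continuous_comp _ _ _ (g iv.1) (fun x : 'rV[R]_n => x ord0 iv.2)); [exact: cg|exact: coord_cont].
  have [tM _ tmax] := EVT_max (ltW p20) (continuous_subspaceT cgv).
  exists (g iv.1 tM ord0 iv.2); split; last by move=> t ht; apply: tmax; rewrite in_itv.
  have [bg _] := (realizationE _ _).1 (gX iv.1 tM).
  rewrite lt_neqAle barycentric_le1 // andbT; apply/eqP => /(coord1_vertex bg).
  exact: gv.
have [M HM] := choice maxs.
(* No coordinate reaches 1 on the compact loops, so one d keeps all of them inside the cut cells. *)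
have [|d d0 hd] := @fin_pos_bound R _ (fun iv => 1 - M iv).
  by move=> iv; rewrite subr_gt0; have [] := HM iv.
have gd i t v : 0 <= t <= 2 * pi -> g i t ord0 v <= 1 - d.
  by move=> ht; have [_ /(_ t ht)] := HM (i, v); have := hd (i, v) => /=; lra.
pose cut (s : cell) : set 'rV[R]_n := cut_simplex d (val s).
have cutX s : cut s `<=` realization K `\ p'.
  move=> x [xs xd]; split.
    by apply: (simplex_realization cK _ xs); have /andP[] := valP s.
  by move=> xp; have := xd v0; rewrite xp /= vertexE eqxx mulr1n; lra.
pose zX (i : J) x := zx x - (z i).1.
pose zY (i : J) x := zy x - (z i).2.
have z0 s i x : cut s x -> (zX i x, zY i x) <> (0, 0).
  move=> hx [/eqP + /eqP]; rewrite !subr_eq0 => /eqP h1 /eqP h2.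
  have := kz x (cutX s x hx); rewrite h1 h2 -surjective_pairing kapz => xi.
  by have := hx.2 (val i); rewrite -xi vertexE eqxx mulr1n; lra.
have cz s i : con (cut s) (zX i) /\ con (cut s) (zY i).
  by split; apply: conB; try exact: con_cst; [apply: con_sub czx|apply: con_sub czy]; exact: cutX.
have lifts (si : cell * J) : exists th, polar_lift (cut si.1) (zX si.2) (zY si.2) th.
  have [[a ha]|em] := pselect (exists a, cut si.1 a).
    exact: (polar_lift_star (@cut_simplex_compact _ _ _ _) (cut_simplex_star ha) (cz _ _).1 (cz _ _).2 (@z0 _ _)).
  (* A cut cell may be empty, and then any function is a lift. *)
  by exists (fun=> 0); split => x hx; exfalso; apply: em; exists x.
have [th Hth] := choice lifts.
have jumps (pi_ : incidence * J) : exists k : int, forall x, cut (val pi_.1).1 x ->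
    th ((val pi_.1).2, pi_.2) x - th ((val pi_.1).1, pi_.2) x = k%:~R * (2 * pi).
  case: pi_ => [[[e tau] /= etau] i] /=.
  have sub : cut e `<=` cut tau by apply: cut_simplexS; exact: proper_sub.
  have [[a ha]|em] := pselect (exists a, cut e a); last first.
    by exists 0 => x hx; exfalso; apply: em; exists x.
  have tz x : cut e x -> tpz (th (tau, i) x - th (e, i) x).
    move=> hx; apply: (polar_tpz (@z0 e i x hx)); first exact: (Hth (tau, i)).2 (sub x hx).
    exact: (Hth (e, i)).2 hx.
  have [k hk] := tz a ha; exists k => x hx; rewrite -hk.
  apply: (tpz_star (f := fun x => th (tau, i) x - th (e, i) x) (cut_simplex_star ha)) => //.
  by apply: conB; [apply: con_sub sub (Hth (tau, i)).1|exact: (Hth (e, i)).1].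
have [k Hk] := choice jumps.
pose mat (u : J + cell) (o : option incidence) : int :=
  match u, o with
  | inl i, Some q => k (q, i) | inl i, None => 0
  | inr s, Some q => (s == (val q).1)%:R - (s == (val q).2)%:R | inr s, None => 1
  end.
have [|c [[u0 cu0] ceq]] := @int_kernel _ _ mat.
  by rewrite card_option card_sum cardJ.
pose lam i := c (inl i); pose gam s := c (inr s).
have pick (s0 : cell) : \sum_s c (inr s) * (s == s0)%:R = gam s0.
  by rewrite (bigD1 s0) //= eqxx mulr1 big1 ?addr0 // => s /negPf ->; rewrite mulr0.
have eq1 (q : incidence) : \sum_i lam i * k (q, i) + gam (val q).1 - gam (val q).2 = 0.
  have := ceq (Some q); rewrite big_sumType /= => h.
  rewrite -[RHS]h -addrA; congr (_ + _).
  under eq_bigr do rewrite mulrBr.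
  by rewrite sumrB !pick.
have eq2 : \sum_s gam s = 0.
  have := ceq None; rewrite big_sumType /= big1 ?add0r; last by move=> i _; rewrite mulr0.
  by move=> h; rewrite -[RHS]h; apply: eq_bigr => s _; rewrite mulr1.
pose Ths s x : R := \sum_i (lam i)%:~R * th (s, i) x - (gam s)%:~R * (2 * pi).
(* Evaluated on the smallest cell containing x; the incidence equations give the same value on every
   other cut cell through x. *)
pose Th x : R := if insub (carrier x) is Some s then Ths s x else 0.
have Th_cut s x : cut s x -> Th x = Ths s x.
  move=> hx; have Xx := (cutX s x hx).1.
  have [s' s'E inE_] := insub_carrier Xx (cut_carrier d0 Xx hx.2).
  rewrite /Th inE_.
  have sub : val s' \subset val s by rewrite s'E; exact: carrier_simplex hx.1.
  have [->//|ss] := eqVneq s' s.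
  have pr : val s' \proper val s by rewrite finset.properEneq sub andbT (inj_eq val_inj).
  pose q : incidence := @exist _ (fun p : cell * cell => val p.1 \proper val p.2) (s', s) pr.
  have hx' : cut s' x.
    by split; [rewrite s'E; apply: simplex_carrier; case: hx => [[]]|exact: hx.2].
  have hq i := Hk (q, i) x hx'.
  rewrite /Ths; apply/eqP; rewrite -subr_eq0; apply/eqP.
  have -> : \sum_i (lam i)%:~R * th (s, i) x = \sum_i (lam i)%:~R * th (s', i) x +
     (\sum_i lam i * k (q, i))%:~R * (2 * pi).
    rewrite rmorph_sum mulr_suml -big_split /=; apply: eq_bigr => i _.
    by rewrite intrM -mulrA -hq /=; ring.
  have := eq1 q => /(canRL (subrK _)); rewrite add0r => /(canRL (addrK _)) -> /=.
  by rewrite intrD mulrNz; ring.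
pose Y := [set x | exists2 s : cell, s \in enum {: cell} & cut s x].
have cTh : con Y Th.
  apply: con_bigU => s _; first exact: cut_simplex_closed.
  apply: (con_ext (f := Ths s)) => [x hx|]; first by rewrite (Th_cut s).
  apply: conB; last exact: con_cst.
  by apply: con_sum => i; apply: conM; [exact: con_cst|exact: (Hth (s, i)).1].
have gcut i t : 0 <= t <= 2 * pi -> exists s, cut s (g i t).
  move=> ht; have gdv v := gd i t v ht.
  have [s sE _] := insub_carrier (gX i t) (cut_carrier d0 (gX i t) gdv).
  exists s; split; last exact: gdv.
  by rewrite sE; apply: simplex_carrier; have [] := (realizationE _ _).1 (gX i t).
have g2pi i : g i (2 * pi) = g i 0 by rewrite /g circle_2pi.
(* Around z i, the angle seen from z i turns once and the other angles do not. *)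
have lam0 i : lam i = 0.
  pose sq : set (R * R) := rectangle ((z i).1 - r) ((z i).1 + r) ((z i).2 - r) ((z i).2 + r).
  have csq t : sq (circle (z i) r t).
    by apply/square_normE; exact: circle_near (ltW r0).
  have arg j : exists a : R -> R, [/\ con `[0, 2 * pi] a,
     a (2 * pi) - a 0 = if j == i then 2 * pi else 0 &
     forall t, polar (zX j (g i t)) (zY j (g i t)) (a t)].
    have gzE t : zX j (g i t) = (circle (z i) r t).1 - (z j).1 /\ zY j (g i t) = (circle (z i) r t).2 - (z j).2.
      by rewrite /zX /zY /g; have := zk (circle (z i) r t); case: (circle _ _ _) => ? ? [-> ->].
    have [->|ji] := eqVneq j i.
      exists id; split; [by apply: con_continuous => t; exact: cvg_id|by rewrite subr0|move=> t].
      apply: (polar_scale r0); rewrite /zX /zY /g.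
        by have := congr1 fst (zk (circle (z i) r t)) => /= ->; rewrite addrAC subrr add0r.
      by have := congr1 snd (zk (circle (z i) r t)) => /= ->; rewrite addrAC subrr add0r.
    have le1 : (z i).1 - r <= (z i).1 + r by rewrite lerD2l ge0_cp // ltW.
    have le2 : (z i).2 - r <= (z i).2 + r by rewrite lerD2l ge0_cp // ltW.
    have nz w : sq w -> (w.1 - (z j).1, w.2 - (z j).2) <> (0, 0).
      move=> /square_normE[a1 a2] [/eqP + /eqP]; rewrite !subr_eq0 => /eqP h1 /eqP h2.
      have ij : i = j by apply: sep; [move: a1; rewrite h1|move: a2; rewrite h2].
      by move: ji; rewrite ij eqxx.
    have [a [ca pa]] := @polar_lift_star R (R * R)%type sq _ (fun w => w.1 - (z j).1) (fun w => w.2 - (z j).2)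
      (@rectangle_compact _ _ _ _ _) (rectangle_star le1 le2)
      (conB (con_continuous fst_cont) (@con_cst _ _ _ _)) (conB (con_continuous snd_cont) (@con_cst _ _ _ _)) nz.
    exists (fun t => a (circle (z i) r t)); split.
    - by apply: con_comp ca => //; apply: con_continuous; exact: circle_continuous.
    - by rewrite circle_2pi subrr.
    - by move=> t; have [-> ->] := gzE t; apply: pa; exact: csq.
  have [a Ha] := choice arg.
  have := @tpz_segment R (fun t => Th (g i t) - \sum_j (lam j)%:~R * a j t) 0 (2 * pi) (ltW p20).
  rewrite g2pi => H.
  have {}H : Th (g i 0) - \sum_j (lam j)%:~R * a j (2 * pi) = Th (g i 0) - \sum_j (lam j)%:~R * a j 0.
    apply: H.
      apply: conB; last first.
        by apply: con_sum => j; apply: conM; [exact: con_cst|have [] := Ha j].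
      apply: (con_comp (A := Y)) cTh; first exact: con_continuous.
      move=> t /=; rewrite in_itv /= => /(gcut i)[s hs]; exists s => //.
      by rewrite mem_enum.
    move=> t /(gcut i)[s hs]; rewrite (Th_cut s) // /Ths addrAC -sumrB.
    apply: tpzB; last by apply: tpzM.
    apply: tpz_sum => j; rewrite -mulrBr; apply: tpzM.
    apply: (polar_tpz (@z0 s j _ hs)); first exact: (Hth (s, j)).2.
    by have [] := Ha j.
  have {}H : \sum_j (lam j)%:~R * (a j (2 * pi) - a j 0) = 0.
    under eq_bigr do rewrite mulrBr; rewrite sumrB; apply/eqP; rewrite subr_eq0; apply/eqP.
    by have /(congr1 -%R) := H; rewrite !opprB => /addIr.
  move: H; rewrite (bigD1 i) //= big1 ?addr0; last first.
    by move=> j ji; have [_ -> _] := Ha j; rewrite (negPf ji) mulr0.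
  have [_ -> _] := Ha i; rewrite eqxx => /eqP; rewrite mulf_eq0 (gt_eqF p20) orbF intr_eq0.
  by move/eqP.
have gam_inc (q : incidence) : gam (val q).1 = gam (val q).2.
  have := eq1 q; rewrite big1 ?add0r; last by move=> i _; rewrite lam0 mul0r.
  by move/eqP; rewrite subr_eq0 => /eqP.
(* Near a point the carrier can only grow, so the cell of w is contained in that of a nearby point
   and gam agrees along the incidence: f is locally constant off the vertices. *)
pose f w : int := if insub (carrier (kap w)) is Some s then gam s else 0.
pose Z := [seq z i | i <- enum {: J}].
have notZ w : w \notin Z -> forall v, kap w <> vertex_point R v.
  move=> wZ v /kap_vertex[i _ wz]; move: wZ; rewrite wz => /negP; apply.
  by apply/mapP; exists i; rewrite ?mem_enum.
have kapcell w : w \notin Z -> exists2 s : cell, val s = carrier (kap w) & f w = gam s.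
  move=> /notZ wv; have Xw := (kX w).1.
  have [s sE sI] := insub_carrier Xw (not_vertex_carrier Xw wv).
  by exists s => //; rewrite /f sI.
have floc w : w \notin Z -> \forall w' \near w, f w' = f w.
  move=> wZ; have [s sE ->] := kapcell w wZ.
  have : \forall w' \near w, forall v, kap w ord0 v != 0 -> kap w' ord0 v != 0.
    apply: (@filter_forall _ _ (fun v => [set w' | kap w ord0 v != 0 -> kap w' ord0 v != 0]) (nbhs w)) => v.
    have [k0|kv] := eqVneq (kap w ord0 v) 0; first by apply: filterE.
    have cv : (fun w' => kap w' ord0 v) @ w --> kap w ord0 v.
      by apply: (@continuous_comp _ _ _ kap (fun x : 'rV[R]_n => x ord0 v)); [exact: ck|exact: coord_cont].
    have kv' : 0 < `|kap w ord0 v| by rewrite normr_gt0.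
    have /cvgrPdist_lt/(_ _ kv') := cv; apply: filterS => w' h _.
    by apply/eqP => k0; move: h; rewrite k0 subr0 ltxx.
  apply: filterS => w' hw.
  have sub : val s \subset carrier (kap w').
    by rewrite sE; apply/fintype.subsetP => v; rewrite !mem_carrier; exact: hw.
  have c1 : (1 < #|carrier (kap w')|)%N.
    by apply: leq_trans (subset_leq_card sub); have /andP[] := valP s.
  have [s' s'E s'I] := insub_carrier (kX w').1 c1.
  rewrite /f s'I; have [->//|ss] := eqVneq s' s.
  have pr : val s \proper val s' by rewrite finset.properEneq s'E sub andbT -s'E eq_sym (inj_eq val_inj).
  by have := gam_inc (@exist _ (fun p : cell * cell => val p.1 \proper val p.2) (s, s') pr).
have gam_cst s s' : gam s = gam s'.
  have val_of s1 : exists2 w, w \notin Z & f w = gam s1.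
    have [x [Xx cx xv]] := cell_point s1.
    have Xx' : (realization K `\ p') x by split => //; exact: xv.
    have kx := kz x Xx'.
    have wZ : (zx x, zy x) \notin Z.
      by apply/mapP => -[i _ h]; apply: (xv (val i)); rewrite -kx h kapz.
    exists (zx x, zy x) => //; have [s2 s2E ->] := kapcell _ wZ.
    by congr gam; apply: val_inj; rewrite s2E kx.
  have [w wZ <-] := val_of s; have [w' wZ' <-] := val_of s'.
  exact: plane_minus_finite floc _ _ wZ wZ'.
have gam0 s : gam s = 0.
  have := eq2; rewrite (eq_bigr (fun=> gam s)); last by move=> s' _; exact: gam_cst.
  rewrite sumr_const => /eqP; rewrite mulrn_eq0 => /orP[/eqP c0|/eqP//].
  by have := max_card (pred1 s); rewrite card1 c0.
by case: u0 cu0 => [i|s]; rewrite -/(lam _) -/(gam _) ?lam0 ?gam0 eqxx.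
Qed.

End EulerBound.

(** * From incidences to the number of edges *)

Section EdgeCount.
Context {R : realType} {n : nat}.
Variable K : {set {set 'I_n}}.
Hypothesis cK : simplicial_complex K.
Hypothesis hK : homeomorphic (@realization R n K) (@unit_sphere R).

Lemma card_incidence : #|{: incidence K}| =
  (\sum_(s : cell K) #|[pred s' : cell K | val s \proper val s']|)%N.
Proof.
rewrite card_sig -sum1_card.
rewrite -(pair_big_dep xpredT (fun s s' : cell K => val s \proper val s') (fun _ _ => 1%N)) /=.
by apply: eq_bigr => s _; rewrite -sum1_card.
Qed.

Lemma card_incidence' : #|{: incidence K}| =
  (\sum_(s' : cell K) #|[pred s : cell K | val s \proper val s']|)%N.
Proof.
rewrite card_incidence (eq_bigr (fun s : cell K => \sum_(s' : cell K) (val s \proper val s'))%N).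
  rewrite exchange_big /=; apply: eq_bigr => s' _.
  by rewrite -sum1_card [RHS]big_mkcond /=; apply: eq_bigr => s _; rewrite inE; case: (_ \proper _).
by move=> s _; rewrite -sum1_card big_mkcond /=; apply: eq_bigr => s' _; rewrite ?inE; case: (_ \proper _).
Qed.

Lemma triangle_edges (s' : cell K) :
  (#|[pred s : cell K | val s \proper val s']| <= 3 * (#|val s'| == 3))%N.
Proof.
have [s3|s3] := eqVneq #|val s'| 3%N.
  rewrite -(fintype.card_image val_inj) muln1.
  have <- : #|[set A : {set 'I_n} | A \subset val s' & #|A| == 2%N]| = 3%N.
    by rewrite cards_draws s3.
  apply: subset_leq_card; apply/fintype.subsetP => A /fintype.imageP[s sP ->].
  rewrite inE in sP; rewrite inE (proper_sub sP) /=.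
  have := proper_card sP; rewrite s3; have /andP[_] := valP s.
  by case: #|_| => [|[|[|]]].
rewrite muln0 leqn0; apply/eqP/eq_card0 => s; rewrite !inE; apply/negP => /proper_card.
have /andP[_ h] := valP s; have := cell_card cK hK s'; rewrite (negPf s3) orbF => /eqP ->.
by rewrite ltnNge h.
Qed.

Lemma edge_triangles (s : cell K) :
  (#|[pred s' : cell K | val s \proper val s']| <= 2 * (#|val s| == 2))%N.
Proof.
have [s2|s2] := eqVneq #|val s| 2%N; last first.
  rewrite muln0 leqn0; apply/eqP/eq_card0 => s'; rewrite !inE; apply/negP => /proper_card.
  have := cell_card cK hK s; rewrite (negPf s2) /= => /eqP ->.
  have /andP[h _] := valP s'; by rewrite ltnNge (simplex_card_le3 cK hK h).
rewrite muln1 leqNgt; apply/negP => /card_gt2P[s1 [s1' [s1'' [[h1 h2 h3] [d1 d2 d3]]]]].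
have /eqP/cards2P[a [b [ab sE]]] := s2.
have third (t : cell K) : t \in [pred s' : cell K | val s \proper val s'] ->
    exists c, [/\ a != c, b != c & val t = [set a; b; c]%SET].
  rewrite inE => st; have [sub _] := andP st.
  have t3 : #|val t| = 3%N.
    have := proper_card st; have := cell_card cK hK t; rewrite s2.
    by case/orP => /eqP ->.
  have : #|val t :\: val s|%SET == 1%N by rewrite cardsD (finset.setIidPr sub) t3 s2.
  case/cards1P => c cE; exists c.
  have /finset.setDP[ct cs] : c \in (val t :\: val s)%SET by rewrite cE inE.
  move: cs; rewrite sE !inE negb_or => /andP[ca cb]; split; rewrite 1?eq_sym //.
  apply/eqP; rewrite eq_sym eqEcard; apply/andP; split.
    rewrite sE in sub; apply/fintype.subsetP => v; rewrite !inE -orbA => /or3P[] /eqP -> //;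
    by apply: (fintype.subsetP sub); rewrite !inE eqxx ?orbT.
  by rewrite t3 finset.setUC cardsU1 cards2 ab !inE negb_or ca cb.
have [c1 [ac1 bc1 E1]] := third _ h1; have [c2 [ac2 bc2 E2]] := third _ h2.
have [c3 [ac3 bc3 E3]] := third _ h3.
have inK (t : cell K) : val t \in K by have /andP[] := valP t.
have neq (t t' : cell K) c c' : t != t' -> val t = [set a; b; c]%SET -> val t' = [set a; b; c']%SET -> c != c'.
  move=> tt tE tE'; apply: contra tt => /eqP cc; apply/eqP/val_inj.
  by rewrite tE tE' cc.
apply: (@no_book R n K cK hK a b c1 c2 c3).
- rewrite /= !inE !negb_or ab ac1 ac2 ac3 bc1 bc2 bc3.
  by rewrite (neq _ _ _ _ d1 E1 E2) (neq _ _ _ _ d2 E2 E3) eq_sym (neq _ _ _ _ d3 E3 E1).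
- by rewrite -E1.
- by rewrite -E2.
- by rewrite -E3.
Qed.

Lemma edges_enough : (3 * n <= #|{: edge K}| + 6)%N.
Proof.
have [n0|n0] := posnP n; first by rewrite {1}n0 muln0.
have v0 : 'I_n by exact: Ordinal n0.
have euler := euler_bound cK hK v0.
have I3 : (#|{: incidence K}| <= 3 * #|[pred s : cell K | #|val s| == 3]|)%N.
  rewrite card_incidence' -[X in (_ <= 3 * X)%N]sum1_card [X in (_ <= 3 * X)%N]big_mkcond big_distrr /=; apply: leq_sum => s' _.
  by apply: leq_trans (triangle_edges s') _; rewrite inE; case: (_ == 3%N).
have I2 : (#|{: incidence K}| <= 2 * #|[pred s : cell K | #|val s| == 2]|)%N.
  rewrite card_incidence -[X in (_ <= 2 * X)%N]sum1_card [X in (_ <= 2 * X)%N]big_mkcond big_distrr /=; apply: leq_sum => s _.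
  by apply: leq_trans (edge_triangles s) _; rewrite inE; case: (_ == 2%N).
have cells : #|{: cell K}| = (#|[pred s : cell K | #|val s| == 2]| + #|[pred s : cell K | #|val s| == 3]|)%N.
  rewrite -(cardC [pred s : cell K | #|val s| == 2]); congr (_ + _)%N.
  apply: eq_card => s; rewrite !inE; have := cell_card cK hK s.
  by case: (boolP (_ == 2%N)) => [/eqP ->|].
have E : (#|[pred s : cell K | #|val s| == 2]| <= #|{: edge K}|)%N.
  rewrite card_sig -(fintype.card_image val_inj); apply: subset_leq_card.
  apply/fintype.subsetP => A /fintype.imageP[s sP ->]; rewrite inE in sP.
  by rewrite inE sP andbT; have /andP[] := valP s.
(* With I incidences, E edges and F triangles: n + E + F <= I + 2 and I <= 3 F give 3 n + 3 E <= 2 I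
   + 6, and I <= 2 E bounds this by 4 E + 6. *)
lia.
Qed.

End EdgeCount.

Local Open Scope classical_set_scope.

Theorem theorem1p6 (R : realType) (n : nat) (K : {set {set 'I_n}})
    (conv : angle_convention) :
  sphere_triangulation R K -> (4 < n)%N ->
  almost_every_in (@W R n K)
    [set Theta : {ffun edge K -> R} | finite_up_to (@moebius_equiv R n)
       [set P : 'I_n -> disk R | [/\ circle_pattern P, irreducible P
                  & realizes conv Theta P]]].
Proof.
move=> [cK hK] n4; apply: generic_finiteness => //.
exact: edges_enough hK.
Qed.
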